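(* For real binary forms of degree $8$, the real rank boundaries are the following hypersurfaces of $\mathbb{P}(\mathbb{C}[x,y]_8)\cong\mathbb{P}^8_{\mathbb{C}}$: \begin{align*} \partial_{\mathrm{alg}}(\mathcal{R}_{8,5}) &= (\Delta_{(3,3,2)})^\vee\cup(\Delta_{(4,2,2)})^\vee,\\ \partial_{\mathrm{alg}}(\mathcal{R}_{8,6}) &= (\Delta_{(3,3,2)})^\vee\cup(\Delta_{(4,2,2)})^\vee\cup(\Delta_{(4,4)})^\vee\cup(\Delta_{(5,3)})^\vee\cup(\Delta_{(6,2)})^\vee,\\ \partial_{\mathrm{alg}}(\mathcal{R}_{8,7}) &= (\Delta_{(4,4)})^\vee\cup(\Delta_{(5,3)})^\vee\cup(\Delta_{(6,2)})^\vee\cup(\Delta_{(8)})^\vee,\\ \partial_{\mathrm{alg}}(\mathcal{R}_{8,8}) &= (\Delta_{(8)})^\vee. \end{align*}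
   Context: Let $R=\mathbb{R}[x,y]$ and $R_d$ its space of binary forms of degree $d$. The real rank $\mathrm{rk}(f)$ of $f\in R_d$ is the least $r$ such that $f=\sum_{i=1}^r c_i l_i^d$ with $l_i\in R_1$, $c_i\in\mathbb{R}$. Let $\Omega_{d,r}=\{f\in R_d:\mathrm{rk}(f)=r\}$ and let $\mathcal{R}_{d,r}$ be the interior of $\Omega_{d,r}$ in the Euclidean topology (nonempty exactly when $\frac{d+1}{2}\le r\le d$). The topological boundary $\partial(\mathcal{R}_{d,r})$ is the closure of $\mathcal{R}_{d,r}$ minus the interior of the closure of $\mathcal{R}_{d,r}$; the real rank boundary $\partial_{\mathrm{alg}}(\mathcal{R}_{d,r})$ is the Zariski closure of $\partial(\mathcal{R}_{d,r})$, regarded as a hypersurface in the complex projective space $\mathbb{P}(\mathbb{C}[x,y]_d)$ (with coordinates $(a_0,\dots,a_d)$ for $f=\sum_i\binom{d}{i}a_ix^{d-i}y^i$). Let $\mathbb{C}[u,v]=\mathbb{C}[\partial_x,\partial_y]$ act on $\mathbb{C}[x,y]$ by differentiation, giving a perfect pairing $\mathbb{C}[x,y]_d\otimes\mathbb{C}[u,v]_d\to\mathbb{C}$. For a partition $\lambda=(\lambda_1,\dots,\lambda_n)$ of $d$, the coincident root locus $\Delta_\lambda\subset\mathbb{P}(\mathbb{C}[u,v]_d)$ is the set of forms that factor as $\prod_{i=1}^n\ell_i^{\lambda_i}$ with $\ell_i\in\mathbb{C}[u,v]_1$. Its dual variety $(\Delta_\lambda)^\vee\subset\mathbb{P}(\mathbb{C}[x,y]_d)$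 is the closure of the set of $f$ (viewed as hyperplanes via the pairing) containing the embedded tangent space $T_g\Delta_\lambda$ at some smooth point $g$ of $\Delta_\lambda$; equivalently, $(\Delta_\lambda)^\vee$ consists of the $f\in\mathbb{C}[x,y]_d$ annihilated by some differential operator $\prod_{i=1}^n\ell_i^{\lambda_i-1}(\partial_x,\partial_y)$ with $\ell_i\in\mathbb{C}[u,v]_1$. *)

(* Defs.v *)
From HB Require Import structures.
From mathcomp Require Import all_boot all_order all_algebra.
From mathcomp Require Import all_classical all_reals all_analysis.
From mathcomp Require Import complex.
From mathcomp Require mpoly.
From mathcomp Require Import Rstruct Rstruct_topology.


Import Order.TTheory GRing.Theory Num.Theory.
Local Open Scope ring_scope.
Local Open Scope classical_set_scope.

Notation RR := Rdefinitions.R.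
Notation CC := (RR[i]).

(* Binary forms over a ring K are represented as elements of
   {poly {poly K}} : the outer variable 'X is y, the inner variable is x. *)
Definition varx {K : nzRingType} : {poly {poly K}} := ('X : {poly K})%:P.
Definition vary {K : nzRingType} : {poly {poly K}} := 'X.
Definition cst {K : nzRingType} (c : K) : {poly {poly K}} := c%:P%:P.

Definition form_of {K : nzRingType} {d : nat} (a : 'rV[K]_d.+1) : {poly {poly K}} :=
  \sum_(i < d.+1) cst ('C(d, i)%:R * a 0 i) * varx ^+ (d - i) * vary ^+ i.

Definition linform {K : nzRingType} (p q : K) : {poly {poly K}} :=
  cst p * varx + cst q * vary.

Definition waring_decomp (d r : nat) (a : 'rV[RR]_d.+1) : Prop :=
  exists (c p q : 'I_r -> RR),
    form_of a = \sum_(k < r) cst (c k) * linform (p k) (q k) ^+ d.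

Definition real_rank_eq (d r : nat) (a : 'rV[RR]_d.+1) : Prop :=
  waring_decomp d r a /\ forall r', (r' < r)%N -> ~ waring_decomp d r' a.

Definition Omega (d r : nat) : set 'rV[RR]_d.+1 := [set a | real_rank_eq d r a].
Definition Rdr (d r : nat) : set 'rV[RR]_d.+1 := interior (Omega d r).
Definition top_boundary (d r : nat) : set 'rV[RR]_d.+1 :=
  closure (Rdr d r) `\` interior (closure (Rdr d r)).

Definition complexify {n : nat} (a : 'rV[RR]_n) : 'rV[CC]_n :=
  map_mx (fun x : RR => (x%:C)%C) a.

(* Zariski closure over C (in affine space C^n, i.e. on affine cones) of a
   set of real points: common zero set of all complex polynomials in the
   coordinates that vanish on it. *)
Definition zariski_closure {n : nat} (S : set 'rV[RR]_n) : set 'rV[CC]_n :=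
  [set z | forall P : mpoly.mpoly n CC,
      (forall a, S a -> mpoly.meval (fun i => complexify a 0 i) P = 0) ->
      mpoly.meval (fun i => z 0 i) P = 0].

(* Real rank boundary (as an affine cone in C^(d+1)). *)
Definition rank_boundary (d r : nat) : set 'rV[CC]_d.+1 :=
  zariski_closure (top_boundary d r).

Definition ddx {K : nzRingType} (f : {poly {poly K}}) : {poly {poly K}} :=
  map_poly (@deriv K) f.
Definition ddy {K : nzRingType} (f : {poly {poly K}}) : {poly {poly K}} :=
  deriv f.

Definition lin_op {K : nzRingType} (l : K * K) (f : {poly {poly K}}) :=
  cst l.1 * ddx f + cst l.2 * ddy f.

Definition crl_op {K : nzRingType} (lam : seq nat) (ls : seq (K * K))
  (f : {poly {poly K}}) : {poly {poly K}} :=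
  foldr (fun kl g => iter kl.1.-1 (lin_op kl.2) g) f (zip lam ls).

(* Affine cone over the dual variety (Delta_lambda)^vee of the coincident
   root locus Delta_lambda in P(C[u,v]_d): the forms f in C[x,y]_d
   annihilated by prod_i l_i^(lambda_i - 1)(d_x,d_y) for some nonzero
   linear forms l_i in C[u,v]_1. *)
Definition dual_crl (d : nat) (lam : seq nat) : set 'rV[CC]_d.+1 :=
  [set z | exists ls : seq (CC * CC),
      size ls = size lam /\ all (fun l => l != (0, 0)) ls /\
      crl_op lam ls (form_of z) = 0].

(* Main.v *)
(* A form of degree 8 is a linear functional L on polynomials of degree at most 8, and by
   apolarity it has real rank at most r iff L vanishes on the multiples (of degree at most 8)
   of some real polynomial of degree r with distinct roots, points at infinity allowed.

   Upper bound: by compactness a limit of forms of rank at most r is apolar to a real-rooted h of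
   degree r. Choosing h with the most distinct roots, either its roots are simple and the form is
   interior, or h has at most n = 8 - r distinct roots, so that the form lies on one of the
   hypersurfaces; these are Zariski closed by elimination theory.

   Lower bound: for each partition there is an explicit form a0 whose only apolar real-rooted
   polynomial of degree r is prod (X - rho_i)^(mu_i). If a form near a0 is apolar to a product h of
   the same shape, separating the multiple roots of h makes it a limit of forms of rank r. On the
   other hand, splitting a root of multiplicity m >= 2 changes the centred factor X^m into
   X^m + e T with e < 0 to first order, and a sign condition on a0 then makes L nonpositive on
   every nearby real-rooted polynomial of degree r times suitable linear factors; subtracting
   eps y^8 makes it negative, so such forms have rank at least r + 1. Hence these real points
   form an open set of the parameter space of the hypersurface, and are Zariski dense in it. *)

(* For r + n = 8 the locus [dual r n] is the wall between real ranks r and r + 1, so each family of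
   partitions occurs in two consecutive boundaries: n = 3 for ranks 5 and 6, n = 2 for 6 and 7, n =
   1 for 7 and 8. There is no wall above rank 8, the maximal rank, and none below rank 5: rank at
   most 4 makes the 5 x 5 Hankel determinant vanish, so such forms have empty interior. This is why
   (2,2,2,2) is absent. The sign argument is local in the roots, whereas rank at least r + 1 must
   exclude all real-rooted polynomials. Hence the base form needs a single apolar real-rooted
   polynomial of degree r; compactness of the projective line then leaves only its neighbours. The
   six base forms are such that uniqueness follows from Newton's inequalities, quadratic conditions
   on the coefficients which the linear apolarity equations turn into sums of squares of the wrong
   sign. For density one real point suffices: roots and initial moments parametrise the hypersurface
   polynomially as long as the roots are finite. Roots at infinity are reached by projectivities
   that degenerate polynomially to the identity. *)
Require Import Defs.
From HB Require Import structures.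
From mathcomp Require Import all_boot all_order all_algebra.
From mathcomp Require Import all_classical all_reals all_analysis.
From mathcomp Require Import complex.
From mathcomp Require Import perm polyrcf ring lra zify.
From mathcomp Require Import Rstruct Rstruct_topology.
From mathcomp Require mpoly.
Set Implicit Arguments. Unset Strict Implicit. Unset Printing Implicit Defensive.
Import Order.TTheory GRing.Theory Num.Theory.
Import numFieldNormedType.Exports.
Local Open Scope ring_scope.
Local Open Scope classical_set_scope.

(* The form with coordinates a is read as the functional X^i |-> a_i on polynomials. A product
   of differential operators becomes a polynomial h, and it annihilates the form iff the
   functional vanishes on X^j h for all small j. *)
Definition Lf {K : fieldType} (a : 'rV[K]_9) (p : {poly K}) : K :=
  \sum_(i < 9) p`_i * a 0 i.

Fact Lf_is_linear {K : fieldType} (a : 'rV[K]_9) : linear_for *%R (Lf a).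
Proof.
move=> c p q; rewrite /Lf mulr_sumr -big_split /=; apply: eq_bigr => i _.
by rewrite coefD coefZ mulrDl mulrA.
Qed.
HB.instance Definition _ (K : fieldType) (a : 'rV[K]_9) :=
  GRing.isLinear.Build K {poly K} K *%R (Lf a) (Lf_is_linear a).

Lemma Lf_Xn {K : fieldType} (a : 'rV[K]_9) (i : 'I_9) : Lf a 'X^i = a 0 i.
Proof.
rewrite /Lf (bigD1 i) //= coefXn eqxx mul1r big1 ?addr0 // => j ji.
by rewrite coefXn (inj_eq val_inj) (negbTE ji) mul0r.
Qed.

(* [Some t] is the finite point t of the projective line; [None] is the point at infinity,
   whose linear form dehomogenizes to 1. *)
Definition lin {K : fieldType} (t : option K) : {poly K} :=
  if t is Some x then x%:P - 'X else 1.

Definition lins {K : fieldType} (ts : seq (option K)) : {poly K} :=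
  \prod_(t <- ts) lin t.

(** For h of formal degree 8 - n this says that h, as a differential operator, annihilates the form.
    The bound [n], not the degree of h, accounts for roots at infinity. *)
Definition kills {K : fieldType} (a : 'rV[K]_9) (n : nat) (h : {poly K}) :=
  forall j, (j <= n)%N -> Lf a ('X^j * h) = 0.

Lemma lin_neq0 {K : fieldType} (t : option K) : lin t != 0.
Proof.
case: t => [x|] /=; last exact: oner_neq0.
by rewrite -opprB oppr_eq0 polyXsubC_eq0.
Qed.

Lemma lins_neq0 {K : fieldType} (ts : seq (option K)) : lins ts != 0.
Proof. by rewrite prodf_seq_neq0; apply/allP=> t _; rewrite lin_neq0. Qed.

Lemma size_lin {K : fieldType} (t : option K) : size (lin t) = (t != None).+1.
Proof.
case: t => [x|] /=; last by rewrite size_poly1.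
by rewrite -opprB size_polyN size_XsubC.
Qed.

Lemma lins_cons {K : fieldType} (t : option K) ts : lins (t :: ts) = lin t * lins ts.
Proof. by rewrite /lins big_cons. Qed.

Lemma lins_cat {K : fieldType} (s t : seq (option K)) : lins (s ++ t) = lins s * lins t.
Proof. by rewrite /lins big_cat. Qed.

Lemma size_lins {K : fieldType} (ts : seq (option K)) :
  size (lins ts) = (count (predC1 None) ts).+1.
Proof.
elim: ts => [|t ts IH]; first by rewrite /lins big_nil size_poly1.
by rewrite lins_cons size_mul ?lin_neq0 ?lins_neq0 // IH size_lin /= addnS.
Qed.

Lemma size_lins_le {K : fieldType} (ts : seq (option K)) :
  (size (lins ts) <= (size ts).+1)%N.
Proof. by rewrite size_lins ltnS count_size. Qed.

Lemma perm_lins {K : fieldType} (s t : seq (option K)) :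
  perm_eq s t -> lins s = lins t.
Proof. exact: perm_big. Qed.

Lemma killsP {K : fieldType} (a : 'rV[K]_9) n (h p : {poly K}) :
  kills a n h -> (size p <= n.+1)%N -> Lf a (p * h) = 0.
Proof.
move=> kh sp; rewrite -[p]coefK poly_def mulr_suml linear_sum /= big1 // => i _.
rewrite -scalerAl linearZ /= kh ?mulr0 //.
by rewrite -ltnS (leq_trans (ltn_ord i)).
Qed.

Lemma kills_mul {K : fieldType} (a : 'rV[K]_9) n m (h p : {poly K}) :
  kills a n h -> (size p + m <= n.+1)%N -> kills a m (p * h).
Proof.
move=> kh sp j jm; rewrite mulrA; apply: killsP kh _.
rewrite (leq_trans (size_polyMleq _ _)) // size_polyXn.
by rewrite addSn /= addnC (leq_trans _ sp) // leq_add2l.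
Qed.

Lemma killsZ {K : fieldType} (a : 'rV[K]_9) n (h : {poly K}) c :
  c != 0 -> kills a n (c *: h) -> kills a n h.
Proof.
move=> c0 kh j jn; have := kh j jn; rewrite -scalerAr linearZ /= => /eqP.
by rewrite mulf_eq0 (negbTE c0) => /eqP.
Qed.

(** * Linear substitutions *)

(** The homogenization of P in formal degree [e], evaluated at the pair (A, B). The formal degree is
    explicit because roots at infinity lower the actual one. *)
Definition hsub {K : fieldType} (A B : {poly K}) (e : nat) (P : {poly K}) :=
  \sum_(j < e.+1) P`_j *: (A ^+ j * B ^+ (e - j)).

Lemma hsub_sum {K : fieldType} (A B : {poly K}) e I (s : seq I) (F : I -> {poly K}) :
  hsub A B e (\sum_(i <- s) F i) = \sum_(i <- s) hsub A B e (F i).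
Proof.
rewrite /hsub exchange_big /=; apply: eq_bigr => j _.
by rewrite coef_sum scaler_suml.
Qed.

Lemma hsubZ {K : fieldType} (A B : {poly K}) e c P : hsub A B e (c *: P) = c *: hsub A B e P.
Proof.
rewrite /hsub scaler_sumr; apply: eq_bigr => j _.
by rewrite coefZ scalerA.
Qed.

Lemma hsubXn {K : fieldType} (A B : {poly K}) e i : (i <= e)%N ->
  hsub A B e 'X^i = A ^+ i * B ^+ (e - i).
Proof.
move=> ie; rewrite /hsub (bigD1 (inord i)) //= inordK // coefXn eqxx scale1r.
rewrite big1 ?addr0 // => j; rewrite -(inj_eq val_inj) /= inordK // => ji.
by rewrite coefXn (negbTE ji) scale0r.
Qed.

Lemma polyE {K : fieldType} (P : {poly K}) n : (size P <= n)%N ->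
  P = \sum_(i < n) P`_i *: 'X^i.
Proof.
move=> sP; rewrite -poly_def; apply/polyP => i; rewrite coef_poly.
by case: ltnP => // ni; rewrite nth_default // (leq_trans sP).
Qed.

Lemma hsubM {K : fieldType} (A B : {poly K}) e1 e2 (P Q : {poly K}) :
  (size P <= e1.+1)%N -> (size Q <= e2.+1)%N ->
  hsub A B (e1 + e2) (P * Q) = hsub A B e1 P * hsub A B e2 Q.
Proof.
move=> sP sQ; rewrite {1}(polyE sP) {1}(polyE sQ) mulr_suml hsub_sum.
rewrite [X in _ = X * _]/hsub mulr_suml; apply: eq_bigr => i _.
rewrite mulr_sumr hsub_sum [X in _ = _ * X]/hsub mulr_sumr; apply: eq_bigr => j _.
have Hi := ltn_ord i; have Hj := ltn_ord j.
rewrite -scalerAl -scalerAr !hsubZ -exprD hsubXn; last by lia.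
rewrite -scalerAl -scalerAr; congr (_ *: (_ *: _)).
rewrite exprD -!mulrA; congr (_ * _); rewrite mulrCA; congr (_ * _).
rewrite -exprD; congr (_ ^+ _); lia.
Qed.

Lemma hsub_lins {K : fieldType} (A B : {poly K}) (ts : seq (option K)) :
  hsub A B (size ts) (lins ts) = \prod_(t <- ts) hsub A B 1 (lin t).
Proof.
elim: ts => [|t ts IH].
  by rewrite /lins !big_nil /hsub big_ord1 coef1 scale1r !expr0 mulr1.
rewrite lins_cons [RHS]big_cons -IH -hsubM ?size_lins_le //.
by rewrite size_lin; case: (_ != _).
Qed.

(** The transpose of the substitution by the matrix (al, be; ga, de) in degree 8: a linear change of
    variables on forms, read on moments. *)
Definition act {K : fieldType} (al be ga de : K) (a : 'rV[K]_9) : 'rV[K]_9 :=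
  \row_(j < 9) Lf a ((al *: 'X + be%:P) ^+ j * (ga *: 'X + de%:P) ^+ (8 - j)).

Lemma Lf_act {K : fieldType} (al be ga de : K) a P :
  Lf (act al be ga de a) P = Lf a (hsub (al *: 'X + be%:P) (ga *: 'X + de%:P) 8 P).
Proof.
rewrite /hsub linear_sum; apply: eq_bigr => i _.
by rewrite mxE linearZ.
Qed.

Definition mob {K : fieldType} (al be ga de : K) (t : option K) : option K :=
  if t is Some x then
    if ga * x + de == 0 then None else Some ((al * x + be) / (ga * x + de))
  else if ga == 0 then None else Some (al / ga).

(** Substitution moves the root of a linear form by the inverse projectivity, whose matrix is the
    adjugate up to a scalar. The cases distinguish whether the root is at infinity before or
    after. *)
Lemma hsub_lin {K : fieldType} (al be ga de : K) t : al * de - be * ga != 0 ->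
  exists2 c, c != 0 & hsub (al *: 'X + be%:P) (ga *: 'X + de%:P) 1 (lin t) =
    c *: lin (mob de (- be) (- ga) al t).
Proof.
move=> det; rewrite /hsub !big_ord_recl big_ord0 /= !expr0 !expr1 mul1r mulr1 addr0.
case: t => [x|] /=; rewrite !coefE /=.
  rewrite subr0 sub0r; case: eqP => [e|/eqP e] /=.
    exists (x * de - be).
      apply: contraNneq det => e'; apply/eqP.
      have -> : al = ga * x by apply/eqP; rewrite -subr_eq0 addrC -mulNr e.
      have -> : be = x * de by apply/esym/eqP; rewrite -subr_eq0 e'.
      ring.
    rewrite -!mul_polyC; have -> : al = ga * x by apply/eqP; rewrite -subr_eq0 addrC -mulNr e.
    by rewrite !polyCB !polyCM !polyCN; ring.
  exists (al - ga * x); first by rewrite addrC -mulNr.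
  rewrite scalerBr -[X in X - _]mul_polyC -polyCM.
  have -> : (al - ga * x) * ((de * x - be) / (- ga * x + al)) = de * x - be.
    by field.
  by rewrite -!mul_polyC !polyCD !polyCN !polyCM; ring.
rewrite scale1r scale0r addr0; case: eqP => [|/eqP] e /=.
  move/eqP: e; rewrite oppr_eq0 => /eqP e; rewrite e scale0r add0r.
  exists de; last by rewrite alg_polyC.
  by apply: contraNneq det => ->; rewrite e !mulr0 subr0.
exists (- ga) => //.
rewrite scalerBr -[X in _ = X - _]mul_polyC -polyCM.
have -> : - ga * (de / - ga) = de by field.
by rewrite -!mul_polyC !polyCN; ring.
Qed.

Lemma hsub_lins_mob {K : fieldType} (al be ga de : K) ts : al * de - be * ga != 0 ->
  exists2 c, c != 0 & hsub (al *: 'X + be%:P) (ga *: 'X + de%:P) (size ts) (lins ts) =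
    c *: lins (map (mob de (- be) (- ga) al) ts).
Proof.
move=> det; rewrite hsub_lins; elim: ts => [|t ts [c c0 IH]].
  by exists 1; rewrite ?oner_neq0 // /lins !big_nil scale1r.
have [c' c'0 E] := hsub_lin t det; exists (c' * c); first by rewrite mulf_neq0.
by rewrite big_cons IH E /= lins_cons -scalerAl -scalerAr scalerA.
Qed.

Lemma size_affine_exp {K : fieldType} (x y : K) m :
  (size ((x *: 'X + y%:P) ^+ m : {poly K})%R <= m.+1)%N.
Proof.
rewrite (leq_trans (size_poly_exp_leq _ _)) // ltnS.
suff : (size (x *: 'X + y%:P : {poly K})%R <= 2)%N.
  by case: size => [|[|[|]]] //= _; rewrite ?mul0n ?mul1n.
rewrite (leq_trans (size_polyD _ _)) // geq_max.
rewrite (leq_trans (size_scale_leq _ _)) ?size_polyX //.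
by rewrite (leq_trans (size_polyC_leq1 _)).
Qed.

Lemma kills_act {K : fieldType} (al be ga de : K) a n ts : al * de - be * ga != 0 ->
  (size ts + n = 8)%N -> kills a n (lins (map (mob de (- be) (- ga) al) ts)) ->
  kills (act al be ga de a) n (lins ts).
Proof.
move=> det sn kh j jn; rewrite Lf_act.
have -> : (8 = n + size ts)%N by rewrite addnC.
have [c c0 E] := hsub_lins_mob ts det.
rewrite hsubM ?size_lins_le ?size_polyXn // E -scalerAr linearZ /= (killsP kh) ?mulr0 //.
rewrite hsubXn // (leq_trans (size_polyMleq _ _)) //.
have sA := size_affine_exp al be j; have sB := size_affine_exp ga de (n - j).
move: (leq_add sA sB); set u := (size _ + size _)%N; lia.
Qed.

Lemma hsub_affine_exp {K : fieldType} (A B : {poly K}) x y m :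
  hsub A B m ((x *: 'X + y%:P) ^+ m) = (x *: A + y *: B) ^+ m.
Proof.
elim: m => [|m IH].
  by rewrite !expr0 /hsub big_ord1 coef1 scale1r !expr0 mulr1.
rewrite !exprS -IH -add1n hsubM ?size_affine_exp //; last first.
  by have := size_affine_exp x y 1; rewrite expr1.
congr (_ * _); rewrite /hsub !big_ord_recl big_ord0 /= !expr0 !expr1 mul1r mulr1 addr0 !coefE /=.
by rewrite !mulr0 !mulr1 add0r addr0 addrC.
Qed.

(** The four equations say that the primed matrix times the other one is the identity, and powers of
    linear forms compose as the matrices do. *)
Lemma actK {K : fieldType} (al be ga de al' be' ga' de' : K) a :
  al' * al + be' * ga = 1 -> al' * be + be' * de = 0 ->
  ga' * al + de' * ga = 0 -> ga' * be + de' * de = 1 ->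
  act al' be' ga' de' (act al be ga de a) = a.
Proof.
move=> e1 e2 e3 e4; apply/rowP => j; rewrite mxE Lf_act.
have jn : (j <= 8)%N by rewrite -ltnS.
rewrite -[X in hsub _ _ X _](subnKC jn) hsubM ?size_affine_exp // !hsub_affine_exp.
have E x y : x *: (al *: 'X + be%:P) + y *: (ga *: 'X + de%:P) =
    (x * al + y * ga) *: 'X + (x * be + y * de)%:P.
  by rewrite -!mul_polyC !polyCD !polyCM; ring.
by rewrite !E e1 e2 e3 e4 scale1r addr0 scale0r add0r expr1n mulr1 Lf_Xn.
Qed.

Lemma mobK {K : fieldType} (al be ga de : K) : al * de - be * ga != 0 ->
  cancel (mob de (- be) (- ga) al) (mob al be ga de).
Proof.
move=> det [x|] /=; last first.
  case: eqP => [/eqP|/eqP]; rewrite oppr_eq0 => g /=; first by rewrite g.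
  by rewrite invrN !mulrN mulrCA mulfV // mulr1 addNr eqxx.
case: eqP => [e|/eqP e] /=.
  have ea : al = ga * x by apply/eqP; rewrite -subr_eq0 addrC -mulNr e.
  case: eqP => [g|/eqP g]; first by move: det; rewrite ea g mulr0 !mul0r subr0 eqxx.
  by rewrite ea; congr Some; field.
have e' : al - ga * x != 0 by rewrite addrC -mulNr.
have E : ga * ((de * x + - be) / (- ga * x + al)) + de = (al * de - be * ga) / (- ga * x + al).
  by field.
rewrite E mulf_eq0 invr_eq0 (negbTE det) (negbTE e) /=; congr Some.
by field; rewrite det e.
Qed.

(** The bilinear form (q, k) -> L(m q k) has trivial kernel on the side of q, so its matrix has full
    rank and some k realises any prescribed values. *)
Lemma Lf_solve {K : fieldType} (a : 'rV[K]_9) (m : {poly K}) s n :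
  (forall q : {poly K}, (size q <= n.+1)%N ->
     (forall i, (i <= s)%N -> Lf a (m * q * 'X^i) = 0) -> q = 0) ->
  forall b : nat -> K, exists2 k : {poly K}, (size k <= s.+1)%N &
    forall j, (j <= n)%N -> Lf a (m * k * 'X^j) = b j.
Proof.
move=> inj b.
have expand (u v : nat) (k : 'rV[K]_u) :
    Lf a (m * rVpoly k * 'X^v) = \sum_(i < u) k 0 i * Lf a (m * 'X^(i + v)).
  rewrite {1}(polyE (size_poly _ _ : (size (rVpoly k) <= u)%N)).
  rewrite mulr_sumr mulr_suml linear_sum; apply: eq_bigr => i _ /=.
  by rewrite -scalerAr -scalerAl linearZ /= coef_rVpoly_ord exprD mulrA.
pose M := \matrix_(i < s.+1, j < n.+1) Lf a (m * 'X^(i + j)).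
have rf : row_full M.
  rewrite /row_full -mxrank_tr; apply: inj_row_free => v vM.
  have : rVpoly v = 0.
    apply: inj => [|i iS]; first exact: size_poly.
    have := congr1 (fun w : 'rV_s.+1 => w 0 (inord i)) vM; rewrite !mxE => <-.
    rewrite expand; apply: eq_bigr => j _; rewrite !mxE inordK //.
    by rewrite addnC.
  by move=> /(congr1 (poly_rV : {poly K} -> 'rV_n.+1)); rewrite rVpolyK linear0.
have /submxP[D eD] : ((\row_(j < n.+1) b j) <= M)%MS by apply: submx_full.
exists (rVpoly D); first exact: size_poly.
move=> j jn; have := congr1 (fun w : 'rV_n.+1 => w 0 (inord j)) eD.
rewrite !mxE inordK // => ->; rewrite expand; apply: eq_bigr => i _.
by rewrite !mxE inordK.
Qed.

(* Coprime cofactors generate all forms of large degree, so that two apolar forms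
   of small total degree have an apolar greatest common divisor. *)
Lemma Lf_gcd {K : fieldType} (a : 'rV[K]_9) (m q k : {poly K}) s n :
  q != 0 -> (size q <= n.+1)%N -> size k = s.+1 ->
  (forall i, (i <= s)%N -> Lf a (m * q * 'X^i) = 0) ->
  (forall j, (j <= n)%N -> Lf a (m * k * 'X^j) = 0) ->
  forall i, (i + size (gcdp q k) <= n + s + 1)%N -> Lf a (m * gcdp q k * 'X^i) = 0.
Proof.
move=> q0 sq sk kq kk i; set c := gcdp q k => hi.
have c0 : c != 0 by rewrite gcdp_eq0 (negbTE q0).
have k0 : k != 0 by rewrite -size_poly_gt0 sk.
pose q' : {poly K} := q %/ c; pose k' : {poly K} := k %/ c.
have qE : q = q' * c by rewrite divpK // dvdp_gcdl.
have kE : k = k' * c by rewrite divpK // dvdp_gcdr.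
have k'0 : k' != 0 by apply: contraNneq k0; rewrite kE => ->; rewrite mul0r.
have q'0 : q' != 0 by apply: contraNneq q0; rewrite qE => ->; rewrite mul0r.
have cop : coprimep q' k' by rewrite coprimep_div_gcd // q0.
have /Bezout_coprimepP[[u v] /= uv] := cop.
have [e e0 uvE] : exists2 e : K, e != 0 & u * q' + v * k' = e%:P.
  have := uv; rewrite -size_poly_eq1 => /size_poly1P[e e0 ->]; by exists e.
pose D : {poly K} := e^-1 *: ('X^i * u).
(* Bezout for the cofactors, with the coefficient of q' reduced modulo k'. Its degree is then small
   enough for [kq], and the bound on i controls the degree of the coefficient of k'. *)
have PE : 'X^i = (D %% k') * q' + ((D %/ k') * q' + e^-1 *: ('X^i * v)) * k'.
  have -> : (D %% k') * q' + ((D %/ k') * q' + e^-1 *: ('X^i * v)) * k' =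
     (D %/ k' * k' + D %% k') * q' + e^-1 *: ('X^i * v) * k' by ring.
  rewrite -divp_eq /D -!scalerAl -scalerDr -!mulrA -mulrDr uvE mulrC mul_polyC.
  by rewrite scalerA mulVf // scale1r.
set A : {poly K} := D %% k' in PE; set B : {poly K} := D %/ k' * q' + _ in PE.
have sA : (size A < size k')%N by rewrite ltn_modp.
clearbody B A; clear D; clearbody q' k' c.
have skE : size k = (size k' + size c).-1 by rewrite kE size_mul.
have sqE : size q = (size q' + size c).-1 by rewrite qE size_mul.
have sc : (0 < size c)%N by rewrite size_poly_gt0.
have sk' : (0 < size k')%N by rewrite size_poly_gt0.
have sq' : (0 < size q')%N by rewrite size_poly_gt0.
have sB : (size B <= n.+1)%N.
  have [->|B0] := eqVneq B 0; first by rewrite size_poly0.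
  have : (size (B * k')%R <= maxn (i.+1) (size A + size q').-1)%N.
    have -> : B * k' = 'X^i - A * q' by rewrite PE; ring.
    rewrite (leq_trans (size_polyD _ _)) // geq_max size_polyXn leq_maxl /=.
    by rewrite size_polyN (leq_trans (size_polyMleq _ _)) // leq_maxr.
  rewrite size_mul // => hB.
  have key (b k1 a1 q1 c1 : nat) : (0 < k1 -> 0 < c1 -> 0 < q1 -> a1 < k1 ->
      (b + k1).-1 <= maxn i.+1 (a1 + q1).-1 -> s.+1 = (k1 + c1).-1 ->
      (q1 + c1).-1 <= n.+1 -> i + c1 <= n + s + 1 -> b <= n.+1)%N by lia.
  by apply: (key _ _ _ _ _ sk' sc sq' sA hB _ _ hi); rewrite -?skE -?sqE.
have -> : m * c * 'X^i = m * q * A + m * k * B by rewrite PE qE kE; ring.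
rewrite linearD /=.
have gen (p w : {poly K}) l : (forall i, (i <= l)%N -> Lf a (m * p * 'X^i) = 0) ->
    (size w <= l.+1)%N -> Lf a (m * p * w) = 0.
  move=> kp sw; rewrite mulrC; apply: (@killsP _ _ l _ _ _ sw).
  by move=> j jl; rewrite mulrC kp.
rewrite (gen k B n kk) // addr0 (gen q A s kq) //.
by move: skE sA sc; rewrite sk; move: (size k') (size A) (size c) => x y z; lia.
Qed.

(** * Real-rooted polynomials: separating and splitting roots *)

Definition rp {K : fieldType} (xs : seq K) : {poly K} := lins (map Some xs).

Lemma rp_cons {K : fieldType} (x : K) xs : rp (x :: xs) = (x%:P - 'X) * rp xs.
Proof. by rewrite /rp /= lins_cons. Qed.

Lemma rp_cat {K : fieldType} (xs ys : seq K) : rp (xs ++ ys) = rp xs * rp ys.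
Proof. by rewrite /rp map_cat lins_cat. Qed.

Lemma perm_rp {K : fieldType} (xs ys : seq K) : perm_eq xs ys -> rp xs = rp ys.
Proof. by move=> p; apply/perm_lins/perm_map. Qed.

Lemma size_rp {K : fieldType} (xs : seq K) : size (rp xs) = (size xs).+1.
Proof. by rewrite size_lins count_map -[in RHS](count_predT xs). Qed.

Lemma rp_neq0 {K : fieldType} (xs : seq K) : rp xs != 0.
Proof. exact: lins_neq0. Qed.

Lemma rpE {K : fieldType} (xs : seq K) :
  rp xs = (-1) ^+ size xs *: \prod_(x <- xs) ('X - x%:P).
Proof.
elim: xs => [|x xs IH]; first by rewrite /rp /lins !big_nil scale1r.
by rewrite rp_cons IH big_cons /= exprS mulN1r scaleNr -scalerAr -scalerN -mulNr opprB.
Qed.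

Lemma rp_horner {K : fieldType} (xs : seq K) z : (rp xs).[z] = \prod_(x <- xs) (x - z).
Proof.
elim: xs => [|x xs IH]; first by rewrite /rp /lins !big_nil hornerE.
by rewrite rp_cons big_cons !hornerE IH.
Qed.

Lemma rp_roots {K : fieldType} (p : {poly K}) (xs : seq K) :
  p != 0 -> (size p <= (size xs).+1)%N -> uniq xs -> all (root p) xs ->
  exists2 c, c != 0 & p = c *: rp xs.
Proof.
move=> p0 sp ux rx.
have sz : size p = (size xs).+1.
  by apply/eqP; rewrite eqn_leq sp; apply: max_poly_roots.
exists ((-1) ^+ size xs * lead_coef p).
  by rewrite mulf_neq0 ?lead_coef_eq0 // expf_neq0 // oppr_eq0 oner_eq0.
rewrite rpE scalerA mulrAC -exprMn mulrNN mul1r expr1n mul1r.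
by apply: all_roots_prod_XsubC; rewrite ?uniq_rootsE.
Qed.

Lemma separate {R : realFieldType} (us : seq R) : uniq us ->
  exists2 eta, 0 < eta & forall x y, x \in us -> y \in us -> x != y -> eta *+ 2 <= `|x - y|.
Proof.
elim: us => [|x us IH] /=; first by exists 1.
case/andP=> xus /IH[e e0 sep].
have [e' e'0 sep'] : exists2 e', 0 < e' & forall y, y \in us -> e' *+ 2 <= `|x - y|.
  elim: us xus {IH sep} => [|y us IH]; first by exists 1.
  rewrite inE negb_or => /andP[xy /IH[e1 e10 H]].
  exists (Num.min e1 (`|x - y| / 2)).
    by rewrite lt_min e10 divr_gt0 // normr_gt0 subr_eq0.
  move=> z; rewrite inE => /predU1P[->|zus].
    by rewrite -[X in X <= _]mulr_natr -ler_pdivlMr // ge_min lexx orbT.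
  by rewrite (le_trans _ (H z zus)) // lerMn2r /= ge_min lexx.
exists (Num.min e e'); first by rewrite lt_min e0.
have m1 : Num.min e e' *+ 2 <= e *+ 2 by rewrite lerMn2r /= ge_min lexx.
have m2 : Num.min e e' *+ 2 <= e' *+ 2 by rewrite lerMn2r /= ge_min lexx orbT.
move=> y z; rewrite !inE => /predU1P[->|yu] /predU1P[->|zu] yz.
- by rewrite eqxx in yz.
- exact: le_trans m2 (sep' _ zu).
- by rewrite distrC; apply: le_trans m2 (sep' _ yu).
- exact: le_trans m1 (sep _ _ yu zu yz).
Qed.

Lemma uniq_near {R : realFieldType} (us : seq R) eta f :
  (forall x y, x \in us -> y \in us -> x != y -> eta *+ 2 <= `|x - y|) ->
  (forall x, x \in us -> `|f x - x| < eta) ->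
  forall x y, x \in us -> y \in us -> `|f x - y| < eta -> x = y.
Proof.
move=> sep cl x y xu yu fxy; apply/eqP/negPn/negP => xy.
have := sep x y xu yu xy; apply/negP; rewrite -ltNge.
rewrite (le_lt_trans (ler_distD (f x) x y)) // mulr2n ltrD // distrC.
exact: cl.
Qed.

Definition alternates {R : realFieldType} (us : seq R) (eta : R) (p : {poly R}) :=
  forall x, x \in us -> p.[x - eta] * p.[x + eta] < 0.

(** The factor of x itself contributes - eta^2, and any other y contributes (y - x)^2 - eta^2,
    positive by separation. *)
Lemma rp_alternates {R : realFieldType} (us : seq R) eta : 0 < eta -> uniq us ->
  (forall x y, x \in us -> y \in us -> x != y -> eta *+ 2 <= `|x - y|) ->
  alternates us eta (rp us).
Proof.
move=> eta0 uu sep x xu; rewrite !rp_horner -big_split /= (bigD1_seq x) //=.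
have -> : (x - (x - eta)) * (x - (x + eta)) = - (eta ^+ 2) by ring.
rewrite mulNr oppr_lt0 mulr_gt0 ?exprn_gt0 // big_seq_cond prodr_gt0 // => y.
move=> /andP[yu yx]; have := sep y x yu xu yx => le.
have : eta ^+ 2 < (y - x) ^+ 2.
  rewrite -[X in _ < X]real_normK ?num_real // ltrXn2r // ?nnegrE ?(ltW eta0) //.
  by rewrite (lt_le_trans _ le) // mulr2n ltrDl.
by rewrite -subr_gt0 => h; rewrite (lt_le_trans h) // le_eqVlt; apply/orP; left; apply/eqP; ring.
Qed.

(** The disjoint intervals around the points of [us] contain one root each, and the degree leaves
    room for no others. *)
Lemma alternates_split {R : rcfType} (us : seq R) eta (p : {poly R}) :
  uniq us -> 0 < eta -> p != 0 -> (size p <= (size us).+1)%N ->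
  (forall x y, x \in us -> y \in us -> x != y -> eta *+ 2 <= `|x - y|) ->
  alternates us eta p ->
  exists vs c, [/\ uniq vs, size vs = size us, c != 0 & p = c *: rp vs].
Proof.
move=> uu eta0 p0 sp sep alt.
have /choice[f Hf] : forall x, exists z, x \in us -> `|z - x| < eta /\ root p z.
  move=> x; case xu: (x \in us); last by exists 0.
  have le : x - eta <= x + eta by lra.
  have [z zI rz] := poly_ivtoo le (alt x xu).
  exists z => _; split=> //; move: zI; rewrite in_itv /= => /andP[z1 z2].
  by rewrite ltr_norml ltrBlDl z2 ltrBrDl z1.
have ufs : uniq (map f us).
  rewrite map_inj_in_uniq // => x y xu yu fxy.
  apply: (@uniq_near _ us eta f sep _ x y xu yu) => [z /Hf[]//|].
  by rewrite fxy; have [] := Hf y yu.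
have [||c c0 E] := @rp_roots _ p (map f us) p0 _ ufs.
- by rewrite size_map.
- by apply/allP=> z /mapP[x /Hf[_ r] ->].
by exists (map f us), c; rewrite size_map.
Qed.

Lemma small_perturbation {R : realFieldType} (w k : {poly R}) (pts : seq R) :
  (forall x, x \in pts -> w.[x] != 0) ->
  exists2 e, 0 < e & forall d, `|d| <= e -> forall x, x \in pts ->
    0 < w.[x] * (w + d *: k).[x].
Proof.
elim: pts => [|y pts IH] nz; first by exists 1.
have [|e e0 He] := IH; first by move=> x xp; apply: nz; rewrite inE xp orbT.
have wy : 0 < `|w.[y]| by rewrite normr_gt0 nz // mem_head.
have ky : 0 < `|k.[y]| + 1 by rewrite ltr_wpDl.
exists (Num.min e (`|w.[y]| / (`|k.[y]| + 1) / 2)).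
  by rewrite lt_min e0 !divr_gt0.
move=> d; rewrite le_min => /andP[d1 d2] x; rewrite inE => /predU1P[->|xp]; last exact: He.
rewrite hornerD hornerZ mulrDr -expr2 -[X in 0 < X + _]real_normK ?num_real //.
have : `|d| * `|k.[y]| < `|w.[y]|.
  apply: (@le_lt_trans _ _ (`|w.[y]| / (`|k.[y]| + 1) / 2 * (`|k.[y]| + 1))).
    by apply: ler_pM => //; rewrite lerDl.
  rewrite mulrAC divfK ?gt_eqF //; lra.
rewrite -normrM => h.
have : - (`|w.[y]| * `|d * k.[y]|) <= w.[y] * (d * k.[y]).
  by rewrite -normrM lerNl -normrN ler_norm.
have : `|w.[y]| * `|d * k.[y]| < `|w.[y]| ^+ 2 by rewrite expr2 ltr_pM2l.
lra.
Qed.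

(** The perturbed polynomial takes the value e at rho, where the unperturbed one has the same sign
    on both sides. A small e of the opposite sign creates a root on each side of rho, while the sign
    changes around the other points survive. *)
Lemma split_double_root {R : rcfType} (us : seq R) rho (k : {poly R}) :
  uniq us -> rho \in us -> k.[rho] = 1 -> (size k <= (size us).+2)%N ->
  exists e vs c, [/\ uniq vs, size vs = (size us).+1, c != 0 &
    (rho%:P - 'X) * rp us + e *: k = c *: rp vs].
Proof.
move=> uu ru k1 sk; have [eta eta0 sep] := separate uu.
set w := (rho%:P - 'X) * rp us.
have alt := rp_alternates eta0 uu sep.
have wE x : w.[x] = (rho - x) * (rp us).[x] by rewrite !hornerE.
have wrho : w.[rho - eta] * w.[rho + eta] > 0.
  rewrite !wE; have := alt _ ru; set A := (rp us).[_]; set B := (rp us).[_] => AB.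
  have -> : (rho - (rho - eta)) * A * ((rho - (rho + eta)) * B) = eta ^+ 2 * - (A * B) by ring.
  by rewrite mulr_gt0 ?exprn_gt0 // oppr_gt0.
have wx x : x \in us -> x != rho -> w.[x - eta] * w.[x + eta] < 0.
  move=> xu xr; rewrite !wE; have := alt _ xu; set A := (rp us).[_]; set B := (rp us).[_] => AB.
  have -> : (rho - (x - eta)) * A * ((rho - (x + eta)) * B) =
    ((rho - x) ^+ 2 - eta ^+ 2) * (A * B) by ring.
  rewrite pmulr_rlt0 // subr_gt0 -[X in _ < X]real_normK ?num_real // ltrXn2r //.
  - exact: ltW.
  - by rewrite (lt_le_trans _ (sep _ _ ru xu _)) ?mulr2n ?ltrDl // eq_sym.
pose pts := [seq x - eta | x <- us] ++ [seq x + eta | x <- us].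
have nz x : x \in pts -> w.[x] != 0.
  rewrite mem_cat => /orP[] /mapP[y yu ->]; have [->|yr] := eqVneq y rho.
  - by apply: contraTneq wrho => ->; rewrite mul0r ltxx.
  - by apply: contraTneq (wx y yu yr) => ->; rewrite mul0r ltxx.
  - by apply: contraTneq wrho => ->; rewrite mulr0 ltxx.
  - by apply: contraTneq (wx y yu yr) => ->; rewrite mulr0 ltxx.
have [E E0 HE] := small_perturbation k nz.
pose e := if 0 < w.[rho - eta] then - E else E.
have eE : `|e| <= E by rewrite /e; case: ifP; rewrite ?normrN gtr0_norm.
have ew : e * w.[rho - eta] < 0.
  have := nz (rho - eta); rewrite mem_cat (map_f (fun x => x - eta) ru) => /(_ isT).
  rewrite neq_lt /e; case: ifP => [h _|_]; first by rewrite mulNr oppr_lt0 mulr_gt0.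
  by rewrite orbF => h; rewrite pmulr_rlt0.
set p := w + e *: k.
have pm x : x \in us -> 0 < w.[x - eta] * p.[x - eta].
  by move=> xu; apply: HE => //; rewrite mem_cat (map_f (fun x => x - eta)).
have pp x : x \in us -> 0 < w.[x + eta] * p.[x + eta].
  by move=> xu; apply: HE => //; rewrite mem_cat (map_f (fun x => x + eta)) // orbT.
have prho : p.[rho] = e by rewrite hornerD wE subrr mul0r add0r hornerZ k1 mulr1.
have sgn2 (a b c d : R) : 0 < a * c -> 0 < b * d -> a * b < 0 -> c * d < 0.
  move=> h1 h2 h3; have : 0 < (a * b) * (c * d) by rewrite mulrACA mulr_gt0.
  by rewrite nmulr_rgt0.
have e0 : e != 0 by apply: contraTneq ew => ->; rewrite mul0r ltxx.
have p0 : p != 0 by apply: contraNneq e0 => p0; rewrite -prho p0 horner0.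
have sp : (size p <= (size us).+2)%N.
  rewrite (leq_trans (size_polyD _ _)) // geq_max (leq_trans (size_scale_leq _ _)) // andbT.
  by rewrite (leq_trans (size_polyMleq _ _)) // size_rp -[_ - _]/(lin (Some rho)) size_lin.
have l1 : rho - eta <= rho by lra.
have l2 : rho <= rho + eta by lra.
have [|z1] := @poly_ivtoo _ p _ _ l1.
  rewrite prho; have := pm _ ru; nra.
rewrite in_itv /= => /andP[z1a z1b] rz1.
have [|z2] := @poly_ivtoo _ p _ _ l2.
  rewrite prho; have := pp _ ru => h.
  have : e * w.[rho + eta] < 0 by nra.
  by nra.
rewrite in_itv /= => /andP[z2a z2b] rz2.
have /choice[f Hf] : forall x, exists z, x \in us ->
    [/\ `|z - x| < eta, root p z & x = rho -> z = z2].
  move=> x; case xu: (x \in us); last by exists 0.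
  have [->|xr] := eqVneq x rho.
    exists z2 => _; split=> //; rewrite ltr_norml; lra.
  have le : x - eta <= x + eta by lra.
  have [|z zI rz] := @poly_ivtoo _ p _ _ le.
    exact: sgn2 (pm x xu) (pp x xu) (wx x xu xr).
  exists z => _; split=> //; last by move/eqP: xr.
  move: zI; rewrite in_itv /= => /andP[h1 h2]; rewrite ltr_norml; lra.
have ne x y : x \in us -> y \in us -> `|f x - y| < eta -> x = y.
  by move=> xu yu; apply: (@uniq_near _ us eta f) => // z /Hf[].
have ufs : uniq (z1 :: map f us).
  rewrite /= map_inj_in_uniq; last first.
    by move=> x y xu yu fxy; apply: ne => //; rewrite fxy; have [] := Hf y yu.
  rewrite uu andbT; apply/negP => /mapP[x xu z1x].
  have xr : x = rho by apply: ne => //; rewrite -z1x ltr_norml; lra.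
  have [_ _ /(_ xr)] := Hf x xu; rewrite -z1x => z12; lra.
have [||c c0 Ec] := @rp_roots _ p (z1 :: map f us) p0 _ ufs.
- by rewrite /= size_map.
- by rewrite /= rz1; apply/allP=> z /mapP[x /Hf[_ r _] ->].
by exists e, (z1 :: map f us), c; rewrite /= size_map.
Qed.

Lemma fresh_points {R : realFieldType} (k : nat) (l : seq R) :
  exists ns, [/\ uniq ns, size ns = k & forall x, x \in ns -> x \notin l].
Proof.
elim: k => [|k [ns [un sn fr]]]; first by exists [::].
have [y yl] : exists y, y \notin l ++ ns.
  have [M HM] : exists M, forall x, x \in l ++ ns -> x < M.
    elim: (l ++ ns) => [|x s [M HM]]; first by exists 0.
    exists (Num.max M (x + 1)) => z; rewrite inE => /predU1P[->|/HM zM].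
      by rewrite lt_max ltrDl ltr01 orbT.
    by rewrite lt_max zM.
  by exists M; apply/negP => /HM; rewrite ltxx.
move: yl; rewrite mem_cat negb_or => /andP[yl yn].
exists (y :: ns); split=> /=; rewrite ?yn ?sn //.
by move=> x; rewrite inE => /predU1P[->//|/fr].
Qed.

Lemma size_undup_sub {T : eqType} (s t : seq T) : {subset s <= t} ->
  (size (undup s) <= size (undup t))%N.
Proof.
by move=> st; apply: uniq_leq_size; rewrite ?undup_uniq // => x; rewrite !mem_undup => /st.
Qed.

(* Among the apolar real-rooted forms of degree r take one with the most distinct roots:
   either all its roots are simple, or a gcd argument bounds their number by n. *)
Lemma more_distinct_roots {R : rcfType} (a : 'rV[R]_9) n (xs : seq R) :
  (size xs + n = 8)%N -> kills a n (rp xs) ->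
  exists ys, [/\ size ys = size xs, kills a n (rp ys) &
    uniq ys \/ (size (undup ys) <= n)%N].
Proof.
move=> sx; have [k] := ubnP (size xs - size (undup xs)).
elim: k xs sx => // k IH xs sx lk kx.
have [ux|nux] := boolP (uniq xs); first by exists xs; split=> //; left.
have [le|gt] := leqP (size (undup xs)) n; first by exists xs; split=> //; right.
set us := undup xs in lk gt *; pose s := size us; pose r := size xs.
have uu : uniq us := undup_uniq _.
have [ms pm] := perm_to_subseq (undup_subseq xs).
have sm : (size ms + s = r)%N by have := perm_size pm; rewrite size_cat addnC.
have msu x : x \in ms -> x \in us.
  by move=> xm; rewrite mem_undup (perm_mem pm) mem_cat xm orbT.
have ltsr : (s < r)%N by rewrite ltn_size_undup.
have hE : rp xs = rp ms * rp us by rewrite (perm_rp pm) rp_cat mulrC.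
have improve ys : size ys = r -> kills a n (rp ys) -> (s < size (undup ys))%N ->
    exists ys, [/\ size ys = size xs, kills a n (rp ys) & uniq ys \/ (size (undup ys) <= n)%N].
  move=> sy ky lt; have [|||zs [z1 z2 z3]] := IH ys; rewrite ?sy //.
    have key (p q t : nat) : (p - q < k.+1 -> q < t -> t <= p -> p - t < k)%N by lia.
    by apply: (key _ _ _ lk lt); rewrite -/r -sy size_undup.
  by exists zs; rewrite z1 sy.
have [H|] := pselect (forall q : {poly R}, (size q <= n.+1)%N ->
   (forall i, (i <= s)%N -> Lf a (rp ms * q * 'X^i) = 0) -> q = 0).
  case: ms pm sm msu hE H => [|rho ms] pm sm msu hE H; first by move: ltsr; rewrite -sm ltnn.
  have [kap' skap' Hk] := Lf_solve H (fun j => - Lf a (rp ms * 'X^j)).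
  pose kap := 1 + (rho%:P - 'X) * kap'.
  have k1 : kap.[rho] = 1 by rewrite !hornerE subrr mul0r addr0.
  have skap : (size kap <= s.+2)%N.
    rewrite (leq_trans (size_polyD _ _)) // geq_max size_poly1 /=.
    rewrite (leq_trans (size_polyMleq _ _)) // -[_ - _]/(lin (Some rho)) size_lin /=.
    by rewrite -(ltn_predK skap') /= || rewrite addSn /=.
  have [e [vs [c [uv sv c0 E]]]] := split_double_root uu (msu rho (mem_head _ _)) k1 skap.
  apply: (improve (vs ++ ms)).
  - by rewrite size_cat sv -sm /= addnC addnS addSn.
  - apply: (killsZ c0); rewrite rp_cat scalerAl -E mulrDl => j jn.
    rewrite mulrDr linearD /=.
    have -> : 'X^j * ((rho%:P - 'X) * rp us * rp ms) = 'X^j * rp xs.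
      by rewrite hE rp_cons; ring.
    rewrite kx // add0r -scalerAl -scalerAr linearZ /= /kap mulrDl mul1r mulrDr linearD /=.
    have -> : 'X^j * ((rho%:P - 'X) * kap' * rp ms) = rp (rho :: ms) * kap' * 'X^j.
      by rewrite rp_cons; ring.
    by rewrite Hk // [_ * rp ms]mulrC subrr mulr0.
  - have := @size_undup_sub _ vs (vs ++ ms); rewrite (undup_id uv) sv; apply => x xv.
    by rewrite mem_cat xv.
(* Otherwise q and [rp us] are both apolar after multiplication by [rp ms], hence so is their gcd,
   with roots [cs]. This holds in so many degrees that the remaining s - [size cs] roots can be
   chosen freely. *)
move=> /existsNP[q] /not_implyP[sq] /not_implyP[kq /eqP q0].
have sk : size (rp us) = s.+1 by rewrite size_rp.
have kk j : (j <= n)%N -> Lf a (rp ms * rp us * 'X^j) = 0.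
  by move=> jn; rewrite -hE mulrC kx.
have K := Lf_gcd q0 sq sk kq kk.
have : gcdp q (rp us) %| \prod_(x <- us) ('X - x%:P).
  apply: (dvdp_trans (dvdp_gcdr _ _)).
  by rewrite rpE dvdpZl // expf_neq0 // oppr_eq0 oner_eq0.
move=> /dvdp_prod_XsubC[mk]; set cs := mask mk us => ecs.
have [c c0 cE] : exists2 c, c != 0 & gcdp q (rp us) = c *: rp cs.
  have /eqpP[[c1 c2] /= /andP[c10 c20] e12] := ecs.
  exists (c1^-1 * c2 * (-1) ^+ size cs).
    by rewrite !mulf_neq0 ?invr_eq0 // expf_neq0 // oppr_eq0 oner_eq0.
  rewrite [rp cs]rpE scalerA -[X in X *: _]mulrA -expr2 sqrr_sign mulr1.
  by rewrite -scalerA -e12 scalerA mulVf // scale1r.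
have scs : size (gcdp q (rp us)) = (size cs).+1 by rewrite cE size_scale // size_rp.
pose w := ms ++ cs.
have gn : (size cs <= n)%N.
  have : (size (gcdp q (rp us)) <= size q)%N by apply: dvdp_leq => //; apply: dvdp_gcdl.
  by rewrite scs => h; have := leq_trans h sq.
have gs : (size cs <= s)%N by apply: size_subseq; apply: mask_subseq.
have kw : kills a (n + s - size cs) (rp w).
  apply: (killsZ c0) => j jn; rewrite rp_cat.
  have -> : 'X^j * (c *: (rp ms * rp cs)) = rp ms * gcdp q (rp us) * 'X^j.
    by rewrite cE -!scalerAr -scalerAl; congr (_ *: _); ring.
  by apply: K; rewrite scs; lia.
have sw : size w = (size ms + size cs)%N by rewrite size_cat.
have [x xw] : exists x, x \in w.
  rewrite /w; case: (ms) sm => [|x l] sm; first by move: ltsr; rewrite -sm ltnn.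
  by exists x; rewrite mem_head.
have kext ns : size ns = (s - size cs)%N -> kills a n (rp (w ++ ns)).
  move=> sn; rewrite rp_cat mulrC; apply: (kills_mul kw); rewrite size_rp sn; lia.
(* If w has few distinct roots, the free roots repeat one of them and at most n remain. Otherwise
   fresh free roots raise the number of distinct roots above s. *)
have [t_le|t_gt] := leqP (size (undup w)) (size cs).
  exists (w ++ nseq (s - size cs) x); split.
  - by rewrite size_cat size_nseq sw; lia.
  - by apply: kext; rewrite size_nseq.
  - right; apply: leq_trans gn; apply: leq_trans t_le; apply: size_undup_sub => y.
    by rewrite mem_cat => /orP[//|/nseqP[-> _]].
have [ns [un sn fr]] := fresh_points (s - size cs) w.
apply: (improve (w ++ ns)).
- by rewrite size_cat sn sw; lia.
- exact: kext.
have : (size (undup w ++ ns) <= size (undup (w ++ ns)))%N.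
  apply: uniq_leq_size.
    rewrite cat_uniq undup_uniq un andbT /=; apply/hasPn => y /fr.
    by rewrite mem_undup.
  by move=> y yI; rewrite mem_undup mem_cat; move: yI; rewrite mem_cat mem_undup.
rewrite size_cat sn; have key (p' q' t u : nat) : (q' < p' -> q' <= t -> p' + (t - q') <= u -> t < u)%N by lia.
exact: key t_gt gs.
Qed.

(** * Waring decompositions and apolarity *)

Lemma coef_form_of {K : nzRingType} (d : nat) (a : 'rV[K]_d.+1) (i : 'I_d.+1) :
  (form_of a)`_i = ('C(d, i)%:R * a 0 i)%:P * 'X^(d - i).
Proof.
rewrite /form_of coef_sum (bigD1 i) //= big1 ?addr0 => [|j ji];
  rewrite /Defs.cst /varx /vary -mulrA -rmorphXn /= mulrA -rmorphM coefCM coefXn.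
  by rewrite eqxx mulr1.
by rewrite eq_sym (inj_eq val_inj) (negbTE ji) mulr0.
Qed.

Lemma form_of_inj {K : numFieldType} (d : nat) : injective (@form_of K d).
Proof.
move=> a b e; apply/rowP => i; have := congr1 (fun p : {poly {poly K}} => p`_i`_(d - i)) e.
rewrite !coef_form_of !coefCM coefXn eqxx !mulr1; apply: mulfI.
by rewrite pnatr_eq0 -lt0n bin_gt0 -ltnS.
Qed.

Lemma linform_exp {K : comNzRingType} (d : nat) (p q : K) :
  linform p q ^+ d = form_of (\row_(i < d.+1) (p ^+ (d - i) * q ^+ i)).
Proof.
rewrite /linform exprDn /form_of; apply: eq_bigr => i _; rewrite mxE /Defs.cst.
by rewrite !exprMn -mulr_natl !polyCM !polyC_exp !polyC_natr; ring.
Qed.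

(** A triple (c, p, q) stands for c (p x + q y)^8, whose functional is a multiple of the evaluation
    at the point q / p. *)
Definition power_sum {K : fieldType} (s : seq (K * K * K)) : 'rV[K]_9 :=
  \row_(j < 9) \sum_(x <- s) x.1.1 * (x.1.2 ^+ (8 - j) * x.2 ^+ j).

Lemma waringE r a : waring_decomp 8 r a <-> exists2 s : seq (RR * RR * RR), size s = r & a = power_sum s.
Proof.
have E m (c p q : 'I_m -> RR) :
    \sum_(k < m) Defs.cst (c k) * linform (p k) (q k) ^+ 8 =
    form_of (\row_(j < 9) \sum_(k < m) c k * (p k ^+ (8 - j) * q k ^+ j)).
  under eq_bigr => k _ do rewrite linform_exp /form_of mulr_sumr.
  rewrite exchange_big /=; apply: eq_bigr => i _; rewrite mxE.
  rewrite mulr_sumr /Defs.cst !rmorph_sum /= !mulr_suml; apply: eq_bigr => k _.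
  by rewrite mxE !rmorphM /=; ring.
split=> [[c [p [q]]]|[s <- ->]].
  rewrite E => /form_of_inj ->; exists [seq (c k, p k, q k) | k <- enum 'I_r].
    by rewrite size_map size_enum_ord.
  by apply/rowP => j; rewrite !mxE big_map big_enum.
exists (fun k => (nth (0, 0, 0) s k).1.1), (fun k => (nth (0, 0, 0) s k).1.2),
  (fun k => (nth (0, 0, 0) s k).2).
apply: etrans _ (esym (E _ _ _ _)); congr form_of; apply/rowP => j; rewrite !mxE.
by rewrite (big_nth (0, 0, 0)) big_mkord.
Qed.

Lemma waring_le r r' a : (r <= r')%N -> waring_decomp 8 r a -> waring_decomp 8 r' a.
Proof.
move=> rr' /waringE[s sr ->]; apply/waringE.
exists (s ++ nseq (r' - r) (0, 0, 0)); first by rewrite size_cat size_nseq sr subnKC.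
apply/rowP => j; rewrite !mxE big_cat /= [X in _ + X]big1_seq ?addr0 // => x /andP[_].
by move=> /nseqP[-> _]; rewrite mul0r.
Qed.

Lemma Lf_power_sum {K : fieldType} (s : seq (K * K * K)) P :
  Lf (power_sum s) P = \sum_(x <- s) x.1.1 * (hsub x.2%:P x.1.2%:P 8 P)`_0.
Proof.
rewrite /Lf /hsub; under eq_bigr => i _ do rewrite mxE mulr_sumr.
rewrite exchange_big /=; apply: eq_bigr => x _; rewrite coef_sum mulr_sumr.
apply: eq_bigr => j _; rewrite coefZ -!polyC_exp coefCM coefC eqxx.
ring.
Qed.

Lemma act_power_sum {K : fieldType} (al be ga de : K) s :
  act al be ga de (power_sum s) =
  power_sum [seq (x.1.1, ga * x.2 + de * x.1.2, al * x.2 + be * x.1.2) | x <- s].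
Proof.
apply/rowP => j; rewrite !mxE Lf_power_sum big_map; apply: eq_bigr => x _ /=; congr (_ * _).
have jn : (j <= 8)%N by rewrite -ltnS.
rewrite -[X in hsub _ _ X _](subnKC jn) hsubM ?size_affine_exp // !hsub_affine_exp.
rewrite -!mul_polyC -!polyCM -!polyCD -!polyC_exp coefCM coefC eqxx.
by rewrite mulrC.
Qed.

Lemma waring_act r (al be ga de : RR) a :
  waring_decomp 8 r a -> waring_decomp 8 r (act al be ga de a).
Proof.
move=> /waringE[s sr ->]; apply/waringE; rewrite act_power_sum.
by eexists; [|reflexivity]; rewrite size_map.
Qed.

(** Each summand evaluates at its point q / p, which is a root of [lins]. For p = 0 it reads the
    coefficient of X^8, which vanishes because a point at infinity lowers the degree. *)
Lemma waring_kills r a : (r <= 8)%N -> waring_decomp 8 r a ->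
  exists2 ts, size ts = r & kills a (8 - r) (lins ts).
Proof.
move=> r8 /waringE[s sr ->].
pose t (x : RR * RR * RR) := if x.1.2 == 0 then None else Some (x.2 / x.1.2).
exists (map t s); first by rewrite size_map.
move=> j jr; rewrite Lf_power_sum big1_seq // => x /andP[_ xs].
set P := ('X^j * _); suff -> : (hsub x.2%:P x.1.2%:P 8 P)`_0 = 0 by rewrite mulr0.
have sP : (size P <= j + size (lins (map t s)))%N.
  by rewrite (leq_trans (size_polyMleq _ _)) // size_polyXn addSn.
have cs : (count (predC1 None) (map t s) <= r)%N by rewrite -sr -(size_map t) count_size.
have [x0|x0] := eqVneq x.1.2 0.
  have {}sP : (size P <= 8)%N.
    apply: (leq_trans sP); rewrite size_lins.
    suff h : (count (predC1 None) (map t s) < r)%N.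
      by apply: (leq_trans (leq_add jr h)); rewrite subnK.
    rewrite -sr -(size_map t) -(count_predC (predC1 None) (map t s)) -[X in (X < _)%N]addn0 ltn_add2l.
    rewrite -has_count; apply/hasP; exists (t x); first exact: map_f.
    by rewrite /t x0 eqxx.
  rewrite /hsub x0 coef_sum big1 // => i _; rewrite coefZ -!polyC_exp coefCM coefC eqxx.
  have [i8|i8] := eqVneq (i : nat) 8%N; first by rewrite nth_default ?mul0r // i8.
  by rewrite expr0n subn_eq0 leqNgt ltn_neqAle i8 -ltnS ltn_ord /= !mulr0.
have {}sP : (size P <= 9)%N.
  apply: (leq_trans sP); rewrite size_lins addnS ltnS.
  by apply: (leq_trans (leq_add jr cs)); rewrite subnK.
have -> : (hsub x.2%:P x.1.2%:P 8 P)`_0 = x.1.2 ^+ 8 * P.[x.2 / x.1.2].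
  rewrite (horner_coef_wide _ sP) mulr_sumr /hsub coef_sum; apply: eq_bigr => i _.
  rewrite coefZ -!polyC_exp coefCM coefC eqxx.
  have i8 : (i <= 8)%N by rewrite -ltnS.
  have -> : x.1.2 ^+ 8 = x.1.2 ^+ (8 - i) * x.1.2 ^+ i by rewrite -exprD subnK.
  by rewrite expr_div_n; field; rewrite expf_neq0.
rewrite hornerM /lins horner_prod (big_rem (t x)) ?map_f //= {1}/t (negbTE x0) /=.
by rewrite hornerD hornerN hornerC hornerX subrr mul0r !mulr0.
Qed.

(** Lagrange interpolation at the nodes [us]: a monomial differs from its interpolant by a multiple
    of [rp us] of degree at most 8, which the functional kills. The weights of the decomposition are
    the values on the Lagrange basis. *)
Lemma kills_waring r (us : seq RR) a : uniq us -> size us = r -> (r <= 8)%N ->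
  kills a (8 - r) (rp us) -> waring_decomp 8 r a.
Proof.
move=> uu su r8 kr; apply/waringE.
pose u i := nth 0 us i.
pose g (k : 'I_r) : {poly RR} := \prod_(j < r | j != k) ('X - (u j)%:P).
pose l k := (g k).[u k]^-1 *: g k.
have uI (i j : 'I_r) : i != j -> u i != u j.
  by move=> ij; rewrite nth_uniq ?su.
have gg k : (g k).[u k] != 0.
  rewrite horner_prod; apply/prodf_neq0 => j jk.
  by rewrite !hornerE subr_eq0 uI // eq_sym.
have lE (k j : 'I_r) : (l k).[u j] = (k == j)%:R.
  rewrite hornerZ; have [->|kj] := eqVneq k j; first by rewrite mulVf.
  rewrite [(g k).[u j]]horner_prod (bigD1 j) /=; last by rewrite eq_sym.
  by rewrite hornerXsubC subrr mul0r mulr0.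
exists [seq (Lf a (l k), 1, u k) | k <- enum 'I_r].
  by rewrite size_map size_enum_ord.
apply/rowP => j; rewrite mxE big_map big_enum /= -Lf_Xn.
pose D : {poly RR} := 'X^j - \sum_(k < r) (u k ^+ j) *: l k.
have sl k : (size (l k) <= 9)%N.
  rewrite (leq_trans (size_scale_leq _ _)) // /g -big_filter size_prod_XsubC ltnS.
  rewrite size_filter (leq_trans (count_size _ _)) // /index_enum -enumT.
  by rewrite size_enum_ord.
have sD : (size D <= 9)%N.
  rewrite (leq_trans (size_polyD _ _)) // geq_max size_polyXn ltn_ord size_polyN.
  rewrite (leq_trans (size_sum _ _ _)) //; apply/bigmax_leqP => k _.
  by rewrite (leq_trans (size_scale_leq _ _)).
have rD : all (root D) us.
  apply/(all_nthP 0) => i; rewrite su => ir; rewrite /root hornerD hornerN hornerXn.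
  rewrite horner_sum (bigD1 (Ordinal ir)) // big1 => [|k ki].
    by rewrite hornerZ (lE (Ordinal ir) (Ordinal ir)) eqxx mulr1 /= addr0 subrr.
  by rewrite -[us`_i]/(u (Ordinal ir)) hornerZ (lE k (Ordinal ir)) (negbTE ki) mulr0.
have [q qE] : exists q, D = q * rp us.
  have [q qE] := uniq_roots_prod_XsubC rD (etrans (uniq_rootsE us) uu).
  exists ((-1) ^+ size us *: q); rewrite rpE -scalerAl -scalerAr scalerA -expr2.
  by rewrite sqrr_sign scale1r.
have : Lf a D = 0.
  rewrite qE; apply: killsP kr _.
  have [->|q0] := eqVneq q 0; first by rewrite size_poly0.
  move: sD; rewrite qE size_mul ?rp_neq0 // size_rp su addnS /= => h.
  have key (x : nat) : (x + r <= 9 -> r <= 8 -> x <= (8 - r).+1)%N by lia.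
  exact: key h r8.
rewrite linearB /= linear_sum /= => /eqP; rewrite subr_eq0 => /eqP ->.
by apply: eq_bigr => k _; rewrite linearZ /= expr1n mul1r mulrC.
Qed.

(** * Continuity and openness of apolarity *)

Lemma cvg_bigsum {R : realType} {T I : Type} (F : set_system T) {FF : Filter F} (s : seq I)
    (P : pred I) (f : I -> T -> R) (l : I -> R) :
  (forall i, f i t @[t --> F] --> l i) ->
  (\sum_(i <- s | P i) f i t) @[t --> F] --> \sum_(i <- s | P i) l i.
Proof.
move=> fl; elim: s => [|i s IH].
  by rewrite big_nil; under eq_fun do rewrite big_nil; exact: cvg_cst.
rewrite big_cons; under eq_fun do rewrite big_cons.
by case: (P i) => //; apply: cvgD.
Qed.

Lemma cvg_bigprod {R : realType} {T I : Type} (F : set_system T) {FF : Filter F} (s : seq I)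
    (P : pred I) (f : I -> T -> R) (l : I -> R) :
  (forall i, f i t @[t --> F] --> l i) ->
  (\prod_(i <- s | P i) f i t) @[t --> F] --> \prod_(i <- s | P i) l i.
Proof.
move=> fl; elim: s => [|i s IH].
  by rewrite big_nil; under eq_fun do rewrite big_nil; exact: cvg_cst.
rewrite big_cons; under eq_fun do rewrite big_cons.
by case: (P i) => //; apply: cvgM.
Qed.

(** Entrywise, so that products and determinants reduce to limits of reals along an arbitrary
    filter; product filters occur below. *)
Definition mxcvg {R : realType} {T : Type} (F : set_system T) m n (A : T -> 'M[R]_(m, n)) (A0 : 'M[R]_(m, n)) :=
  forall i j, A t i j @[t --> F] --> A0 i j.

Lemma mxcvg_cst {R : realType} {T : Type} (F : set_system T) {FF : Filter F} m n (A : 'M[R]_(m, n)) :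
  mxcvg F (fun=> A) A.
Proof. by move=> i j; exact: cvg_cst. Qed.

Lemma mxcvgM {R : realType} {T : Type} (F : set_system T) {FF : Filter F} m n p
    (A : T -> 'M[R]_(m, n)) (B : T -> 'M[R]_(n, p)) A0 B0 :
  mxcvg F A A0 -> mxcvg F B B0 -> mxcvg F (fun t => A t *m B t) (A0 *m B0).
Proof.
move=> hA hB i j; rewrite mxE; under eq_fun do rewrite mxE.
by apply: cvg_bigsum => k; apply: cvgM.
Qed.

Lemma cvg_det {R : realType} {T : Type} (F : set_system T) {FF : Filter F} n (A : T -> 'M[R]_n) A0 :
  mxcvg F A A0 -> \det (A t) @[t --> F] --> \det A0.
Proof.
move=> hA; rewrite /determinant; apply: cvg_bigsum => s.
by apply: cvgM; [exact: cvg_cst | apply: cvg_bigprod => i; exact: hA].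
Qed.

Lemma mxcvg_adj {R : realType} {T : Type} (F : set_system T) {FF : Filter F} n (A : T -> 'M[R]_n) A0 :
  mxcvg F A A0 -> mxcvg F (fun t => \adj (A t)) (\adj A0).
Proof.
move=> hA i j; rewrite mxE /cofactor; under eq_fun do rewrite mxE /cofactor.
apply: cvgM; first exact: cvg_cst.
apply: cvg_det => u v; rewrite !mxE; under eq_fun do rewrite !mxE.
exact: hA.
Qed.

(** The catalecticant matrix. For m + n <= 10 every index is at most 8, so [inord] never falls back
    on its default. *)
Definition hankel {K : fieldType} m n (a : 'rV[K]_9) : 'M[K]_(m, n) := \matrix_(i, j) a 0 (inord (i + j)).

Lemma hankelE {K : fieldType} m n (a : 'rV[K]_9) (k : 'rV[K]_m) (j : 'I_n) : (m + n <= 10)%N ->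
  (k *m hankel m n a) 0 j = Lf a ('X^j * rVpoly k).
Proof.
move=> mn; rewrite (polyE (size_poly _ _ : (size (rVpoly k) <= m)%N)).
rewrite mulr_sumr linear_sum mxE; apply: eq_bigr => i _ /=.
rewrite !mxE -scalerAr linearZ /= coef_rVpoly_ord -exprD [(j + i)%N]addnC.
have ij : (i + j < 9)%N by have := ltn_ord i; have := ltn_ord j; lia.
by rewrite -(Lf_Xn a (inord _)) inordK.
Qed.

Lemma mxcvg_hankel {R : realType} m n (a : 'rV[R]_9) : mxcvg (nbhs a) (hankel m n) (hankel m n a).
Proof.
move=> i j; rewrite mxE; under eq_fun do rewrite mxE.
exact: coord_continuous.
Qed.

Lemma near_all {T : Type} (F : set_system T) {FF : Filter F} (U : eqType) (s : seq U)
    (P : U -> T -> Prop) :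
  (forall x, x \in s -> \forall t \near F, P x t) ->
  \forall t \near F, forall x, x \in s -> P x t.
Proof.
elim: s => [|x s IH] H; first by apply: nearW.
have H1 := H x (mem_head _ _).
have H2 : \forall t \near F, forall x, x \in s -> P x t.
  by apply: IH => y ys; apply: H; rewrite inE ys orbT.
by apply: filterS2 H1 H2 => t h1 h2 y; rewrite inE => /predU1P[->//|/h2].
Qed.

(** Full rank of the catalecticant: there is no nonzero apolar form of degree n. This makes the
    solutions of the apolarity equations in degree 8 - n vary continuously with the form. *)
Definition nondegenerate {K : fieldType} (a : 'rV[K]_9) n :=
  forall q : {poly K}, (size q <= n.+1)%N -> kills a (8 - n) q -> q = 0.

Definition close {R : realType} {n} (e : R) (a a' : 'rV[R]_n) := forall i, `|a' 0 i - a 0 i| < e.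

Lemma nearP {R : realType} {n} (a : 'rV[R]_n) (P : 'rV[R]_n -> Prop) :
  (\forall a' \near a, P a') <-> exists2 e, 0 < e & forall a', close e a a' -> P a'.
Proof.
split=> [/nbhs_ballP[e /= e0 H]|[e e0 H]].
  exists e => // a' ca; apply: H; split=> // i j.
  by rewrite ord1 /ball /= distrC.
apply/nbhs_ballP; exists e => // a'; case=> _ ba; apply: H => i.
by have := ba 0 i; rewrite /ball /= distrC.
Qed.

(* Solving (k M(a') = 0) near a known solution: k' = det N k0 - k0 M adj(N) psi with
   N = psi M(a') and psi a left inverse of M(a) depends polynomially on a'. *)
Lemma simple_roots_open {R : realType} r n (us : seq R) (a : 'rV[R]_9) :
  uniq us -> size us = r -> (r + n = 8)%N -> (0 < r)%N -> kills a n (rp us) ->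
  nondegenerate a n -> exists2 e, 0 < e & forall a', close e a a' ->
  exists vs, [/\ uniq vs, size vs = r & kills a' n (rp vs)].
Proof.
move=> uu su rn r0 ku nd; apply/nearP.
pose M : 'rV[R]_9 -> 'M[R]_(r.+1, n.+1) := hankel r.+1 n.+1.
have rf : row_full (M a).
  rewrite /row_full -mxrank_tr; apply: inj_row_free => v vM.
  have vz : rVpoly v = 0.
    apply: nd => [|j jr]; first exact: size_poly.
    have jr' : (j < r.+1)%N by rewrite ltnS (leq_trans jr) // leq_subLR addnC rn.
    have := hankelE a v (Ordinal jr'); rewrite /= => <-; last by rewrite addSn addnS addnC rn.
    transitivity ((v *m (M a)^T) 0 (Ordinal jr')); last by rewrite vM mxE.
    rewrite !mxE; apply: eq_bigr => i _; rewrite !mxE /=; congr (_ * a _ (inord _)).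
    exact: addnC.
  by move: vz => /(congr1 (poly_rV : {poly R} -> 'rV_n.+1)); rewrite rVpolyK linear0.
have /row_fullP[psi psiM] := rf.
pose k0 : 'rV[R]_r.+1 := poly_rV (rp us).
have k0E : rVpoly k0 = rp us by rewrite poly_rV_K // size_rp su.
have k0M : k0 *m M a = 0.
  apply/rowP => j; rewrite hankelE ?addSn ?addnS ?rn // k0E mxE ku //.
  by rewrite -ltnS.
pose N a' := psi *m M a'.
pose k a' := (\det (N a'))%:M *m k0 - k0 *m M a' *m (\adj (N a') *m psi).
have kM a' : k a' *m M a' = 0.
  rewrite mulmxBl -!mulmxA -/(N a') mul_adj_mx.
  by rewrite mulmxA mul_scalar_mx scalar_mxC mulmxA mul_mx_scalar subrr.
have ka : k a = k0.
  by rewrite /k /N psiM det1 mul1mx k0M mul0mx subr0.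
have cM : mxcvg (nbhs a) M (M a) by exact: mxcvg_hankel.
have cN : mxcvg (nbhs a) N (N a) by apply: mxcvgM => //; exact: mxcvg_cst.
have c1 : mxcvg (nbhs a) (fun a' => (\det (N a'))%:M *m k0) ((\det (N a))%:M *m k0).
  apply: mxcvgM; last exact: mxcvg_cst.
  move=> u v; rewrite !mxE; under eq_fun do rewrite !mxE.
  by apply: cvgMn; exact: cvg_det.
have c2 : mxcvg (nbhs a) (fun a' => k0 *m M a' *m (\adj (N a') *m psi))
    (k0 *m M a *m (\adj (N a) *m psi)).
  apply: mxcvgM; first by apply: mxcvgM => //; exact: mxcvg_cst.
  by apply: mxcvgM; [exact: mxcvg_adj | exact: mxcvg_cst].
have ck : mxcvg (nbhs a) k k0.
  rewrite -ka; move=> i j; rewrite /k mxE; under eq_fun do rewrite mxE.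
  apply: cvgD; first exact: c1.
  by rewrite mxE; under eq_fun do rewrite mxE; apply: cvgN; exact: c2.
have FF : Filter (nbhs a) := nbhs_filter a.
have [eta eta0 sep] := separate uu.
have alt := rp_alternates eta0 uu sep.
have cev x : (rVpoly (k a')).[x] @[a' --> a] --> (rp us).[x].
  rewrite -k0E (horner_coef_wide _ (size_poly _ _ : (size (rVpoly k0) <= r.+1)%N)).
  under eq_fun do rewrite (horner_coef_wide _ (size_poly _ _ : (size (rVpoly (k _)) <= r.+1)%N)).
  apply: (@cvg_bigsum R _ _ (nbhs a) FF) => i; rewrite coef_rVpoly_ord; under eq_fun do rewrite coef_rVpoly_ord.
  by apply: cvgM; [exact: ck | exact: cvg_cst].
have H : \forall a' \near a, alternates us eta (rVpoly (k a')).
  apply: (@near_all _ (nbhs a) FF) => x xu.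
  have : (rVpoly (k a')).[x - eta] * (rVpoly (k a')).[x + eta] @[a' --> a] -->
    (rp us).[x - eta] * (rp us).[x + eta] by apply: cvgM; exact: cev.
  by move/cvgr_lt; apply; exact: alt.
near=> a'.
have alt' : alternates us eta (rVpoly (k a')) by near: a'.
have p0 : rVpoly (k a') != 0.
  case: (us) su alt' => [|x l] su alt'; first by rewrite -su in r0.
  by apply: contraTneq (alt' x (mem_head _ _)) => ->; rewrite !horner0 mulr0 ltxx.
have [vs [c [uv sv c0 E]]] : exists vs c, [/\ uniq vs, size vs = size us, c != 0 &
    rVpoly (k a') = c *: rp vs].
  by apply: alternates_split alt' => //; rewrite su; exact: size_poly.
exists vs; split=> //; first by rewrite sv.
apply: (killsZ c0); rewrite -E => j jn.
have jn' : (j < n.+1)%N by rewrite ltnS.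
have := hankelE a' (k a') (Ordinal jn'); rewrite /= => <-; last by rewrite addSn addnS rn.
by rewrite -/(M a') kM mxE.
Unshelve. all: by end_near. Qed.

Definition pcvg {R : realType} {T : Type} (F : set_system T) (P : T -> {poly R}) (P0 : {poly R}) :=
  forall k, (P t)`_k @[t --> F] --> P0`_k.

Lemma pcvg_cst {R : realType} {T : Type} (F : set_system T) {FF : Filter F} (P : {poly R}) :
  pcvg F (fun=> P) P.
Proof. by move=> k; exact: cvg_cst. Qed.

Lemma pcvgC {R : realType} {T : Type} (F : set_system T) {FF : Filter F} (c : T -> R) (c0 : R) :
  c t @[t --> F] --> c0 -> pcvg F (fun t => (c t)%:P) c0%:P.
Proof.
move=> cc k; rewrite coefC; under eq_fun do rewrite coefC.
by case: ifP => // _; exact: cvg_cst.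
Qed.

Lemma pcvgD {R : realType} {T : Type} (F : set_system T) {FF : Filter F} (P Q : T -> {poly R}) (P0 Q0 : {poly R}) :
  pcvg F P P0 -> pcvg F Q Q0 -> pcvg F (fun t => P t + Q t) (P0 + Q0).
Proof.
move=> hP hQ k; rewrite coefD; under eq_fun do rewrite coefD.
by apply: cvgD.
Qed.

Lemma pcvgN {R : realType} {T : Type} (F : set_system T) {FF : Filter F} (P : T -> {poly R}) (P0 : {poly R}) :
  pcvg F P P0 -> pcvg F (fun t => - P t) (- P0).
Proof.
move=> hP k; rewrite coefN; under eq_fun do rewrite coefN.
by apply: cvgN.
Qed.

Lemma pcvgM {R : realType} {T : Type} (F : set_system T) {FF : Filter F} (P Q : T -> {poly R}) (P0 Q0 : {poly R}) :
  pcvg F P P0 -> pcvg F Q Q0 -> pcvg F (fun t => P t * Q t) (P0 * Q0).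
Proof.
move=> hP hQ k; rewrite coefM; under eq_fun do rewrite coefM.
by apply: cvg_bigsum => i; apply: cvgM.
Qed.

Lemma pcvg_prod {R : realType} {T I : Type} (F : set_system T) {FF : Filter F}
    (s : seq I) (A : pred I) (P : I -> T -> {poly R}) P0 :
  (forall i, pcvg F (P i) (P0 i)) ->
  pcvg F (fun t => \prod_(i <- s | A i) P i t) (\prod_(i <- s | A i) P0 i).
Proof.
move=> hP; elim: s => [|i s IH].
  by rewrite big_nil; under eq_fun do rewrite big_nil; exact: pcvg_cst.
rewrite big_cons; under eq_fun do rewrite big_cons.
by case: (A i) => //; apply: pcvgM.
Qed.

Lemma cvg_Lf {R : realType} {T : Type} (F : set_system T) {FF : Filter F}
    (a : T -> 'rV[R]_9) a0 (P : T -> {poly R}) (P0 : {poly R}) :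
  mxcvg F a a0 -> pcvg F P P0 -> Lf (a t) (P t) @[t --> F] --> Lf a0 P0.
Proof. by move=> ha hP; apply: cvg_bigsum => i; apply: cvgM. Qed.

(* A parametrisation of the projective line by [-1, 1]. *)
Definition plin {R : realFieldType} (th : R) : {poly R} := th%:P - (1 - `|th|)%:P * 'X.

Definition plins {R : realFieldType} {r} (w : 'rV[R]_r) : {poly R} := \prod_i plin (w 0 i).

Lemma plin_lin {R : realFieldType} (th : R) : `|th| <= 1 ->
  exists t c, c != 0 /\ plin th = c *: lin t.
Proof.
rewrite le_eqVlt => /predU1P[th1|th1].
  exists None, th; rewrite /plin th1 subrr polyC0 mul0r subr0 alg_polyC; split=> //.
  by rewrite -normr_gt0 th1.
exists (Some (th / (1 - `|th|))), (1 - `|th|).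
have h : 1 - `|th| != 0 by rewrite gt_eqF // subr_gt0.
split=> //; rewrite /= scalerBr -!mul_polyC -polyCM.
by have -> : (1 - `|th|) * (th / (1 - `|th|)) = th by rewrite mulrC divfK.
Qed.

Lemma lin_plin {R : realFieldType} (t : option R) :
  exists th c, [/\ `|th| <= 1, c != 0 & lin t = c *: plin th].
Proof.
case: t => [x|]; last first.
  by exists 1, 1; rewrite normr1 oner_neq0 /plin normr1 subrr polyC0 mul0r subr0 scale1r.
have h : 0 < 1 + `|x| by rewrite ltr_wpDr.
exists (x / (1 + `|x|)), (1 + `|x|); split.
- by rewrite normrM normfV (gtr0_norm h) ler_pdivrMr // mul1r lerDr.
- by rewrite gt_eqF.
rewrite /plin normrM normfV (gtr0_norm h) scalerBr -!mul_polyC mulrA -!polyCM /=.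
have -> : (1 + `|x|) * (x / (1 + `|x|)) = x by rewrite mulrC divfK ?gt_eqF.
have -> : (1 + `|x|) * (1 - `|x| / (1 + `|x|)) = 1 by field; rewrite gt_eqF.
by rewrite mul1r.
Qed.

Lemma plins_lins {R : realFieldType} {r} (w : 'rV[R]_r) : (forall i, `|w 0 i| <= 1) ->
  exists ts c, [/\ size ts = r, c != 0 & plins w = c *: lins ts].
Proof.
move=> w1; rewrite /plins.
have -> : \prod_i plin (w 0 i) = \prod_(i <- enum 'I_r) plin (w 0 i) by rewrite big_enum.
suff H s : exists ts c, [/\ size ts = size s, c != 0 & \prod_(i <- s) plin (w 0 i) = c *: lins ts].
  by have := H (enum 'I_r); rewrite size_enum_ord.
elim: s => [|i s [ts [c [st c0 E]]]].
  by exists [::], 1; rewrite big_nil /lins big_nil scale1r oner_neq0.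
have [t [d [d0 Ed]]] := plin_lin (w1 i).
exists (t :: ts), (d * c); rewrite /= st mulf_neq0 // big_cons E Ed lins_cons.
by rewrite -scalerAl -scalerAr scalerA.
Qed.

Lemma lins_plins {R : realFieldType} (ts : seq (option R)) :
  exists (w : 'rV[R]_(size ts)) c, [/\ forall i, `|w 0 i| <= 1, c != 0 & lins ts = c *: plins w].
Proof.
have /choice[th] : forall t : option R, exists th, exists c, [/\ `|th| <= 1, c != 0 & lin t = c *: plin th].
  exact: lin_plin.
move=> /choice[c Hc].
exists (\row_i th (nth None ts i)), (\prod_(t <- ts) c t); split=> [i||].
- by rewrite mxE; have [] := Hc (nth None ts i).
- by rewrite prodf_seq_neq0; apply/allP => t _; have [] := Hc t.
rewrite /plins; under [X in _ = _ *: X]eq_bigr => i _ do rewrite mxE.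
rewrite -(big_mkord predT (fun i => plin (th (nth None ts i)))) -(big_nth None predT (fun t => plin (th t))).
elim: ts => [|t ts IH]; first by rewrite /lins !big_nil scale1r.
rewrite lins_cons !big_cons IH; have [_ _ ->] := Hc t.
by rewrite -scalerAl -scalerAr scalerA.
Qed.

Lemma pcvg_plins {R : realType} {T : Type} (F : set_system T) {FF : Filter F} r
    (w : T -> 'rV[R]_r) w0 : mxcvg F w w0 -> pcvg F (fun t => plins (w t)) (plins w0).
Proof.
move=> cw; apply: pcvg_prod => i; apply: pcvgD; first by apply: pcvgC; exact: cw.
apply: pcvgN; apply: pcvgM; last exact: pcvg_cst.
apply: pcvgC; apply: cvgB; first exact: cvg_cst.
by apply: cvg_norm; exact: cw.
Qed.

(** Any r points, at infinity or not, are encoded by a w in the compact cube [-1, 1]^r, so the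
    neighbourhoods found for each w combine into a single one. [A] is a side condition on the
    parameter. *)
Lemma kills_near_covering {R : realType} {T : Type} (F : set_system T) {FF : Filter F}
    (a : T -> 'rV[R]_9) (A : T -> Prop) r n :
  (forall w : 'rV[R]_r, (forall i, `|w 0 i| <= 1) ->
     \forall w' \near w & t \near F, A t -> ~ kills (a t) n (plins w')) ->
  \forall t \near F, A t -> forall ts, size ts = r -> ~ kills (a t) n (lins ts).
Proof.
move=> H; pose K := [set w : 'rV[R]_r | forall i, `[(-1), 1]%classic (w ord0 i)].
have cK : compact K.
  apply: (@rV_compact _ r (fun=> `[(-1), 1]%classic : set R)) => i.
  exact: segment_compact.
have nc := (compact_near_coveringP K).1 cK.
have HF : \near F, K `<=` (fun w => A F -> ~ kills (a F) n (plins w)).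
  apply: (nc T F (fun t w => A t -> ~ kills (a t) n (plins w)) FF) => w Kw.
  by apply: H => i; have := Kw i; rewrite /= in_itv /= -ler_norml.
apply: filterS HF.
move=> t Ht At ts st kt; subst r.
have [w [c [w1 c0 E]]] := lins_plins ts.
have Kw : K w by move=> i; rewrite /= in_itv /= -ler_norml.
apply: (Ht w Kw At); move: kt; rewrite E; exact: killsZ.
Qed.

Lemma not_killed_near {R : realType} {T : Type} (F : set_system T) {FF : Filter F}
    (a : T -> 'rV[R]_9) a0 r n (w : 'rV[R]_r) :
  mxcvg F a a0 -> ~ kills a0 n (plins w) ->
  \forall w' \near w & t \near F, ~ kills (a t) n (plins w').
Proof.
move=> ca /existsNP[j] /not_implyP[jn /eqP L0].
have FP : Filter (filter_prod (nbhs w) F) by apply: filter_prod_filter.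
have : Lf (a x.2) ('X^j * plins x.1) @[x --> (nbhs w, F)] --> Lf a0 ('X^j * plins w).
  apply: (@cvg_Lf _ _ _ FP).
    move=> i k; apply: (@cvg_comp _ _ _ snd (fun t => a t i k) _ F); last exact: ca.
    exact: cvg_snd.
  apply: (@pcvgM _ _ _ FP); first exact: (@pcvg_cst _ _ _ FP).
  apply: (@pcvg_plins _ _ _ FP) => i k.
  apply: (@cvg_comp _ _ _ fst (fun v : 'rV[R]_r => v i k) _ (nbhs w)); first exact: cvg_fst.
  exact: coord_continuous.
move=> /cvgr_neq0 /(_ L0) nz.
apply: filterS nz => -[w' t] /= nz kt; move/eqP: nz; apply; exact: kt.
Qed.

Lemma not_apolar_open {R : realType} r n (a : 'rV[R]_9) :
  (forall ts, size ts = r -> ~ kills a n (lins ts)) ->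
  exists2 e, 0 < e & forall a', close e a a' ->
    forall ts, size ts = r -> ~ kills a' n (lins ts).
Proof.
move=> H; apply/nearP.
have : \forall a' \near a, True -> forall ts, size ts = r -> ~ kills a' n (lins ts).
  apply: (@kills_near_covering _ _ (nbhs a) _ id) => w w1.
  have [ts [c [st c0 E]]] := plins_lins w1.
  have : ~ kills a n (plins w) by rewrite E => /(killsZ c0); exact: H.
  move=> nk; have ci : mxcvg (nbhs a) id a by move=> i j; exact: coord_continuous.
  by apply: filterS (not_killed_near ci nk) => x h _.
by apply: filterS => x; apply.
Qed.

(** * Polynomial functions of one variable *)

Definition is_poly {K : comNzRingType} (f : K -> K) := exists p : {poly K}, forall x, f x = p.[x].

Lemma is_poly_ext {K : comNzRingType} (f g : K -> K) : f =1 g -> is_poly f -> is_poly g.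
Proof. by move=> fg [p Hp]; exists p => x; rewrite -fg. Qed.

Lemma is_poly_cst {K : comNzRingType} (c : K) : is_poly (fun=> c).
Proof. by exists c%:P => x; rewrite hornerC. Qed.

Lemma is_poly_id {K : comNzRingType} : is_poly (@id K).
Proof. by exists 'X => x; rewrite hornerX. Qed.

Lemma is_polyD {K : comNzRingType} (f g : K -> K) :
  is_poly f -> is_poly g -> is_poly (fun x => f x + g x).
Proof. by move=> [p Hp] [q Hq]; exists (p + q) => x; rewrite hornerD Hp Hq. Qed.

Lemma is_polyN {K : comNzRingType} (f : K -> K) : is_poly f -> is_poly (fun x => - f x).
Proof. by move=> [p Hp]; exists (- p) => x; rewrite hornerN Hp. Qed.

Lemma is_polyM {K : comNzRingType} (f g : K -> K) :
  is_poly f -> is_poly g -> is_poly (fun x => f x * g x).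
Proof. by move=> [p Hp] [q Hq]; exists (p * q) => x; rewrite hornerM Hp Hq. Qed.

Lemma is_polyX {K : comNzRingType} (f : K -> K) n : is_poly f -> is_poly (fun x => f x ^+ n).
Proof. by move=> [p Hp]; exists (p ^+ n) => x; rewrite horner_exp Hp. Qed.

Lemma is_poly_sum {K : comNzRingType} I (s : seq I) (P : pred I) (f : I -> K -> K) :
  (forall i, is_poly (f i)) -> is_poly (fun x => \sum_(i <- s | P i) f i x).
Proof.
move=> hf; have [p Hp] := choice hf; exists (\sum_(i <- s | P i) p i) => x.
by rewrite horner_sum; apply: eq_bigr => i _.
Qed.

Lemma is_poly_prod {K : comNzRingType} I (s : seq I) (P : pred I) (f : I -> K -> K) :
  (forall i, is_poly (f i)) -> is_poly (fun x => \prod_(i <- s | P i) f i x).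
Proof.
move=> hf; have [p Hp] := choice hf; exists (\prod_(i <- s | P i) p i) => x.
by rewrite horner_prod; apply: eq_bigr => i _.
Qed.

Lemma is_poly_det {K : comNzRingType} n (A : K -> 'M[K]_n) :
  (forall i j, is_poly (fun x => A x i j)) -> is_poly (fun x => \det (A x)).
Proof.
move=> hA; apply: is_poly_sum => s; apply: is_polyM; first exact: is_poly_cst.
by apply: is_poly_prod.
Qed.

Lemma poly_nonroot {K : numFieldType} (p : {poly K}) (f : nat -> K) :
  injective f -> p != 0 -> exists i, p.[f i] != 0.
Proof.
move=> fI p0; apply: contrapT => /forallNP H.
have : (size (map f (iota 0 (size p))) < size p)%N.
  apply: max_poly_roots => //; last by rewrite map_inj_uniq ?iota_uniq.
  by apply/allP => x /mapP[i _ ->]; apply/eqP; have /negP := H i; rewrite negbK => /eqP.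
by rewrite size_map size_iota ltnn.
Qed.

Lemma poly_nonroot_small {R : realFieldType} (p : {poly R}) d :
  p != 0 -> 0 < d -> exists x, [/\ 0 < x, x < d & p.[x] != 0].
Proof.
move=> p0 d0; have [|i Hi] := @poly_nonroot _ p (fun i => d / i.+2%:R) _ p0.
  move=> i j /mulfI; rewrite gt_eqF // => /(_ isT)/invr_inj/eqP.
  by rewrite eqr_nat => /eqP[].
exists (d / i.+2%:R); split=> //; first by rewrite divr_gt0.
by rewrite ltr_pdivrMr // ltr_pMr // ltr1n.
Qed.

(** * Apolarity over the complex numbers *)

(** For r + n = 8 and n <= r, over the complex numbers, this is the union of the dual varieties of
    the partitions of 8 into n parts of size at least 2: multiplicities are parts minus one, and
    points may coincide. *)
Definition dual {K : fieldType} (r n : nat) (z : 'rV[K]_9) :=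
  exists ts : seq (option K), [/\ size ts = r, (size (undup ts) <= n)%N & kills z n (lins ts)].

Lemma complexifyE n (a : 'rV[RR]_n) i : complexify a 0 i = (a 0 i)%:C%C.
Proof. by rewrite mxE. Qed.

Lemma Lf_complexify (a : 'rV[RR]_9) (P : {poly RR}) :
  Lf (complexify a) (map_poly (real_complex RR) P) = (Lf a P)%:C%C.
Proof.
rewrite /Lf rmorph_sum; apply: eq_bigr => i _.
by rewrite complexifyE coef_map rmorphM.
Qed.

Lemma kills_complexify (a : 'rV[RR]_9) n (P : {poly RR}) :
  kills a n P -> kills (complexify a) n (map_poly (real_complex RR) P).
Proof.
move=> kP j jn; have -> : 'X^j * map_poly (real_complex RR) P = map_poly (real_complex RR) ('X^j * P).
  by rewrite rmorphM /= map_polyXn.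
by rewrite Lf_complexify kP.
Qed.

Lemma lins_complexify (ts : seq (option RR)) :
  map_poly (real_complex RR) (lins ts) = lins (map (omap (real_complex RR)) ts).
Proof.
rewrite /lins rmorph_prod big_map; apply: eq_bigr => -[x|] _ /=; last by rewrite rmorph1.
by rewrite rmorphB /= map_polyC map_polyX.
Qed.

Lemma act_complexify (al be ga de : RR) a :
  complexify (act al be ga de a) = act al%:C%C be%:C%C ga%:C%C de%:C%C (complexify a).
Proof.
apply/rowP => j; rewrite complexifyE !mxE -Lf_complexify; congr Lf.
by rewrite rmorphM !rmorphXn !rmorphD /= !map_polyZ map_polyX !map_polyC.
Qed.

Lemma dual_complexify r n (a : 'rV[RR]_9) : dual r n a -> dual r n (complexify a).
Proof.
move=> [ts [st dt kt]]; exists (map (omap (real_complex RR)) ts); split.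
- by rewrite size_map.
- rewrite undup_map_inj ?size_map //; move=> [x|] [y|] //= [] e.
  by rewrite e.
- by rewrite -lins_complexify; exact: kills_complexify.
Qed.

Lemma kills_act_map {K : fieldType} (al be ga de : K) n z ts : al * de - be * ga != 0 ->
  (size ts + n = 8)%N -> kills z n (lins ts) ->
  kills (act al be ga de z) n (lins (map (mob al be ga de) ts)).
Proof.
move=> det sn kt; apply: kills_act => //; first by rewrite size_map.
rewrite -map_comp (_ : map _ ts = ts) //; apply: map_id_in => t _ /=.
have := @mobK _ de (- be) (- ga) al; rewrite !opprK; apply.
by rewrite mulrNN mulrC.
Qed.

Lemma dual_act {K : fieldType} (al be ga de : K) r n z : al * de - be * ga != 0 ->
  (r + n = 8)%N -> dual r n z -> dual r n (act al be ga de z).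
Proof.
move=> det rn [ts [st dt kt]]; exists (map (mob al be ga de) ts); split.
- by rewrite size_map.
- apply: leq_trans dt.
  have -> : size (undup ts) = size (map (mob al be ga de) (undup ts)) by rewrite size_map.
  apply: uniq_leq_size; first exact: undup_uniq.
  by move=> x; rewrite mem_undup => /mapP[y yt ->]; rewrite map_f // mem_undup.
- by apply: kills_act_map => //; rewrite st.
Qed.

(** Over the complex numbers the apolar q of degree at most n splits. Its roots, completed by
    infinity, are at most n points, and repeating one of them reaches degree r. *)
Lemma degenerate_dual r n (z : 'rV[CC]_9) : (0 < n)%N -> (n <= r)%N -> (r + n = 8)%N ->
  ~ nondegenerate z n -> dual r n z.
Proof.
move=> n0 nr rn /existsNP[q] /not_implyP[sq] /not_implyP[kq /eqP q0].
have [rs qE] := closed_field_poly_normal q.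
have srs : (size rs <= n)%N.
  move: sq; rewrite qE size_scale ?lead_coef_eq0 // size_prod_XsubC.
  by rewrite -ltnS.
pose l := map Some rs ++ nseq (n - size rs) None.
have sl : size l = n by rewrite size_cat size_map size_nseq subnKC.
have [t tl] : exists t, t \in l.
  by case: (l) sl => [|t l'] sl; [rewrite -sl in n0 | exists t; rewrite mem_head].
exists (l ++ nseq (r - n) t); split.
- by rewrite size_cat size_nseq sl subnKC.
- rewrite -sl; apply: leq_trans (size_undup l); apply: size_undup_sub => u.
  by rewrite mem_cat => /orP[//|/nseqP[-> _]].
have kl : kills z r (lins l).
  have -> : lins l = rp rs.
    rewrite lins_cat [X in _ * X]/lins big1_seq ?mulr1 // => u /andP[_ /nseqP[-> _]] //.
  rewrite rpE; have e8 : (8 - n = r)%N by rewrite -rn addnK.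
  rewrite e8 in kq; move: kq; rewrite {1}qE => /(killsZ _) kq j jr.
  by rewrite -scalerAr linearZ /= kq ?mulr0 ?lead_coef_eq0.
rewrite lins_cat mulrC; apply: (kills_mul kl).
apply: (leq_trans (leq_add (size_lins_le _) (leqnn n))).
by rewrite size_nseq addSn subnK.
Qed.

Lemma nondegenerate_complexify n (a : 'rV[RR]_9) :
  nondegenerate (complexify a) n -> nondegenerate a n.
Proof.
move=> nd q sq kq; have := nd (map_poly (real_complex RR) q).
rewrite size_map_poly => /(_ sq (kills_complexify kq)) /eqP.
by rewrite map_poly_eq0 => /eqP.
Qed.

Lemma close_act {R : realType} (al be ga de : R) (a : 'rV[R]_9) e : 0 < e ->
  exists2 d, 0 < d & forall a', close d a a' -> close e (act al be ga de a) (act al be ga de a').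
Proof.
move=> e0; apply/nearP.
suff : \forall a' \near a, forall j, j \in enum 'I_9 ->
    `|act al be ga de a' 0 j - act al be ga de a 0 j| < e.
  by apply: filterS => a' H j; apply: H; rewrite mem_enum.
have FF : Filter (nbhs a) := nbhs_filter a.
apply: (@near_all _ (nbhs a) FF) => j _.
set P := (al *: 'X + be%:P) ^+ j * (ga *: 'X + de%:P) ^+ (8 - j).
have : Lf a' P @[a' --> a] --> Lf a P.
  apply: (@cvg_Lf _ _ (nbhs a) FF); last exact: pcvg_cst.
  by move=> i k; exact: coord_continuous.
by move=> /cvgr_distC_lt /(_ _ e0); apply: filterS => a'; rewrite !mxE.
Qed.

(** * Closure and interior of the set of forms of rank at most r *)

Lemma nbhs_closeP {n} (a : 'rV[RR]_n) (S : set 'rV[RR]_n) :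
  nbhs a S <-> exists2 e, 0 < e & forall a', close e a a' -> S a'.
Proof.
split=> [/nbhs_ballP[e /= e0 H]|[e e0 H]].
  exists e => // a' ca; apply: H; split=> // i j.
  by rewrite ord1 /ball /= distrC.
apply/nbhs_ballP; exists e => // a'; case=> _ ba; apply: H => i.
by have := ba 0 i; rewrite /ball /= distrC.
Qed.

Lemma closure_closeP {n} (a : 'rV[RR]_n) (S : set 'rV[RR]_n) :
  closure S a <-> forall e, 0 < e -> exists2 a', close e a a' & S a'.
Proof.
split=> [cS e e0|H B /nbhs_closeP[e e0 He]].
  have [|a' [Sa' ca']] := cS [set a' | close e a a'].
    by apply/nbhs_closeP; exists e.
  by exists a'.
by have [a' ca Sa] := H e e0; exists a'; split=> //; exact: He.
Qed.

Lemma close_trans {R : realType} {n} (e d : R) (a b c : 'rV[R]_n) :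
  close e a b -> close d b c -> close (e + d) a c.
Proof.
move=> h1 h2 i; rewrite [e + d]addrC (le_lt_trans (ler_distD (b 0 i) _ _)) //.
exact: ltrD.
Qed.

Lemma closeW {R : realType} {n} (e d : R) (a b : 'rV[R]_n) : e <= d -> close e a b -> close d a b.
Proof. by move=> ed h i; apply: lt_le_trans (h i) ed. Qed.

(** The points of nearby decompositions stay in a compact space but may collide, so apolarity
    survives in the limit and the decomposition may not. *)
Lemma closure_apolar r (a : 'rV[RR]_9) : (r <= 8)%N -> closure (waring_decomp 8 r) a ->
  exists2 ts, size ts = r & kills a (8 - r) (lins ts).
Proof.
move=> r8 /closure_closeP cl; apply: contrapT => no.
have [|e e0 H] := @not_apolar_open _ r (8 - r) a.
  by move=> ts st kt; apply: no; exists ts.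
have [a' ca /(waring_kills r8)[ts st kt]] := cl e e0.
exact: (H a' ca ts st kt).
Qed.

(** The projectivity 1 / (t - s), with s not among the roots, makes all roots finite. Then either
    simple roots are available and persist nearby, or the small number of distinct roots, or
    degeneracy, puts the form on [dual r n]. *)
Lemma interior_waring r n (a : 'rV[RR]_9) : (0 < n)%N -> (n <= r)%N -> (r + n = 8)%N ->
  (exists2 ts, size ts = r & kills a n (lins ts)) -> ~ dual r n (complexify a) ->
  interior (waring_decomp 8 r) a.
Proof.
move=> n0 nr rn [ts st kt] nd.
have [s sts] : exists s, Some s \notin ts.
  have [ns [_ sn fr]] := fresh_points 1 (pmap id ts).
  case: ns sn fr => [|s [|]] // _ /(_ s (mem_head _ _)) h; exists s.
  by move: h; rewrite mem_pmap map_id.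
have det1 : (0 : RR) * - s - 1 * 1 != 0 by rewrite mul0r mul1r sub0r oppr_eq0 oner_eq0.
pose a1 := act 0 1 1 (- s) a.
have a1K b : act s 1 1 0 (act 0 1 1 (- s) b) = b.
  by apply: actK; rewrite ?mulr0 ?mul0r ?mulr1 ?mul1r ?addr0 ?add0r ?subrr.
have nd1 : ~ dual r n (complexify a1).
  move=> d1; apply: nd; rewrite -(a1K a) act_complexify; apply: dual_act => //.
  by rewrite -!rmorphM -rmorphB /= mulr0 mul1r sub0r fmorph_eq0 oppr_eq0 oner_eq0.
have : kills a1 n (lins (map (mob 0 1 1 (- s)) ts)) by apply: kills_act_map; rewrite ?st.
have [xs sx ->] : exists2 xs, size xs = r & map (mob 0 1 1 (- s)) ts = map Some xs.
  exists [seq odflt 0 (mob 0 1 1 (- s) t) | t <- ts]; first by rewrite size_map.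
  rewrite -map_comp; apply/eq_in_map => -[x|] xt /=; last by rewrite oner_eq0.
  by rewrite mul1r subr_eq0; case: eqP xt => // ->; rewrite (negbTE sts).
move=> kx; have [|ys [sy ky]] := more_distinct_roots _ kx; first by rewrite sx.
case=> [uy|dy]; last first.
  case: nd1; apply: dual_complexify; exists (map Some ys); split=> //.
  - by rewrite size_map sy.
  - by rewrite undup_map_inj ?size_map // => x y [].
have ndg : nondegenerate a1 n.
  apply: nondegenerate_complexify; apply: contrapT => h; apply: nd1.
  exact: degenerate_dual.
have r0 : (0 < r)%N by apply: leq_trans nr.
have [|e1 e10 He1] := simple_roots_open uy _ rn r0 ky ndg; first by rewrite sy.
have [e e0 He] := close_act 0 1 1 (- s) a e10.
apply/nbhs_closeP; exists e => // a' ca'.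
have [vs [uv sv kv]] := He1 _ (He _ ca').
rewrite -(a1K a'); apply: waring_act; apply: kills_waring uv sv _ _; last first.
  by rewrite -rn addKn.
by rewrite -rn leq_addr.
Qed.

(** For n = 0 apolarity is a single equation. If L((rho - X)^7) is nonzero for some rho, one further
    root solves it, and [more_distinct_roots] makes all roots simple. If it vanishes for every rho,
    then a_0, ..., a_7 are zero and the form is a multiple of y^8. *)
Lemma waring8 (a : 'rV[RR]_9) : waring_decomp 8 8 a.
Proof.
have key xs : size xs = 8%N -> kills a 0 (rp xs) -> waring_decomp 8 8 a.
  move=> sx kx; have [|ys [sy ky]] := more_distinct_roots _ kx; first by rewrite sx.
  case=> [uy|]; first by apply: (kills_waring uy) => //; rewrite sy.
  case: (ys) sy => [|y l]; rewrite ?sx // => _; rewrite leqn0 size_eq0 => /eqP u0.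
  by have := mem_undup (y :: l) y; rewrite u0 mem_head.
have L8 (P : {poly RR}) x : Lf a (P * (x%:P - 'X)) = x * Lf a P - Lf a ('X * P).
  by rewrite mulrBr linearB /= mulrC mul_polyC linearZ /= [P * _]mulrC.
have [[rho rho0]|/forallNP H] := pselect (exists rho, Lf a (rp (nseq 7 rho)) != 0).
  apply: (key (Lf a ('X * rp (nseq 7 rho)) / Lf a (rp (nseq 7 rho)) :: nseq 7 rho)).
    by [].
  move=> j; rewrite leqn0 => /eqP ->; rewrite expr0 mul1r rp_cons mulrC L8 divfK //.
  by rewrite subrr.
have H0 rho : Lf a (rp (nseq 7 rho)) = 0 by apply/eqP/negPn/negP/H.
(* L((rho - X)^7) as a polynomial in rho. *)
pose Q : {poly RR} := \sum_(k < 8) ((-1) ^+ k * 'C(7, k)%:R * a 0 (inord k)) *: 'X^(7 - k).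
have QE rho : Q.[rho] = 0.
  rewrite -(H0 rho) /rp /lins map_nseq big_nseq iter_mulr_1 /= exprDn linear_sum horner_sum.
  apply: eq_bigr => k _; rewrite hornerZ hornerXn /= linearMn /= [(- 'X) ^+ k]exprNn.
  have -> : rho%:P ^+ (7 - k) * ((-1) ^+ k * 'X^k) = (rho ^+ (7 - k) * (-1) ^+ k) *: 'X^k :> {poly RR}.
    by rewrite -!mul_polyC polyCM !polyC_exp polyCN; ring.
  have k9 : (k < 9)%N by rewrite ltnW // ltnS ltn_ord.
  rewrite linearZ /= -[X in 'X^X](@inordK 8 k) // Lf_Xn -mulr_natr; ring.
have Q0 : Q = 0.
  apply: contraTeq isT => Qn0.
  have [|i] := @poly_nonroot _ Q (fun i => i%:R) _ Qn0; last by rewrite QE eqxx.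
  by move=> i j /eqP; rewrite eqr_nat => /eqP.
have a0 (k : 'I_8) : a 0 (inord k) = 0.
  have := congr1 (fun q : {poly RR} => q`_(7 - k)) Q0; rewrite coef0 coef_sum (bigD1 k) //=.
  rewrite big1 ?addr0 => [|i ik].
    rewrite coefZ coefXn eqxx mulr1 => /eqP; rewrite !mulf_eq0 signr_eq0 /=.
    by rewrite pnatr_eq0 -leqn0 leqNgt bin_gt0 -ltnS ltn_ord /= => /eqP.
  rewrite coefZ coefXn (_ : (7 - k == 7 - i)%N = false) ?mulr0 //.
  apply/negbTE; apply: contra ik => /eqP e; apply/eqP/val_inj => /=.
  by have := ltn_ord k; have := ltn_ord i; lia.
apply: (@waring_le 1) => //; apply/waringE; exists [:: (a 0 ord_max, 0, 1)] => //.
apply/rowP => j; rewrite mxE big_seq1 /= expr1n mulr1 expr0n subn_eq0.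
have [j8|j8] := ltnP j 8.
  have := a0 (Ordinal j8); rewrite /= inord_val => ->.
  by rewrite mulr0.
have -> : j = ord_max by apply/val_inj/eqP; rewrite eqn_leq /= -ltnS ltn_ord.
by rewrite mulr1.
Qed.

(** * Differential operators as apolarity conditions *)

Definition apolar_form {K : fieldType} (z : 'rV[K]_9) d H : {poly {poly K}} :=
  \sum_(i < d.+1) Defs.cst ('C(d, i)%:R * Lf z ('X^i * H)) * varx ^+ (d - i) * vary ^+ i.

Lemma apolar_form1 {K : fieldType} (z : 'rV[K]_9) : apolar_form z 8 1 = form_of z.
Proof. by apply: eq_bigr => i _; rewrite mulr1 Lf_Xn. Qed.

Lemma monomialE {K : comNzRingType} (c : K) m i :
  Defs.cst c * varx ^+ m * vary ^+ i = (c *: 'X^m : {poly K}) *: 'X^i.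
Proof. by rewrite /Defs.cst /varx /vary -polyC_exp -polyCM !mul_polyC. Qed.

Lemma ddx_monomial {K : comNzRingType} (c : K) m i :
  ddx (Defs.cst c * varx ^+ m * vary ^+ i) = Defs.cst (m%:R * c) * varx ^+ m.-1 * vary ^+ i.
Proof.
rewrite !monomialE; apply/polyP => k; rewrite coef_map_id0 ?linear0 // !coefZ !coefXn.
case: (k == i); rewrite ?mulr0 ?linear0 // !mulr1 derivZ derivXn.
by rewrite -scaler_nat scalerA mulrC.
Qed.

Lemma ddy_monomial {K : comNzRingType} (c : K) m i :
  ddy (Defs.cst c * varx ^+ m * vary ^+ i) = Defs.cst (i%:R * c) * varx ^+ m * vary ^+ i.-1.
Proof.
rewrite !monomialE /ddy derivZ derivXn -[_ *+ i]scaler_nat scalerA; congr (_ *: _).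
by rewrite -scalerA mulrC -polyC_natr mul_polyC.
Qed.

Lemma lin_opD {K : nzRingType} l (f g : {poly {poly K}}) : lin_op l (f + g) = lin_op l f + lin_op l g.
Proof.
rewrite /lin_op /ddx /ddy derivD.
have -> : map_poly (@deriv K) (f + g) = map_poly (@deriv K) f + map_poly (@deriv K) g.
  by apply/polyP => k; rewrite coefD !coef_map_id0 ?linear0 // coefD linearD.
by rewrite !mulrDr addrACA.
Qed.

Lemma lin_op0 {K : nzRingType} l : lin_op l (0 : {poly {poly K}}) = 0.
Proof. by apply: (addrI (lin_op l 0)); rewrite -lin_opD !addr0. Qed.

Lemma lin_opC {K : comNzRingType} l (c : K) f : lin_op l (Defs.cst c * f) = Defs.cst c * lin_op l f.
Proof.
rewrite /lin_op /ddx /ddy /Defs.cst (_ : c%:P%:P * f = c%:P *: f) ?mul_polyC // derivZ.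
have -> : map_poly (@deriv K) (c%:P *: f) = c%:P *: map_poly (@deriv K) f.
  apply/polyP => k; rewrite coefZ !coef_map_id0 ?linear0 // coefZ.
  by rewrite mul_polyC derivZ mul_polyC.
by rewrite -!mul_polyC mulrDr !mulrA; congr (_ * _ + _ * _); rewrite mulrC.
Qed.

(** On H the derivation in x acts as 1 and that in y as X; the exponents brought down by
    differentiation turn the binomials of degree d + 1 into those of degree d, up to the factor d +
    1. *)
Lemma lin_op_apolar_form {K : fieldType} (z : 'rV[K]_9) l d H :
  lin_op l (apolar_form z d.+1 H) =
  Defs.cst d.+1%:R * apolar_form z d ((l.1%:P + l.2%:P * 'X) * H).
Proof.
have E I (s : seq I) (F : I -> {poly {poly K}}) :
   lin_op l (\sum_(i <- s) F i) = \sum_(i <- s) lin_op l (F i).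
  elim: s => [|i s IH]; first by rewrite !big_nil lin_op0.
  by rewrite !big_cons lin_opD IH.
rewrite /apolar_form E; under eq_bigr => i _ do rewrite /lin_op ddx_monomial ddy_monomial.
rewrite big_split /= big_ord_recr [X in _ + X]big_ord_recl /= subnn !mulr0n !mul0r.
rewrite !mulr0 addr0 add0r /Defs.cst mulr_sumr -big_split /=; apply: eq_bigr => i _.
have le_id : (i <= d)%N by rewrite -ltnS.
rewrite /bump /= add1n subSS subSn // -pred_Sn.
have e1 : (d - i).+1%:R * 'C(d.+1, i)%:R = d.+1%:R * 'C(d, i)%:R :> K.
  by rewrite -!natrM -subSn // mul_bin_down.
have e2 : i.+1%:R * 'C(d.+1, i.+1)%:R = d.+1%:R * 'C(d, i)%:R :> K.
  by rewrite -!natrM mul_bin_diag.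
have -> : Lf z ('X^i * ((l.1%:P + l.2%:P * 'X) * H)) =
    l.1 * Lf z ('X^i * H) + l.2 * Lf z ('X^(i.+1) * H).
  rewrite -!linearZ -linearD; congr (Lf z _).
  by rewrite -!mul_polyC exprS; ring.
set A := Lf z _; set B := Lf z _.
have E1 : (d - i).+1%:R * ('C(d.+1, i)%:R * A) = d.+1%:R * ('C(d, i)%:R * A) by rewrite !mulrA e1.
have E2 : i.+1%:R * ('C(d.+1, i.+1)%:R * B) = d.+1%:R * ('C(d, i)%:R * B) by rewrite !mulrA e2.
by rewrite E1 E2 add0n !(polyCM, polyCD); ring.
Qed.

Lemma iter_lin_op {K : fieldType} (z : 'rV[K]_9) l m d H :
  exists2 c, c = (\prod_(i < m) (d + i).+1)%:R &
  iter m (lin_op l) (apolar_form z (d + m) H) =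
  Defs.cst c * apolar_form z d ((l.1%:P + l.2%:P * 'X) ^+ m * H).
Proof.
elim: m d H => [|m IH] d H.
  by exists 1; rewrite ?big_ord0 // addn0 expr0 mul1r /Defs.cst !polyC1 mul1r.
eexists; first reflexivity.
have [c cE E] := IH d.+1 H.
rewrite iterSr addnS lin_op_apolar_form.
have C k f : iter k (lin_op l) (Defs.cst (d + m).+1%:R * f) = Defs.cst (d + m).+1%:R * iter k (lin_op l) f.
  by elim: k => //= k ->; rewrite lin_opC.
rewrite C; have [c' c'E ->] := IH d ((l.1%:P + l.2%:P * 'X) * H).
rewrite [in RHS]exprSr -[in RHS]mulrA mulrA; congr (_ * _).
by rewrite big_ord_recr /= natrM -c'E /Defs.cst !polyCM mulrC.
Qed.

(** The constant is a product of the integers brought down by differentiation, nonzero in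
    characteristic zero. *)
Lemma crl_op_apolar_form {K : numFieldType} (z : 'rV[K]_9) (lam : seq nat) ls d :
  size ls = size lam -> (d + \sum_(k <- lam) k.-1 = 8)%N ->
  exists2 c, c != 0 & crl_op lam ls (form_of z) =
    Defs.cst c * apolar_form z d (\prod_(x <- zip lam ls) (x.2.1%:P + x.2.2%:P * 'X) ^+ x.1.-1).
Proof.
rewrite -apolar_form1 /crl_op; elim: lam ls d => [|k lam IH] [|l ls] d //= => [_|[sl]].
  rewrite !big_nil addn0 => ->; exists 1; rewrite ?oner_neq0 //.
  by rewrite /Defs.cst !polyC1 mul1r.
rewrite !big_cons => dE.
have [|c c0 ->] := IH ls (d + k.-1)%N sl; first by rewrite -addnA.
have C m (f : {poly {poly K}}) : iter m (lin_op l) (Defs.cst c * f) = Defs.cst c * iter m (lin_op l) f.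
  by elim: m => //= m ->; rewrite lin_opC.
have [c' c'E E] := iter_lin_op z l k.-1 d (\prod_(x <- zip lam ls) (x.2.1%:P + x.2.2%:P * 'X) ^+ x.1.-1).
exists (c * c'); last by rewrite /= C E mulrA /Defs.cst !polyCM.
rewrite mulf_neq0 // c'E pnatr_eq0 -lt0n prodn_gt0 //.
Qed.

Lemma form_of0 {K : nzRingType} d : form_of (0 : 'rV[K]_d.+1) = 0.
Proof.
by rewrite /form_of big1 // => i _; rewrite mxE mulr0 /Defs.cst !polyC0 !mul0r.
Qed.

Lemma apolar_form_eq0 {K : numFieldType} (z : 'rV[K]_9) d H :
  apolar_form z d H = 0 <-> kills z d H.
Proof.
have E : apolar_form z d H = form_of (\row_(i < d.+1) Lf z ('X^i * H)).
  by apply: eq_bigr => i _; rewrite mxE.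
rewrite E; split=> [|kH].
  rewrite -(form_of0 d) => /form_of_inj e j jd.
  by have := congr1 (fun w : 'rV_d.+1 => w 0 (inord j)) e; rewrite !mxE inordK.
rewrite (_ : \row_i _ = 0) ?form_of0 //; apply/rowP => i; rewrite !mxE kH //.
by rewrite -ltnS.
Qed.

Lemma dual_crlP (z : 'rV[CC]_9) (lam : seq nat) d : (d + \sum_(k <- lam) k.-1 = 8)%N ->
  dual_crl 8 lam z <->
  exists2 ts : seq (option CC), size ts = size lam &
    kills z d (\prod_(x <- zip lam ts) lin x.2 ^+ x.1.-1).
Proof.
move=> dE; split.
  move=> [ls [sl [al]]]; have [c c0 ->] := crl_op_apolar_form z sl dE.
  move=> /eqP; rewrite mulf_eq0 /Defs.cst !polyC_eq0 (negbTE c0) /= => /eqP/apolar_form_eq0 k.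
  (* The root of l1 + l2 X, at infinity when l2 = 0. *)
  pose t (l : CC * CC) := if l.2 == 0 then None else Some (- l.1 / l.2).
  exists (map t ls); first by rewrite size_map.
  have tE l : l != (0, 0) -> exists2 c, c != 0 & l.1%:P + l.2%:P * 'X = c *: lin (t l) :> {poly CC}.
    case: l => l1 l2; rewrite /t -pair_eqE /= negb_and; have [->|l20 _] := eqVneq l2 0.
      by rewrite orbF => l10; exists l1; rewrite // polyC0 mul0r addr0 /= alg_polyC.
    exists (- l2); rewrite ?oppr_eq0 //= scalerBr -!mul_polyC -polyCM.
    have -> : - l2 * (- l1 / l2) = l1 by field.
    by rewrite polyCN mulNr opprK.
  have [e e0 E] : exists2 e, e != 0 &
     \prod_(x <- zip lam ls) (x.2.1%:P + x.2.2%:P * 'X) ^+ x.1.-1 =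
     e *: \prod_(x <- zip lam (map t ls)) lin x.2 ^+ x.1.-1 :> {poly CC}.
    clear - al tE; elim: lam ls al => [|k lam IH] [|l ls] /= al;
      try by exists 1; rewrite ?oner_neq0 // !big_nil scale1r.
    case/andP: al => l0 /IH[e e0 E]; have [c c0 Ec] := tE l l0.
    exists (c ^+ k.-1 * e); first by rewrite mulf_neq0 ?expf_neq0.
    by rewrite !big_cons /= E Ec exprZn -scalerAl -scalerAr scalerA.
  by move: k; rewrite E; exact: killsZ.
move=> [ts st k].
pose l (t : option CC) : CC * CC := if t is Some x then (x, -1) else (1, 0).
exists (map l ts); split; first by rewrite size_map.
split.
  apply/allP => _ /mapP[[x|] _ ->]; rewrite -pair_eqE /= negb_and.
    by rewrite oppr_eq0 oner_eq0 orbT.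
  by rewrite oner_eq0.
have [|c c0 ->] := @crl_op_apolar_form _ z lam (map l ts) d _ dE; first by rewrite size_map.
suff -> : \prod_(x <- zip lam (map l ts)) (x.2.1%:P + x.2.2%:P * 'X) ^+ x.1.-1 =
     \prod_(x <- zip lam ts) lin x.2 ^+ x.1.-1 :> {poly CC}.
  by move/apolar_form_eq0: k => ->; rewrite mulr0.
clear; elim: lam ts => [|k lam IH] [|t ts] /=; rewrite ?big_nil // !big_cons IH /=.
congr (_ ^+ _ * _); case: t => [x|] /=; last by rewrite polyC0 mul0r addr0 polyC1.
by rewrite polyCN polyC1 mulN1r.
Qed.

(** * Sorting the dual varieties by partition *)

Lemma lins_undup {K : fieldType} (ts : seq (option K)) :
  lins ts = \prod_(t <- undup ts) lin t ^+ count_mem t ts.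
Proof.
rewrite -(perm_lins (perm_count_undup ts)) /lins big_flatten big_map.
by apply: eq_bigr => t _; rewrite big_nseq iter_mulr_1.
Qed.

Lemma sum_count_undup {T : eqType} (ts : seq T) :
  (\sum_(t <- undup ts) count_mem t ts = size ts)%N.
Proof.
rewrite -(perm_size (perm_count_undup ts)) size_flatten /shape -map_comp sumnE big_map.
by apply: eq_bigr => t _; rewrite /= size_nseq.
Qed.

Lemma count_undup_gt0 {T : eqType} (ts : seq T) t : t \in undup ts -> (0 < count_mem t ts)%N.
Proof. by rewrite mem_undup -has_pred1 has_count. Qed.

Ltac prove_kills := match goal with
  | k : kills _ _ ?h |- kills _ _ ?g => suff -> : g = h by []; rewrite ?big_cons ?big_nil /=; ring
  end.

Lemma dual_71 (z : 'rV[CC]_9) : dual 7 1 z -> dual_crl 8 [:: 8]%N z.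
Proof.
move=> [ts [st dt]]; rewrite lins_undup; have := sum_count_undup ts; rewrite st.
have := @count_undup_gt0 _ ts.
case: (undup ts) dt => [|t [|]] // _ _; rewrite ?big_nil ?big_seq1 // => -> k.
apply/(@dual_crlP _ _ 1); first by rewrite big_seq1.
by exists [:: t]; rewrite //= big_seq1.
Qed.

(** Two multiplicities with sum 6 are 3 + 3, 4 + 2 or 5 + 1, each one less than a part. A single
    point is used twice, as 3 + 3. *)
Lemma dual_62 (z : 'rV[CC]_9) : dual 6 2 z ->
  [\/ dual_crl 8 [:: 4; 4]%N z, dual_crl 8 [:: 5; 3]%N z | dual_crl 8 [:: 6; 2]%N z].
Proof.
move=> [ts [st dt]]; rewrite lins_undup; have := sum_count_undup ts; rewrite st.
have := @count_undup_gt0 _ ts.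
have d44 : (2 + \sum_(k <- [:: 4; 4]) k.-1 = 8)%N by rewrite !big_cons big_nil.
have d53 : (2 + \sum_(k <- [:: 5; 3]) k.-1 = 8)%N by rewrite !big_cons big_nil.
have d62 : (2 + \sum_(k <- [:: 6; 2]) k.-1 = 8)%N by rewrite !big_cons big_nil.
case: (undup ts) dt => [|t [|u [|]]] // _ pos; rewrite ?big_nil // !big_cons !big_nil ?addn0 ?mulr1.
  move=> -> k; constructor 1; apply/(dual_crlP _ d44); exists [:: t; t] => //.
  by prove_kills.
have := pos t (mem_head _ _); have := pos u; rewrite inE mem_head orbT => /(_ isT).
case: (count_mem t ts) => [|[|[|[|[|[|i]]]]]] //; case: (count_mem u ts) => [|[|[|[|[|[|j]]]]]] // _ _ e k;
    try by exfalso; lia.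
- by constructor 3; apply/(dual_crlP _ d62); exists [:: u; t] => //; prove_kills.
- by constructor 2; apply/(dual_crlP _ d53); exists [:: u; t] => //; prove_kills.
- by constructor 1; apply/(dual_crlP _ d44); exists [:: u; t] => //; prove_kills.
- by constructor 2; apply/(dual_crlP _ d53); exists [:: t; u] => //; prove_kills.
- by constructor 3; apply/(dual_crlP _ d62); exists [:: t; u] => //; prove_kills.
Qed.

(** Three multiplicities with sum 5 are 2 + 2 + 1 or 3 + 1 + 1. With fewer than three distinct
    points, some point is used several times. *)
Lemma dual_53 (z : 'rV[CC]_9) : dual 5 3 z ->
  dual_crl 8 [:: 3; 3; 2]%N z \/ dual_crl 8 [:: 4; 2; 2]%N z.
Proof.
move=> [ts [st dt]]; rewrite lins_undup; have := sum_count_undup ts; rewrite st.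
have := @count_undup_gt0 _ ts.
have d332 : (3 + \sum_(k <- [:: 3; 3; 2]) k.-1 = 8)%N by rewrite !big_cons big_nil.
have d422 : (3 + \sum_(k <- [:: 4; 2; 2]) k.-1 = 8)%N by rewrite !big_cons big_nil.
case: (undup ts) dt => [|t [|u [|v [|]]]] // _ pos; rewrite ?big_nil // !big_cons !big_nil ?addn0 ?mulr1.
- move=> -> k; left; apply/(dual_crlP _ d332); exists [:: t; t; t] => //.
  by prove_kills.
- have := pos t (mem_head _ _); have := pos u; rewrite inE mem_head orbT => /(_ isT).
  case: (count_mem t ts) => [|[|[|[|[|[|i]]]]]] //; case: (count_mem u ts) => [|[|[|[|[|[|j]]]]]] // _ _ e k;
    try by exfalso; lia.
  + by right; apply/(dual_crlP _ d422); exists [:: u; u; t] => //; prove_kills.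
  + by left; apply/(dual_crlP _ d332); exists [:: t; u; u] => //; prove_kills.
  + by left; apply/(dual_crlP _ d332); exists [:: t; u; t] => //; prove_kills.
  + by right; apply/(dual_crlP _ d422); exists [:: t; t; u] => //; prove_kills.
have := pos t (mem_head _ _); have := pos u; rewrite inE mem_head orbT => /(_ isT).
have := pos v; rewrite !inE eqxx !orbT => /(_ isT).
case: (count_mem t ts) => [|[|[|[|i]]]] //; case: (count_mem u ts) => [|[|[|[|j]]]] //;
  case: (count_mem v ts) => [|[|[|[|l]]]] // _ _ _ e k; try by exfalso; lia.
- by right; apply/(dual_crlP _ d422); exists [:: v; u; t] => //; prove_kills.
- by left; apply/(dual_crlP _ d332); exists [:: u; v; t] => //; prove_kills.
- by right; apply/(dual_crlP _ d422); exists [:: u; v; t] => //; prove_kills.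
- by left; apply/(dual_crlP _ d332); exists [:: t; v; u] => //; prove_kills.
- by left; apply/(dual_crlP _ d332); exists [:: t; u; v] => //; prove_kills.
- by right; apply/(dual_crlP _ d422); exists [:: t; u; v] => //; prove_kills.
Qed.

(** * Upper bound: where the topological boundaries lie *)

Lemma OmegaP r a : (0 < r)%N ->
  Omega 8 r a <-> waring_decomp 8 r a /\ ~ waring_decomp 8 r.-1 a.
Proof.
move=> r0; split=> [[wr nw]|[wr nw]]; split=> //; first by apply: nw; rewrite prednK.
by move=> r' r'r w; apply: nw; apply: waring_le w; rewrite -ltnS prednK.
Qed.

(** Off the closure of rank at most r - 1, all forms near a have rank exactly r, so a is interior.
    On that closure, a is interior to rank at most r - 1, which contradicts that it is a limit of
    forms of rank r. *)
Lemma top_boundary_step r (a : 'rV[RR]_9) : (0 < r)%N -> top_boundary 8 r a ->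
  (closure (waring_decomp 8 r) a -> interior (waring_decomp 8 r) a) ->
  (closure (waring_decomp 8 r.-1) a -> interior (waring_decomp 8 r.-1) a) -> False.
Proof.
move=> r0 [cl ncl] H1 H0.
have Rsub : Rdr 8 r `<=` waring_decomp 8 r.
  by move=> b /interior_subset /(OmegaP _ r0)[].
have i1 := H1 (closureS Rsub cl).
have [c0|nc0] := pselect (closure (waring_decomp 8 r.-1) a).
  have [b [Rb wb]] := cl _ (H0 c0).
  by have /(OmegaP _ r0)[_] := interior_subset Rb.
apply: ncl; apply: (interiorS (@subset_closure _ (Rdr 8 r))).
rewrite /Rdr ((interior_id _).1 (open_interior _)).
have : nbhs a (~` closure (waring_decomp 8 r.-1)).
  by apply: open_nbhs_nbhs; split=> //; apply: closed_openC; exact: closed_closure.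
apply: filterS2 i1 => b wb nb; apply/(OmegaP _ r0); split=> // w0.
by apply: nb; exact: subset_closure.
Qed.

Lemma closure_interior_waring r n (a : 'rV[RR]_9) : (0 < n)%N -> (n <= r)%N -> (r + n = 8)%N ->
  ~ dual r n (complexify a) ->
  closure (waring_decomp 8 r) a -> interior (waring_decomp 8 r) a.
Proof.
move=> n0 nr rn nd /closure_apolar[|ts st kt]; first by rewrite -rn leq_addr.
by apply: interior_waring nd => //; exists ts => //; move: kt; rewrite -rn addKn.
Qed.

Lemma top_boundary_6 a : top_boundary 8 6 a ->
  dual 6 2 (complexify a) \/ dual 5 3 (complexify a).
Proof.
move=> tb; apply: contrapT => /not_orP[n6 n5].
by apply: (top_boundary_step _ tb) => //; [apply: (@closure_interior_waring _ 2) | apply: (@closure_interior_waring _ 3)].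
Qed.

Lemma top_boundary_7 a : top_boundary 8 7 a ->
  dual 7 1 (complexify a) \/ dual 6 2 (complexify a).
Proof.
move=> tb; apply: contrapT => /not_orP[n6 n5].
by apply: (top_boundary_step _ tb) => //; [apply: (@closure_interior_waring _ 1) | apply: (@closure_interior_waring _ 2)].
Qed.

Lemma top_boundary_8 a : top_boundary 8 8 a -> dual 7 1 (complexify a).
Proof.
move=> tb; apply: contrapT => n7; apply: (top_boundary_step _ tb) => //.
  by move=> _; apply: filterS filterT => b _; exact: waring8.
by apply: (@closure_interior_waring _ 1).
Qed.

(** This stands in for the wall below rank 5: forms of rank at most 4 fill no open set, hence do not
    bound the region of rank 5. *)
Lemma waring4_det (a : 'rV[RR]_9) : waring_decomp 8 4 a -> \det (hankel 5 5 a) = 0.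
Proof.
move=> /waring_kills[//|ts st kt]; apply/eqP/det0P.
have sl : (size (lins ts) <= 5)%N by have := size_lins_le ts; rewrite st.
exists (poly_rV (lins ts)).
  apply: contraNneq (lins_neq0 ts) => e; rewrite -(poly_rV_K sl) e linear0 //.
by apply/rowP => j; rewrite hankelE // poly_rV_K // mxE kt // -ltnS.
Qed.

(** On the line from a to the form whose Hankel matrix is the antidiagonal permutation matrix, the
    determinant is a nonzero polynomial, so it is nonzero at points arbitrarily close to a. *)
Lemma det_hankel_dense (a : 'rV[RR]_9) e : 0 < e ->
  exists2 a', close e a a' & \det (hankel 5 5 a') != 0.
Proof.
move=> e0; pose b : 'rV[RR]_9 := \row_j (j == inord 4)%:R.
have db : \det (hankel 5 5 b) != 0.
  apply/det0P => -[v v0 /rowP vb]; move/eqP: v0; apply; apply/rowP => i; have := vb (rev_ord i); rewrite !mxE (bigD1 i) //= big1 ?addr0.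
    rewrite !mxE (_ : (i + _)%N = 4); first by rewrite eqxx mulr1.
    by have := ltn_ord i; rewrite /=; lia.
  move=> k ki; rewrite !mxE (_ : (_ == _) = false) ?mulr0 //.
  have hk : (k + rev_ord i < 9)%N by have := ltn_ord k; have := ltn_ord (rev_ord i); lia.
  apply: contraNF ki => /eqP /(congr1 val) /=; rewrite !inordK // => h.
  by apply/eqP/val_inj => /=; have := ltn_ord i; lia.
have [p Hp] : is_poly (fun x : RR => \det (hankel 5 5 (a + x *: (b - a)))).
  apply: is_poly_det => i j; apply: (@is_poly_ext _
     (fun x => a 0 (inord (i + j)) + x * ((b - a) 0 (inord (i + j))))).
    by move=> x; rewrite !mxE.
  apply: is_polyD; first exact: is_poly_cst.
  by apply: is_polyM; [exact: is_poly_id | exact: is_poly_cst].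
have p0 : p != 0.
  by apply: contraNneq db => p0; have := Hp 1; rewrite p0 horner0 scale1r addrC subrK => ->.
pose M := 1 + \sum_i `|(b - a) 0 i|.
have M0 : 0 < M by rewrite ltr_wpDr // sumr_ge0.
have [x [x0 xe px]] := poly_nonroot_small p0 (divr_gt0 e0 M0).
exists (a + x *: (b - a)); last by rewrite Hp.
move=> i; rewrite mxE [X in _ + X - _]mxE addrAC subrr add0r normrM gtr0_norm //.
move: xe; rewrite ltr_pdivlMr // => h; apply: le_lt_trans h.
rewrite ler_pM2l // /M (bigD1 i) //= addrCA lerDl addr_ge0 // sumr_ge0 //.
Qed.

Lemma det_hankel_open {R : realType} m (b : 'rV[R]_9) : \det (hankel m m b) != 0 ->
  exists2 e, 0 < e & forall c, close e b c -> \det (hankel m m c) != 0.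
Proof.
move=> db; apply/nearP.
have : \det (hankel m m c) @[c --> b] --> \det (hankel m m b).
  by apply: (@cvg_det _ _ (nbhs b) (nbhs_filter b) m (fun c => hankel m m c)); apply: mxcvg_hankel.
by move=> /cvgr_neq0; apply.
Qed.

(** Only rank at most 5 has to be an interior condition: inside it, forms with nonzero Hankel
    determinant are dense and have rank exactly 5, so a is interior to the closure. *)
Lemma top_boundary_5 a : top_boundary 8 5 a -> dual 5 3 (complexify a).
Proof.
move=> [cl ncl]; apply: contrapT => n5; apply: ncl.
have Rsub : Rdr 8 5 `<=` waring_decomp 8 5.
  by move=> b /interior_subset /(@OmegaP 5 _ isT)[].
have : interior (waring_decomp 8 5) a.
  by apply: (@closure_interior_waring 5 3) => //; exact: closureS Rsub _ cl.
rewrite -[X in X a -> _]((interior_id _).1 (open_interior _)).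
apply: filterS => b ib; apply/closure_closeP => e e0.
have /nbhs_closeP[d d0 Hd] : nbhs b (interior (waring_decomp 8 5)).
  by apply: open_nbhs_nbhs; split=> //; exact: open_interior.
have m0 : 0 < Num.min e d by rewrite lt_min e0.
have [b' cb db'] := det_hankel_dense b m0.
exists b'; first by apply: closeW cb; rewrite ge_min lexx.
have i5 : interior (waring_decomp 8 5) b' by apply: Hd; apply: closeW cb; rewrite ge_min lexx orbT.
have : nbhs b' [set c | \det (hankel 5 5 c) != 0].
  by apply/nbhs_closeP; exact: det_hankel_open.
apply: filterS2 i5 => c w5 dc; apply/(@OmegaP 5 _ isT); split=> // /waring4_det dc0.
by move: dc => /= /eqP; apply.
Qed.

(** * Polynomial functions on the space of forms *)

Import -(notations) mpoly.

Definition polyfun (F : 'rV[CC]_9 -> CC) :=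
  exists P : mpoly.mpoly 9 CC, forall z, F z = mpoly.meval (fun i => z 0 i) P.

Lemma polyfunD F G : polyfun F -> polyfun G -> polyfun (fun z => F z + G z).
Proof. by move=> [P HP] [Q HQ]; exists (P + Q) => z; rewrite rmorphD /= HP HQ. Qed.

Lemma polyfunM F G : polyfun F -> polyfun G -> polyfun (fun z => F z * G z).
Proof. by move=> [P HP] [Q HQ]; exists (P * Q) => z; rewrite rmorphM /= HP HQ. Qed.

Lemma polyfun_cst c : polyfun (fun=> c).
Proof. by exists (mpoly.mpolyC 9 c) => z; rewrite mpoly.mevalC. Qed.

Lemma polyfun_coord i : polyfun (fun z => z 0 i).
Proof. by exists (mpoly.mpolyX CC (mpoly.mnm1 i)) => z; rewrite mpoly.mevalXU. Qed.

Lemma polyfun_sum I (s : seq I) F : (forall i : I, polyfun (F i)) ->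
  polyfun (fun z => \sum_(i <- s) F i z).
Proof.
move=> HF; elim: s => [|i s IH].
  by under eq_fun do rewrite big_nil; exact: polyfun_cst.
by under eq_fun do rewrite big_cons; exact: polyfunD.
Qed.

Lemma polyfun_Lf (Q : {poly CC}) : polyfun (fun z => Lf z Q).
Proof.
apply: polyfun_sum => i; apply: polyfunM; [exact: polyfun_cst | exact: polyfun_coord].
Qed.

(** * Elimination theory on products of projective lines *)

(** A form of degree [e] takes at infinity the value of its top coefficient, so a vanishing top
    coefficient counts as a root. *)
Definition form_eval (e : nat) (c : nat -> CC) (t : option CC) : CC :=
  if t is Some x then \sum_(i < e.+1) c i * x ^+ i else c e.

(* Functions that are polynomial in z and, for each i, a form of degree [nth es i] in the
   i-th point of the projective line, points being encoded by [option CC]. *)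
Fixpoint multiform (es : seq nat) (F : 'rV[CC]_9 -> seq (option CC) -> CC) : Prop :=
  if es is e :: es' then
    exists c : nat -> 'rV[CC]_9 -> seq (option CC) -> CC, (forall i, multiform es' (c i)) /\
      forall z t ts, size ts = size es' -> F z (t :: ts) = form_eval e (fun i => c i z ts) t
  else polyfun (fun z => F z [::]).

Lemma multiform_ext es F G :
  (forall z ts, size ts = size es -> F z ts = G z ts) -> multiform es F -> multiform es G.
Proof.
case: es => [|e es] FG /=.
  by move=> [P HP]; exists P => z; rewrite -FG.
by move=> [c [hc E]]; exists c; split=> // z t ts st; rewrite -FG ?E //= st.
Qed.

Lemma multiformD es F G : multiform es F -> multiform es G ->
  multiform es (fun z ts => F z ts + G z ts).
Proof.
elim: es F G => [|e es IH] F G /=; first exact: polyfunD.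
move=> [c [hc Ec]] [d [hd Ed]]; exists (fun i z ts => c i z ts + d i z ts); split.
  by move=> i; apply: IH.
move=> z t ts st; rewrite Ec // Ed //; case: t => [x|] //=.
by rewrite -big_split; apply: eq_bigr => i _; rewrite mulrDl.
Qed.

Lemma multiformZ es k F : multiform es F -> multiform es (fun z ts => k * F z ts).
Proof.
elim: es F => [|e es IH] F /=; first by apply: polyfunM; exact: polyfun_cst.
move=> [c [hc Ec]]; exists (fun i z ts => k * c i z ts); split; first by move=> i; apply: IH.
move=> z t ts st; rewrite Ec //; case: t => [x|] //=.
by rewrite mulr_sumr; apply: eq_bigr => i _; rewrite mulrA.
Qed.

Lemma multiform0 es : multiform es (fun _ _ => 0).
Proof.
elim: es => [|e es IH] /=; first exact: polyfun_cst.
exists (fun _ _ _ => 0); split=> // z [x|] ts _ //=.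
by rewrite big1 // => i _; rewrite mul0r.
Qed.

Lemma multiform_cst k (es : seq nat) : multiform (map (muln 0) es) (fun _ _ => k).
Proof.
elim: es => [|e es IH] /=; first exact: polyfun_cst.
exists (fun _ _ _ => k); split=> // z [x|] ts _ //=.
by rewrite mul0n big_ord1 mulr1.
Qed.

Lemma multiform_sum es I (s : seq I) F : (forall i : I, multiform es (F i)) ->
  multiform es (fun z ts => \sum_(i <- s) F i z ts).
Proof.
move=> HF; elim: s => [|i s IH].
  by apply: multiform_ext (multiform0 es) => z ts _; rewrite big_nil.
by apply: multiform_ext (multiformD (HF i) IH) => z ts _; rewrite big_cons.
Qed.

Lemma predn_addS_le (a b c d : nat) :
  (a <= c.+1 -> b <= d.+1 -> (a + b).-1 <= (c + d).+1)%N.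
Proof. lia. Qed.

Lemma form_evalM e1 e2 a b t :
  form_eval e1 a t * form_eval e2 b t =
  form_eval (e1 + e2) (fun k => ((\poly_(i < e1.+1) a i) * (\poly_(i < e2.+1) b i))`_k) t.
Proof.
set p := \poly_(i < e1.+1) a i; set q := \poly_(i < e2.+1) b i.
have sp : (size p <= e1.+1)%N by apply: size_poly.
have sq : (size q <= e2.+1)%N by apply: size_poly.
case: t => [x|] /=.
  have -> : \sum_(i < e1.+1) a i * x ^+ i = p.[x] by rewrite horner_poly.
  have -> : \sum_(i < e2.+1) b i * x ^+ i = q.[x] by rewrite horner_poly.
  rewrite -hornerM (@horner_coef_wide _ (e1 + e2).+1) //.
  by apply: (leq_trans (size_polyMleq _ _)); exact: predn_addS_le.
rewrite coefM (bigD1 (inord e1)) //= inordK ?ltnS ?leq_addr // addKn !coef_poly !ltnSn.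
rewrite big1 ?addr0 // => i; rewrite -(inj_eq val_inj) /= inordK ?ltnS ?leq_addr // => ie.
have [h|h] := ltnP i e1.+1; last by rewrite coef_poly ltnNge h mul0r.
rewrite [X in _ * X]coef_poly ltnNge (_ : (e2 < e1 + e2 - i)%N) ?mulr0 //; lia.
Qed.

Lemma multiformM es1 es2 F G : size es1 = size es2 -> multiform es1 F -> multiform es2 G ->
  multiform [seq x.1 + x.2 | x <- zip es1 es2]%N (fun z ts => F z ts * G z ts).
Proof.
elim: es1 es2 F G => [|e1 es1 IH] [|e2 es2] F G //=; first by move=> _; exact: polyfunM.
move=> [ss] [c [hc Ec]] [d [hd Ed]].
exists (fun k z ts => ((\poly_(i < e1.+1) c i z ts) * (\poly_(i < e2.+1) d i z ts))`_k); split.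
  move=> k; apply: (@multiform_ext _ (fun z ts => \sum_(i <- enum 'I_k.+1)
     ((if (i < e1.+1)%N then c i z ts else 0) * (if (k - i < e2.+1)%N then d (k - i)%N z ts else 0)))).
    by move=> z ts _; rewrite coefM big_enum; apply: eq_bigr => i _; rewrite !coef_poly.
  apply: multiform_sum => i.
  apply: (IH es2 (fun z ts => if (i < e1.+1)%N then c i z ts else 0)
    (fun z ts => if (k - i < e2.+1)%N then d (k - i)%N z ts else 0)) => //.
    by case: (i < e1.+1)%N; [exact: hc | exact: multiform0].
  by case: (k - i < e2.+1)%N; [exact: hd | exact: multiform0].
move=> z t ts; rewrite size_map size_zip ss minnn => st.
by rewrite Ec ?ss // Ed // form_evalM.
Qed.

Lemma multiform_prod es I (s : seq I) F : (forall i : I, multiform es (F i)) ->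
  multiform (map (muln (size s)) es) (fun z ts => \prod_(i <- s) F i z ts).
Proof.
move=> HF; elim: s => [|i s IH].
  by apply: multiform_ext (multiform_cst 1 es) => z ts _; rewrite big_nil.
have := multiformM _ (HF i) IH; rewrite size_map => /(_ erefl).
have -> : [seq x.1 + x.2 | x <- zip es (map (muln (size s)) es)]%N = map (muln (size s).+1) es.
  by elim: es {HF IH} => //= e es ->.
by apply: multiform_ext => z ts _; rewrite big_cons.
Qed.

Lemma multiform_det es n (A : 'rV[CC]_9 -> seq (option CC) -> 'M[CC]_n) :
  (forall i j, multiform es (fun z ts => A z ts i j)) ->
  multiform (map (muln n) es) (fun z ts => \det (A z ts)).
Proof.
move=> hA; apply: (@multiform_ext _ (fun z ts => \sum_(s <- enum {perm 'I_n})
   ((-1) ^+ s * \prod_(i <- enum 'I_n) A z ts i (s i)))).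
  by move=> z ts _; rewrite big_enum; apply: eq_bigr => s _; rewrite big_enum.
apply: multiform_sum => s; apply: multiformZ.
have := @multiform_prod es _ (enum 'I_n) (fun i z ts => A z ts i (s i)).
by rewrite size_enum_ord; apply=> i.
Qed.

(** Both forms have the same formal degree [e], so the determinant has degree [e + e] in the
    coefficients; this is the factor by which the remaining degrees grow at each elimination. *)
Definition sylvester e (c d : nat -> CC) : 'M[CC]_(e + e) :=
  \matrix_(i, j) (if (i < e)%N then 'X^i * \poly_(k < e.+1) c k
                  else 'X^(i - e) * \poly_(k < e.+1) d k)`_j.

(** A common root x gives the kernel vector (1, x, x^2, ...), and a common root at infinity gives
    the last basis vector. *)
Lemma sylvester_eq0 e (c d : nat -> CC) t : (0 < e)%N -> form_eval e c t = 0 -> form_eval e d t = 0 ->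
  \det (sylvester e c d) = 0.
Proof.
move=> e0 ct dt; rewrite -det_tr; apply/eqP/det0P.
pose w : 'rV[CC]_(e + e) := \row_j (if t is Some x then x ^+ j else (j.+1 == e + e)%:R).
have e20 : (0 < e + e)%N by rewrite addn_gt0 e0.
exists w.
  apply/eqP => /rowP; rewrite /w; case: (t) => [x|] w0.
    by have := w0 (Ordinal e20); rewrite !mxE /= expr0 => /eqP; rewrite oner_eq0.
  have le : ((e + e).-1 < e + e)%N by rewrite ltn_predL.
  by have := w0 (Ordinal le); rewrite !mxE /= prednK // eqxx => /eqP; rewrite oner_eq0.
apply/rowP => i; rewrite !mxE.
have key (u : nat -> CC) m : form_eval e u t = 0 -> (m < e)%N ->
    \sum_j w 0 j * ('X^m * \poly_(k < e.+1) u k)`_j = 0.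
  move=> ut me; have su := size_poly e.+1 u; move: ut.
  have sP : (size ('X^m * \poly_(k < e.+1) u k)%R <= e + e)%N.
    rewrite (leq_trans (size_polyMleq _ _)) // size_polyXn addSn /=.
    by rewrite (leq_trans (leq_add (leqnn m) su)) // addnS -addSn leq_add2r.
  rewrite /w; case: (t) => [x|] /= ut.
    under eq_bigr => j _ do rewrite mxE mulrC.
    rewrite -(horner_coef_wide _ sP) hornerM.
    by rewrite [X in _ * X](_ : _ = 0) ?mulr0 // horner_poly.
  rewrite (bigD1 (Ordinal (_ : (e + e).-1 < e + e)%N)) ?ltn_predL //= => le.
  rewrite mxE /= prednK // eqxx mul1r coefXnM coef_poly.
  rewrite big1 ?addr0 => [|j jn].
    case: ltnP => // h1; case: ltnP => // h2.
    by rewrite (_ : ((e + e).-1 - m)%N = e) //; lia.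
  rewrite mxE; case: eqP => [h|]; last by rewrite mul0r.
  by case/eqP: jn; apply/val_inj => /=; lia.
case ie: (i < e)%N.
  by apply: etrans _ (key c i ct ie); apply: eq_bigr => j _; rewrite [X in _ * X = _]mxE [sylvester _ _ _ _ _]mxE ie.
have ie' : (i - e < e)%N by rewrite ltn_subLR ?ltn_ord // leqNgt ie.
by apply: etrans _ (key d _ dt ie'); apply: eq_bigr => j _; rewrite [X in _ * X = _]mxE [sylvester _ _ _ _ _]mxE ie.
Qed.

(** As the first form has no root at infinity, coprimality is decided at finite points. A kernel
    vector is a relation A p + B q = 0 in which p divides B, of smaller degree, so B = 0 and then A
    = 0. *)
Lemma sylvester_neq0 e (c d : nat -> CC) : c e != 0 ->
  (forall x, \sum_(i < e.+1) c i * x ^+ i = 0 -> \sum_(i < e.+1) d i * x ^+ i != 0) ->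
  \det (sylvester e c d) != 0.
Proof.
move=> ce nz; apply/det0P => -[v v0 vS]; move/eqP: v0; apply.
set p := \poly_(k < e.+1) c k; set q := \poly_(k < e.+1) d k.
have sp : size p = e.+1 by apply: size_poly_eq.
have sq : (size q <= e.+1)%N by apply: size_poly.
pose A := rVpoly (lsubmx v); pose B := rVpoly (rsubmx v).
have sA : (size A <= e)%N by apply: size_poly.
have sB : (size B <= e)%N by apply: size_poly.
have AB : A * p + B * q = 0.
  apply/polyP => j; rewrite coef0.
  have [je|je] := ltnP j (e + e); last first.
    rewrite nth_default // (leq_trans _ je) // (leq_trans (size_polyD _ _)) // geq_max.
    have key (x y : nat) : (x <= e -> y <= e.+1 -> (x + y).-1 <= e + e)%N by lia.
    by apply/andP; split; apply: (leq_trans (size_polyMleq _ _)); apply: key; rewrite ?sp.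
  have := congr1 (fun w : 'rV_(e + e) => w 0 (Ordinal je)) vS.
  rewrite [X in X = _]mxE [X in _ = X]mxE => H; apply: etrans _ H.
  rewrite big_split_ord /= coefD; congr (_ + _).
    rewrite (polyE sA) mulr_suml coef_sum; apply: eq_bigr => i _.
    rewrite /sylvester !mxE /= ltn_ord -scalerAl coefZ.
    by rewrite coef_rVpoly_ord mxE.
  rewrite (polyE sB) mulr_suml coef_sum; apply: eq_bigr => i _.
  rewrite /sylvester !mxE /= ltnNge leq_addr /= addKn -scalerAl coefZ.
  by rewrite coef_rVpoly_ord mxE.
have p0 : p != 0 by rewrite -size_poly_gt0 sp.
have cop : coprimep p q.
  apply/negPn/negP; rewrite /coprimep => /closed_rootP.
  move=> [x]; rewrite root_gcd /root !horner_poly => /andP[/eqP h /eqP h'].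
  by have := nz x h; rewrite h' eqxx.
have B0 : B = 0.
  have dv : p %| B * q by rewrite -dvdpNr -(addr0_eq AB) opprK dvdp_mull // dvdpp.
  have : p %| B by rewrite -(Gauss_dvdpl _ cop).
  by apply: contraTeq => Bn; apply/negP => /(dvdp_leq Bn); rewrite sp ltnNge sB.
have A0 : A = 0.
  by move: AB; rewrite B0 mul0r addr0 => /eqP; rewrite mulf_eq0 (negbTE p0) orbF => /eqP.
rewrite -[v]hsubmxK -[lsubmx v]rVpolyK -[rsubmx v]rVpolyK -/A -/B A0 B0 linear0.
exact: row_mx0.
Qed.

(* Requiring one equation that avoids finitely many points at once is what makes the
   induction work: the resultant of F and G is nonzero at a point as soon as G avoids
   the finitely many zeros of F above it. *)
Definition separable_set (es : seq nat) (S : 'rV[CC]_9 -> seq (option CC) -> Prop) :=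
  forall pts : seq ('rV[CC]_9 * seq (option CC)),
    (forall p, p \in pts -> size p.2 = size es /\ ~ S p.1 p.2) ->
    exists F, [/\ multiform es F,
      forall z ts, size ts = size es -> S z ts -> F z ts = 0 &
      forall p, p \in pts -> F p.1 p.2 != 0].

Lemma separable_projection e es S : (0 < e)%N -> separable_set (e :: es) S ->
  separable_set (map (muln (e + e)) es) (fun z ts => exists t, S z (t :: ts)).
Proof.
move=> e0 sep pts Hpts.
(* F avoids infinity above each p, so it has finitely many roots there; G will be asked to avoid
   these. *)
have [|F [mF SF nF]] := sep [seq (p.1, None :: p.2) | p <- pts].
  move=> _ /mapP[p pp ->]; have [sp nS] := Hpts p pp; split=> /=.
    by rewrite sp size_map.
  by move=> h; apply: nS; exists None.
have [c [hc Ec]] := mF.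
have cn p : p \in pts -> c e p.1 p.2 != 0.
  move=> pp; have := nF _ (map_f (fun p => (p.1, None :: p.2)) pp) => /=.
  by rewrite Ec //; have [-> _] := Hpts p pp; rewrite size_map.
pose P (p : 'rV[CC]_9 * seq (option CC)) : {poly CC} := \poly_(i < e.+1) c i p.1 p.2.
have /choice[rs Hrs] : forall p, exists rs : seq CC, forall x, P p != 0 -> root (P p) x -> x \in rs.
  move=> p; have [r rE] := closed_field_poly_normal (P p); exists r => x P0.
  by rewrite rE rootZ ?lead_coef_eq0 // root_prod_XsubC.
have [|G [mG SG nG]] := sep (flatten [seq [seq (p.1, Some x :: p.2) | x <- rs p] | p <- pts]).
  move=> q /flattenP[l /mapP[p pp ->]] /mapP[x _ ->]; have [sp nS] := Hpts p pp; split=> /=.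
    by rewrite sp size_map.
  by move=> h; apply: nS; exists (Some x).
have [d [hd Ed]] := mG.
exists (fun z ts => \det (sylvester e (fun i => c i z ts) (fun i => d i z ts))); split.
- apply: multiform_det => i j.
  have gen (m : nat) (u : nat -> 'rV[CC]_9 -> seq (option CC) -> CC) : (forall i, multiform es (u i)) ->
     multiform es (fun z ts => ('X^m * \poly_(k < e.+1) u k z ts)`_j).
    move=> hu; apply: (@multiform_ext _ (fun z ts =>
       if (j < m)%N then 0 else if (j - m < e.+1)%N then u (j - m)%N z ts else 0)).
      by move=> z ts _; rewrite coefXnM coef_poly.
    case: (j < m)%N; first exact: multiform0.
    by case: (j - m < e.+1)%N; [exact: hu | exact: multiform0].
  case ie: (i < e)%N.
    by apply: multiform_ext (gen i c hc) => z ts _; rewrite mxE ie.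
  by apply: multiform_ext (gen (i - e)%N d hd) => z ts _; rewrite mxE ie.
- move=> z ts; rewrite size_map => st [t Stt]; apply: (@sylvester_eq0 _ _ _ t) => //.
    by rewrite -Ec // SF //= st.
  by rewrite -Ed // SG //= st.
move=> p pp; apply: sylvester_neq0; first exact: cn.
move=> x Px.
have P0 : P p != 0.
  apply: contraNneq (cn p pp) => e'; have := congr1 (fun q : {poly CC} => q`_e) e'.
  by rewrite coef_poly ltnSn coef0 => ->.
have rx : x \in rs p by apply: Hrs => //; rewrite /root horner_poly Px.
have := nG (p.1, Some x :: p.2); rewrite Ed /=; last by have [-> _] := Hpts p pp; rewrite size_map.
apply; apply/flattenP; exists [seq (p.1, Some x :: p.2) | x <- rs p]; first exact: (map_f (fun p => [seq (p.1, Some x :: p.2) | x <- rs p])).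
exact: (map_f (fun x => (p.1, Some x :: p.2))).
Qed.

Lemma separable_ext es (S S' : 'rV[CC]_9 -> seq (option CC) -> Prop) :
  (forall z ts, S z ts <-> S' z ts) -> separable_set es S -> separable_set es S'.
Proof.
move=> SS sep pts Hp; have [|F [mF SF nF]] := sep pts.
  by move=> p /Hp[sp nS]; split=> // /SS.
by exists F; split=> // z ts st /SS; exact: SF.
Qed.

(** Induction on the number of points rather than on the list, since each projection rescales the
    remaining degrees; they stay positive. *)
Lemma separable_projections es S : all (ltn 0) es -> separable_set es S ->
  separable_set [::] (fun z _ => exists2 ts, size ts = size es & S z ts).
Proof.
have [n] := ubnP (size es); elim: n es S => // n IH [|e es] S /=.
  move=> _ _ sep pts Hp; have [|F [mF SF nF]] := sep pts.
    by move=> p /Hp[sp nS]; split=> // h; apply: nS; exists p.2.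
  exists F; split=> // z ts; case: ts => // _ [ts]; case: ts => // _; exact: SF.
move=> se /andP[e0 al] /(separable_projection e0) sep.
have al' : all (ltn 0) (map (muln (e + e)) es).
  by rewrite all_map; apply: sub_all al => k /= k0; rewrite muln_gt0 addn_gt0 e0.
have sm : (size (map (muln (e + e)) es) < n)%N by rewrite size_map; move: se; rewrite !ltnS.
apply: separable_ext (IH _ _ sm al' sep) => z _; rewrite size_map; split.
  by move=> [ts st [t Sts]]; exists (t :: ts); rewrite //= st.
by move=> [[|t ts] //= [st] Sts]; exists ts => //; exists t.
Qed.

(* The functions [sum_j s^j L_z(X^j h)] separate, as a nonzero polynomial in s has
   finitely many roots. *)
Lemma separable_kills (lam : seq nat) d :
  separable_set (map predn lam) (fun z ts => kills z d (\prod_(x <- zip lam ts) lin x.2 ^+ x.1.-1)).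
Proof.
move=> pts Hp.
pose h ts : {poly CC} := \prod_(x <- zip lam ts) lin x.2 ^+ x.1.-1.
pose Q (p : 'rV[CC]_9 * seq (option CC)) : {poly CC} := \poly_(j < d.+1) Lf p.1 ('X^j * h p.2).
have Q0 p : p \in pts -> Q p != 0.
  move=> pp; have [_ nk] := Hp p pp; apply: contra_not_neq nk => Q0 j jd.
  by have := congr1 (fun q : {poly CC} => q`_j) Q0; rewrite coef_poly ltnS jd coef0.
have P0 : \prod_(p <- pts) Q p != 0.
  by rewrite prodf_seq_neq0; apply/allP => p pp; rewrite Q0.
have [|i Hi] := @poly_nonroot _ _ (fun i => i%:R) _ P0.
  by move=> i j /eqP; rewrite eqr_nat => /eqP.
set s : CC := i%:R in Hi.
exists (fun z ts => \sum_(j < d.+1) s ^+ j * Lf z ('X^j * h ts)); split.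
- have gen (R : {poly CC}) : multiform (map predn lam) (fun z ts => Lf z (R * h ts)).
    rewrite /h; elim: (lam) R => [|k l IH] R /=.
      have [P HP] := polyfun_Lf R; exists P => z; by rewrite -HP big_nil mulr1.
    exists (fun i z ts => Lf z ((('C(k.-1, i)%:R *: (- 'X) ^+ (k.-1 - i)) * R) *
      \prod_(x <- zip l ts) lin x.2 ^+ x.1.-1)); split=> [i'|z t ts _]; first exact: IH.
    rewrite big_cons /=; case: t => [x|] /=; last first.
      by rewrite binn subnn expr0 !scale1r !expr1n !mul1r.
    rewrite [_ - _]addrC exprDn mulrA mulr_sumr mulr_suml linear_sum /=; apply: eq_bigr => j _.
    have LZ (e : CC) (u : {poly CC}) : e * Lf z u = Lf z (e *: u) by rewrite linearZ.
    rewrite [RHS]mulrC LZ; congr (Lf z _).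
    by rewrite -!mul_polyC -mulr_natr polyC_natr polyC_exp; ring.
  have E := @multiform_sum (map predn lam) _ (enum 'I_d.+1)
    (fun (j : 'I_d.+1) z ts => s ^+ j * Lf z ('X^j * h ts)).
  apply: multiform_ext (E _); first by move=> z ts _; rewrite big_enum.
  by move=> j; apply: multiformZ; exact: gen.
- move=> z ts _ k; rewrite big1 // => j _; rewrite k ?mulr0 //.
  by rewrite -ltnS.
move=> p pp; have : (Q p).[s] != 0.
  by apply: contraNneq Hi => Qs; rewrite horner_prod prodf_seq_eq0; apply/hasP; exists p; rewrite //= Qs.
rewrite horner_poly; under eq_bigr do rewrite mulrC.
by [].
Qed.

(** Zariski closedness of the dual variety: the pairs of a form and its points satisfy
    multihomogeneous equations, from which the points are eliminated one at a time. *)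
Lemma polyfun_separates (lam : seq nat) d z : all (ltn 1) lam ->
  (d + \sum_(k <- lam) k.-1 = 8)%N -> ~ dual_crl 8 lam z ->
  exists2 F, polyfun F & (forall w, dual_crl 8 lam w -> F w = 0) /\ F z != 0.
Proof.
move=> al dE nz; have al' : all (ltn 0) (map predn lam).
  by rewrite all_map; apply: sub_all al => -[|[]].
have [|F [mF SF nF]] := separable_projections al' (@separable_kills lam d) (pts := [:: (z, [::])]).
  move=> p; rewrite inE => /eqP ->; split=> //= h; apply: nz; apply/(dual_crlP _ dE).
  by have [ts st k] := h; exists ts; rewrite // -(size_map predn).
exists (fun z => F z [::]); first exact: mF.
split; last exact: (nF (z, [::]) (mem_head _ _)).
move=> w /(dual_crlP _ dE)[ts st k]; apply: (SF w [::] erefl); exists ts; last exact: k.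
by rewrite size_map.
Qed.

(* The factor X^2 avoids negative exponents when l has fewer than two elements. *)
Definition newton_remainder {R : realFieldType} (l : seq R) : {poly R} :=
  'X^2 * \prod_(x <- l) ('X - x%:P) - 'X^((size l).+2) + (\sum_(x <- l) x) *: 'X^((size l).+1)
  - (((\sum_(x <- l) x) ^+ 2 - \sum_(x <- l) x ^+ 2) / 2) *: 'X^(size l).

(** * Sign of the functional near a multiple configuration *)

Lemma sum_norm_le {R : realFieldType} (l : seq R) s : (forall x, x \in l -> `|x| <= s) ->
  `|\sum_(x <- l) x| <= (size l)%:R * s.
Proof.
elim: l => [|x l IH] ls; first by rewrite big_nil normr0 mul0r.
rewrite big_cons /= -natr1 mulrDl mul1r addrC (le_trans (ler_normD _ _)) // lerD //.
  by apply: IH => y yl; apply: ls; rewrite inE yl orbT.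
by apply: ls; rewrite mem_head.
Qed.

(** A new root x multiplies the remainder by X - x and adds - x e2 X^m, where the second elementary
    symmetric function e2 is of order s^2; so the order s^3 propagates. *)
Lemma newton_remainder_le {R : realFieldType} m : exists2 C : R, 0 <= C &
  forall l s, size l = m -> s <= 1 -> (forall x, x \in l -> `|x| <= s) ->
    forall k, `|(newton_remainder l)`_k| <= C * s ^+ 3.
Proof.
elim: m => [|m [C C0 HC]].
  exists 0 => // l s /size0nil -> _ _ k.
  rewrite /newton_remainder !big_nil scale0r addr0 expr0n subr0 mul0r scale0r subr0 mulr1 subrr.
  by rewrite coef0 normr0 mul0r.
exists (2 * C + m%:R ^+ 2 + m%:R); first by rewrite !addr_ge0 ?mulr_ge0 ?exprn_ge0.
move=> [|x l] s // [sl] s1 ls k.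
have xs : `|x| <= s by apply: ls; rewrite mem_head.
have s0 : 0 <= s by apply: le_trans xs.
have ls' y : y \in l -> `|y| <= s by move=> yl; apply: ls; rewrite inE yl orbT.
have := HC l s sl s1 ls'; set p1 := \sum_(x <- l) x.
have p1s : `|p1| <= m%:R * s by rewrite -sl; exact: sum_norm_le.
set e2 := (p1 ^+ 2 - \sum_(x <- l) x ^+ 2) / 2.
have e2s : `|e2| <= (m%:R ^+ 2 + m%:R) * s ^+ 2.
  have h1 : `|p1 ^+ 2| <= m%:R ^+ 2 * s ^+ 2.
    by rewrite normrX -exprMn ler_sqr // nnegrE ?mulr_ge0.
  have h2 : `|\sum_(x <- l) x ^+ 2| <= m%:R * s ^+ 2.
    rewrite -sl -(size_map (fun x => x ^+ 2)) -(big_map (fun x => x ^+ 2) predT id) /=.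
    apply: sum_norm_le => _ /mapP[y yl ->]; rewrite normrX ler_sqr ?nnegrE //.
    exact: ls'.
  rewrite /e2 normrM normfV (@ger0_norm _ 2) // ler_pdivrMr // mulrDl.
  rewrite (le_trans (ler_normB _ _)) //.
  have : 0 <= m%:R * s ^+ 2 by rewrite mulr_ge0 ?exprn_ge0.
  have : 0 <= m%:R ^+ 2 * s ^+ 2 by rewrite mulr_ge0 ?exprn_ge0.
  lra.
move=> Hl.
have -> : newton_remainder (x :: l) = 'X * newton_remainder l - x *: newton_remainder l
    - (x * e2) *: 'X^m.
  rewrite /newton_remainder !big_cons /= sl -/p1 -/e2.
  have -> : ((x + p1) ^+ 2 - (x ^+ 2 + \sum_(x <- l) x ^+ 2)) / 2 = e2 + x * p1.
    by rewrite /e2; field.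
  rewrite -!mul_polyC !polyCD !polyCM !exprS; ring.
rewrite !coefB !coefZ coefXM coefXn; clearbody e2.
have b1 : `|if k == 0%N then 0 else (newton_remainder l)`_k.-1| <= C * s ^+ 3.
  by case: ifP => // _; rewrite normr0 mulr_ge0 ?exprn_ge0.
have b2 : `|x * (newton_remainder l)`_k| <= C * s ^+ 3.
  by rewrite normrM -[X in _ <= X]mul1r ler_pM // (le_trans xs).
have b3 : `|x * e2 * (k == m)%:R| <= (m%:R ^+ 2 + m%:R) * s ^+ 3.
  rewrite !normrM normr_nat; apply: (@le_trans _ _ (`|x| * `|e2|)).
    have : 0 <= `|x| * `|e2| by rewrite mulr_ge0.
    by case: (k == m) => h; rewrite ?mulr1n ?mulr0n; lra.
  by rewrite exprS mulrCA ler_pM.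
rewrite (le_trans (ler_normB _ _)) // (le_trans (lerD (ler_normB _ _) (lexx _))) //.
lra.
Qed.

Lemma pcvg_ext {R : realType} {T : Type} (F : set_system T) (P Q : T -> {poly R}) (P0 : {poly R}) :
  P =1 Q -> pcvg F P P0 -> pcvg F Q P0.
Proof. by move=> /funext ->. Qed.

(* A centred monic polynomial with small real roots is X^m + e T with e <= 0 and T close
   to X^(m-2), because its higher symmetric functions are negligible against e. *)
Lemma centred_roots {R : realType} {T : Type} (F : set_system T) {FF : Filter F}
    (ds : seq (T -> R)) (rho : T -> R) (rho0 : R) : (0 < size ds)%N ->
  (forall d, List.In d ds -> d t @[t --> F] --> (0 : R)) -> rho t @[t --> F] --> rho0 ->
  exists (e : T -> R) (Q : T -> {poly R}), [/\ forall t, e t <= 0,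
    pcvg F Q (('X - rho0%:P) ^+ (size ds).-1) &
    forall t, ('X - (rho t - \sum_(d <- ds) d t)%:P) * \prod_(d <- ds) ('X - (rho t + d t)%:P) =
      ('X - (rho t)%:P) ^+ (size ds).+1 + e t *: Q t].
Proof.
move=> ds0 cd cr.
(* The additional root makes the sum zero, so the second elementary symmetric function is - [p2] /
   2, never positive. *)
pose l t := - (\sum_(d <- ds) d t) :: [seq d t | d <- ds].
pose m := (size ds).+1.
pose p2 t := \sum_(x <- l t) x ^+ 2.
have sl t : size (l t) = m by rewrite /= size_map.
have l0 t : \sum_(x <- l t) x = 0 by rewrite big_cons big_map addNr.
have p20 t : 0 <= p2 t by apply: sumr_ge0 => x _; exact: sqr_ge0.
pose W t := \prod_(x <- l t) ('X - x%:P).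
have WE t : 'X^2 * (W t - 'X^m + (p2 t / 2) *: 'X^(m - 2)) = newton_remainder (l t).
  rewrite /newton_remainder l0 scale0r addr0 expr0n sub0r sl -/(p2 t) -/(W t) mulNr scaleNr opprK.
  rewrite mulrDr mulrBr -exprD; congr (_ - _ + _).
  by rewrite -scalerAr -exprD subnKC // /m ltnS.
(* When [p2 t] = 0 all roots are zero, and the undefined quotient is replaced by its limit. *)
pose Q0 t : {poly R} := if p2 t == 0 then 'X^(m - 2) else (- p2 t / 2)^-1 *: (W t - 'X^m).
have Q0E t : W t = 'X^m + (- p2 t / 2) *: Q0 t.
  rewrite /Q0; case: eqP => [p0|/eqP p0].
    rewrite p0 oppr0 mul0r scale0r addr0 /W.
    have : all (fun x => x ^+ 2 == 0) (l t).
      by move/eqP: p0; rewrite psumr_eq0 // => x _; exact: sqr_ge0.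
    move=> /allP h; rewrite big_seq (eq_bigr (fun=> 'X)) => [|x /h].
      by rewrite -big_seq big_const_seq count_predT iter_mulr_1 sl.
    by rewrite sqrf_eq0 => /eqP ->; rewrite subr0.
  have nz : - p2 t / 2 != 0 by rewrite mulf_neq0 ?oppr_eq0 // invr_eq0 pnatr_eq0.
  by rewrite scalerA (divff nz) scale1r addrC subrK.
have [C C0 HC] := newton_remainder_le (R := R) m.
have cp2 : p2 t @[t --> F] --> 0.
  have cs (s : seq (T -> R)) (f : R -> R) : (forall d, List.In d s -> d t @[t --> F] --> (0 : R)) ->
      f 0 = 0 -> {for 0, continuous f} -> \sum_(d <- s) f (d t) @[t --> F] --> (0 : R).
    move=> + f0 cf; elim: s => [|d s IH] H.
      by under eq_fun do rewrite big_nil; exact: cvg_cst.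
    under eq_fun do rewrite big_cons.
    have c1 : f (d t) @[t --> F] --> f 0.
      by apply: continuous_cvg => //; apply: H; left.
    have c2 : \sum_(d <- s) f (d t) @[t --> F] --> 0.
      by apply: IH => d' dd'; apply: H; right.
    have h := cvgD c1 c2; rewrite f0 addr0 in h; exact: h.
  have c2 : {for 0, continuous (fun x : R => x ^+ 2)} by exact: exprn_continuous.
  have z2 : (0 : R) ^+ 2 = 0 by rewrite expr0n.
  have d1 : (\sum_(d <- ds) d t) ^+ 2 @[t --> F] --> (0 : R) ^+ 2.
    by apply: (continuous_cvg _ c2); apply: (cs ds id).
  have d2 : \sum_(d <- ds) (d t) ^+ 2 @[t --> F] --> 0 by apply: (cs ds (fun x => x ^+ 2)).
  rewrite /p2; under eq_fun do rewrite big_cons big_map sqrrN.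
  have h := cvgD d1 d2; rewrite z2 addr0 in h; exact: h.
have cQ0 : pcvg F Q0 'X^(m - 2).
  move=> k; apply/cvgrPdist_le => eps eps0.
  (* The square root of [p2] bounds every root, so the remainder is at most C times the third power
     of it, negligible against [p2] / 2. *)
  have s1 : \forall t \near F, Num.sqrt (p2 t) <= 1 /\ 2 * C * Num.sqrt (p2 t) <= eps.
    have cs : Num.sqrt (p2 t) @[t --> F] --> Num.sqrt 0.
      by apply: continuous_cvg => //; exact: sqrt_continuous.
    rewrite sqrtr0 in cs.
    have h1 : \forall t \near F, Num.sqrt (p2 t) <= 1 by move/cvgr_le : cs; apply.
    have h2 : \forall t \near F, 2 * C * Num.sqrt (p2 t) <= eps.
      have cs2 : 2 * C * Num.sqrt (p2 t) @[t --> F] --> 2 * C * 0.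
        by apply: cvgM => //; exact: cvg_cst.
      by rewrite mulr0 in cs2; move/cvgr_le : cs2; apply.
    by apply: filterS2 h1 h2.
  apply: filterS s1 => t [s1 se].
  have [p0|p0] := eqVneq (p2 t) 0; first by rewrite /Q0 p0 eqxx subrr normr0 ltW.
  have lt_s x : x \in l t -> `|x| <= Num.sqrt (p2 t).
    move=> xl; rewrite -sqrtr_sqr ler_sqrt // /p2 (big_rem x) //= lerDl.
    by apply: sumr_ge0 => y _; exact: sqr_ge0.
  have := HC (l t) _ (sl t) s1 lt_s k.+2; rewrite -WE coefXnM /= subSS subSS subn0.
  rewrite Q0E [_ + _ *: Q0 t]addrC addrK coefD !coefZ => h.
  have p2p : 0 < p2 t by rewrite lt_neqAle eq_sym p0 p20.
  have h' : `|(- p2 t / 2) * ((Q0 t)`_k - ('X^(m - 2))`_k)| <= C * Num.sqrt (p2 t) ^+ 3.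
    by apply: le_trans h; rewrite le_eqVlt; apply/orP; left; apply/eqP; congr `|_|; ring.
  rewrite distrC; apply: le_trans se.
  have e3 : Num.sqrt (p2 t) ^+ 3 = Num.sqrt (p2 t) * p2 t by rewrite exprS sqr_sqrtr.
  have e4 : `|- p2 t / 2| = p2 t / 2 by rewrite mulNr normrN gtr0_norm // divr_gt0.
  move: h'; rewrite normrM e3 e4.
  have -> : C * (Num.sqrt (p2 t) * p2 t) = p2 t / 2 * (2 * C * Num.sqrt (p2 t)) by field.
  by rewrite ler_pM2l // divr_gt0.
have sQ0 t : (size (Q0 t) <= m.+1)%N.
  rewrite /Q0; case: ifP => _; first by rewrite size_polyXn /m; lia.
  rewrite (leq_trans (size_scale_leq _ _)) // (leq_trans (size_polyD _ _)) // geq_max.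
  by rewrite size_polyN size_polyXn leqnn andbT /W size_prod_XsubC sl.
exists (fun t => - p2 t / 2), (fun t => Q0 t \Po ('X - (rho t)%:P)); split.
- by move=> t; rewrite mulNr oppr_le0 divr_ge0.
- have -> : ('X - rho0%:P) ^+ (size ds).-1 = 'X^(m - 2) \Po ('X - rho0%:P).
    by rewrite comp_Xn_poly /m subSS subn1.
  have E (P : {poly R}) r : (size P <= m.+1)%N ->
      P \Po ('X - r%:P) = \sum_(k < m.+1) (P`_k)%:P * ('X - r%:P) ^+ k.
    move=> sP; rewrite {1}(polyE sP) rmorph_sum; apply: eq_bigr => k _ /=.
    by rewrite comp_polyZ comp_Xn_poly mul_polyC.
  rewrite E ?size_polyXn; last by rewrite /m; lia.
  apply: (@pcvg_ext _ _ _ (fun t => \sum_(k < m.+1) ((Q0 t)`_k)%:P * ('X - (rho t)%:P) ^+ k)).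
    by move=> t; rewrite E.
  move=> j; rewrite coef_sum; under eq_fun do rewrite coef_sum.
  apply: cvg_bigsum => k.
  have := @pcvgM _ _ F FF (fun t => ((Q0 t)`_k)%:P) (fun t => ('X - (rho t)%:P) ^+ k)
     (('X^(m - 2))`_k)%:P (('X - rho0%:P) ^+ k); apply.
    exact: pcvgC (cQ0 k).
  apply: (@pcvg_ext _ _ _ (fun t => \prod_(i < k) ('X - (rho t)%:P))).
    by move=> t; rewrite prodr_const card_ord.
  rewrite -[X in _ ^+ X](card_ord k) -prodr_const; apply: pcvg_prod => i.
  by apply: pcvgD; [exact: pcvg_cst | apply: pcvgN; exact: pcvgC].
move=> t; set L := 'X - (rho t)%:P.
have -> : L ^+ (size ds).+1 + (- p2 t / 2) *: (Q0 t \Po L) = W t \Po L.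
  by rewrite Q0E comp_polyD comp_polyZ comp_Xn_poly.
rewrite /W big_cons big_map comp_polyM; congr (_ * _).
  by rewrite comp_polyB comp_polyX comp_polyC /L polyCN polyCB; ring.
rewrite rmorph_prod; apply: eq_bigr => d _ /=.
by rewrite comp_polyB comp_polyX comp_polyC /L polyCD; ring.
Qed.

(** g sends each of r linear factors to one of n roots, so the size of a fibre is the multiplicity
    of that root. *)
Definition fiber_size {n r} (g : 'I_r -> 'I_n) (i : 'I_n) := #|[pred k | g k == i]|.

Lemma pcvg_exp {R : realType} {T : Type} (F : set_system T) {FF : Filter F}
    (P : T -> {poly R}) (P0 : {poly R}) k : pcvg F P P0 -> pcvg F (fun t => P t ^+ k) (P0 ^+ k).
Proof.
move=> cP; elim: k => [|k IH].
  by rewrite expr0; under eq_fun do rewrite expr0; exact: pcvg_cst.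
by rewrite exprS; apply: (@pcvg_ext _ _ _ (fun t => P t * P t ^+ k)) => [t|];
  [rewrite exprS | exact: pcvgM].
Qed.

Lemma pcvg_XsubC {R : realType} {T : Type} (F : set_system T) {FF : Filter F}
    (c : T -> R) (c0 : R) : c t @[t --> F] --> c0 ->
  pcvg F (fun t => 'X - (c t)%:P) ('X - c0%:P).
Proof. by move=> cc; apply: pcvgD; [exact: pcvg_cst | apply: pcvgN; exact: pcvgC]. Qed.

(** For a multiple fibre this is [centred_roots], with [y] the centring root. In a simple fibre
    nothing splits: [e] is zero and the moving factor itself serves as [Y]. *)
Lemma fiber_expansion {R : realType} {T : Type} (F : set_system T) {FF : Filter F} n r
    (g : 'I_r -> 'I_n) (i : 'I_n) (rho : T -> R) (rho0 : R) (x : 'I_r -> T -> R) :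
  (0 < fiber_size g i)%N -> rho t @[t --> F] --> rho0 ->
  (forall k, g k = i -> x k t @[t --> F] --> rho0) ->
  exists (e y : T -> R) (Q Y : T -> {poly R}), [/\ forall t, e t <= 0,
    y t @[t --> F] --> rho0,
    forall t, ('X - (y t)%:P) * \prod_(k | g k == i) ('X - (x k t)%:P) =
      ('X - (rho t)%:P) ^+ fiber_size g i * Y t + e t *: Q t,
    pcvg F Y ('X - rho0%:P) /\ (forall t, size (Y t) <= 2)%N &
    (forall t, e t = 0) \/ (1 < fiber_size g i)%N /\
      pcvg F Q (('X - rho0%:P) ^+ (fiber_size g i).-1)].
Proof.
move=> f0 cr cx; pose ks := [seq k <- enum 'I_r | g k == i].
have sks : size ks = fiber_size g i by rewrite -sum1_size big_filter big_enum_cond /= sum1_card.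
have prodE (P : 'I_r -> {poly R}) : \prod_(k | g k == i) P k = \prod_(k <- ks) P k.
  by rewrite big_filter big_enum_cond.
have [f1|f1] := leqP (fiber_size g i) 1.
  have f11 : fiber_size g i = 1%N by apply/eqP; rewrite eqn_leq f1.
  exists (fun=> 0), rho, (fun=> 0), (fun t => \prod_(k | g k == i) ('X - (x k t)%:P)); split=> //.
  - by move=> t; rewrite f11 expr1 scaler0 addr0.
  - split.
      have -> : 'X - rho0%:P = \prod_(k | g k == i) ('X - rho0%:P).
        by rewrite prodr_const -/(fiber_size g i) f11 expr1.
      rewrite /pcvg => j; have H : pcvg F (fun t => \prod_(k <- ks) ('X - (x k t)%:P))
          (\prod_(k <- ks) ('X - rho0%:P)).
        have : forall k, k \in ks -> g k = i by move=> k; rewrite mem_filter => /andP[/eqP].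
        elim: (ks) => [|k l IH] H.
          by rewrite big_nil; under eq_fun do rewrite big_nil; exact: pcvg_cst.
        rewrite big_cons; apply: (@pcvg_ext _ _ _
          (fun t => ('X - (x k t)%:P) * \prod_(k <- l) ('X - (x k t)%:P))) => [t|].
          by rewrite big_cons.
        apply: pcvgM; first by apply: pcvg_XsubC; apply: cx; apply: H; rewrite mem_head.
        by apply: IH => k' kl; apply: H; rewrite inE kl orbT.
      by under eq_fun do rewrite prodE; rewrite prodE; exact: H.
    by move=> t; rewrite prodE size_prod_XsubC sks f11.
  - by left.
pose ds := [seq (fun t => x k t - rho t) | k <- ks].
have sds : size ds = fiber_size g i by rewrite size_map.
have cds d : List.In d ds -> d t @[t --> F] --> (0 : R).
  have : forall k, k \in ks -> g k = i by move=> k; rewrite mem_filter => /andP[/eqP].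
  rewrite /ds; elim: (ks) => //= k l IH H [<-|/IH]; last first.
    by apply=> k' kl; apply: H; rewrite inE kl orbT.
  have h := cvgB (cx k (H k (mem_head _ _))) cr; rewrite subrr in h; exact: h.
have [|e [Q [e0 cQ E]]] := centred_roots _ cds cr; first by rewrite sds.
exists e, (fun t => rho t - \sum_(d <- ds) d t), Q, (fun t => 'X - (rho t)%:P); split=> //.
- have cs : \sum_(d <- ds) d t @[t --> F] --> (0 : R).
    elim: (ds) cds => [|d l IH] H.
      by under eq_fun do rewrite big_nil; exact: cvg_cst.
    under eq_fun do rewrite big_cons.
    have h := cvgD (H d (or_introl erefl)) (IH (fun d' h => H d' (or_intror h))).
    rewrite addr0 in h; exact: h.
  have h := cvgB cr cs; rewrite subr0 in h; exact: h.
- move=> t; rewrite -exprSr -sds -E; congr (_ * _); rewrite prodE /ds big_map.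
  by apply: eq_bigr => k _; rewrite /= [rho t + _]addrC subrK.
- split; first exact: pcvg_XsubC.
  by move=> t; rewrite size_XsubC.
- by right; split=> //; rewrite -sds; exact: cQ.
Qed.

(** Each cluster P_i = A_i + e_i Q_i is replaced by A_i in turn. This removes e_i <= 0 times a
    quantity that tends to the positive number of the hypothesis, so the value does not decrease.
    The final product is the multiple configuration times n factors of degree at most 1, which the
    functional kills. *)
Lemma local_sign {R : realType} {T : Type} (F : set_system T) {FF : Filter F} n r
    (g : 'I_r -> 'I_n) (rho : 'I_n -> T -> R) (rho0 : 'I_n -> R) (x : 'I_r -> T -> R)
    (L : T -> 'rV[R]_9) L0 :
  (forall i, 0 < fiber_size g i)%N -> (forall i, rho i t @[t --> F] --> rho0 i) ->
  (forall k, x k t @[t --> F] --> rho0 (g k)) -> mxcvg F L L0 ->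
  (forall i, (1 < fiber_size g i)%N ->
    0 < Lf L0 (('X - (rho0 i)%:P) ^+ (fiber_size g i).-1 *
               \prod_(j | j != i) ('X - (rho0 j)%:P) ^+ (fiber_size g j).+1)) ->
  \forall t \near F, kills (L t) n (\prod_i ('X - (rho i t)%:P) ^+ fiber_size g i) ->
    exists y : 'I_n -> R, Lf (L t) (\prod_i ('X - (y i)%:P) * \prod_k ('X - (x k t)%:P)) <= 0.
Proof.
move=> f0 cr cx cL pos.
have /choice[e] : forall i, exists e : T -> R, exists y Q Y, [/\ forall t, e t <= 0,
    y t @[t --> F] --> rho0 i,
    forall t, ('X - (y t)%:P) * \prod_(k | g k == i) ('X - (x k t)%:P) =
      ('X - (rho i t)%:P) ^+ fiber_size g i * Y t + e t *: Q t,
    pcvg F Y ('X - (rho0 i)%:P) /\ (forall t, size (Y t) <= 2)%N &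
    (forall t, e t = 0) \/ (1 < fiber_size g i)%N /\
      pcvg F Q (('X - (rho0 i)%:P) ^+ (fiber_size g i).-1)].
  by move=> i; apply: fiber_expansion => // k <-.
move=> /choice[y] /choice[Q] /choice[Y] H.
pose A i t := ('X - (rho i t)%:P) ^+ fiber_size g i * Y i t.
pose A0 i := ('X - (rho0 i)%:P) ^+ (fiber_size g i).+1.
pose P i t := ('X - (y i t)%:P) * \prod_(k | g k == i) ('X - (x k t)%:P).
have PE i t : P i t = A i t + e i t *: Q i t by have [_ _ h _ _] := H i; exact: h.
have cA i : pcvg F (A i) (A0 i).
  have [_ _ _ [cY _] _] := H i; rewrite /A0 exprSr; apply: pcvgM => //.
  by apply: pcvg_exp; exact: pcvg_XsubC.
have cP i : pcvg F (P i) (A0 i).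
  have [_ cy _ _ _] := H i; rewrite /A0 exprS; apply: pcvgM; first exact: pcvg_XsubC.
  pose ks := [seq k <- enum 'I_r | g k == i].
  have -> : ('X - (rho0 i)%:P) ^+ fiber_size g i = \prod_(k | g k == i) ('X - (rho0 (g k))%:P).
    by rewrite /fiber_size -prodr_const; apply: eq_bigr => k /eqP ->.
  by apply: pcvg_prod => k; apply: pcvg_XsubC.
(* The clusters in [s1] have already been replaced, those in [s2] not yet. *)
have main s2 : forall s1, perm_eq (s1 ++ s2) (enum 'I_n) -> \forall t \near F,
    Lf (L t) (\prod_(i <- s1) A i t * \prod_(i <- s2) P i t) <= Lf (L t) (\prod_i A i t).
  elim: s2 => [|i s IH] s1 ps.
    apply: nearW => t; rewrite big_nil mulr1 -big_enum /=.
    by rewrite cats0 in ps; rewrite (perm_big _ ps) lexx.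
  have IH1 := IH (rcons s1 i); rewrite cat_rcons in IH1.
  have step : \forall t \near F,
      Lf (L t) (\prod_(i <- s1) A i t * \prod_(i <- i :: s) P i t) <=
      Lf (L t) (\prod_(i <- rcons s1 i) A i t * \prod_(i <- s) P i t).
    have E t : Lf (L t) (\prod_(i <- s1) A i t * \prod_(i <- i :: s) P i t) =
      Lf (L t) (\prod_(i <- rcons s1 i) A i t * \prod_(i <- s) P i t) +
      e i t * Lf (L t) (\prod_(i <- s1) A i t * Q i t * \prod_(i <- s) P i t).
      rewrite -[X in _ = _ + X]linearZ -linearD; congr (Lf _ _).
      rewrite big_cons -cats1 big_cat big_seq1 /= {1}(PE i t) -!mul_polyC; ring.
    have [e0 _ _ _ []] := H i.
      by move=> e00; apply: nearW => t; rewrite E e00 mul0r addr0.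
    move=> [f1 cQ].
    have : Lf (L t) (\prod_(i <- s1) A i t * Q i t * \prod_(i <- s) P i t) @[t --> F] -->
       Lf L0 (\prod_(i <- s1) A0 i * ('X - (rho0 i)%:P) ^+ (fiber_size g i).-1 * \prod_(i <- s) A0 i).
      apply: cvg_Lf => //; apply: pcvgM; last exact: pcvg_prod.
      by apply: pcvgM => //; exact: pcvg_prod.
    have -> : \prod_(i <- s1) A0 i * ('X - (rho0 i)%:P) ^+ (fiber_size g i).-1 * \prod_(i <- s) A0 i =
       ('X - (rho0 i)%:P) ^+ (fiber_size g i).-1 * \prod_(j | j != i) A0 j.
      have -> : \prod_(j | j != i) A0 j = \prod_(j <- enum 'I_n | j != i) A0 j.
        by rewrite big_enum_cond; apply: eq_bigl.
      have un : uniq (s1 ++ i :: s) by rewrite (perm_uniq ps) enum_uniq.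
      rewrite -(perm_big _ ps) big_cat big_cons /= eqxx /=.
      move: un; rewrite cat_uniq /= => /and3P[_ /norP[i1 _] /andP[i2 _]].
      have nP (l : seq 'I_n) : i \notin l -> \prod_(j <- l | j != i) A0 j = \prod_(j <- l) A0 j.
        move=> il; rewrite big_seq_cond [RHS]big_seq; apply: eq_bigl => j.
        by case jl: (j \in l) => //=; apply: contraNneq il => <-.
      rewrite !nP //; ring.
    move=> /cvgr_gt /(_ _ (pos i f1)); apply: filterS => t ct.
    by rewrite E gerDl mulr_le0_ge0 // ltW.
  by apply: filterS2 step (IH1 ps) => t; exact: le_trans.
have := main (enum 'I_n) [::] (perm_refl _); apply: filterS => t.
rewrite big_nil mul1r => le kt; exists (fun i => y i t).
apply: le_trans (le_trans le _); last first.
  rewrite big_split /= mulrC (killsP kt) //.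
  have sY i : (size (Y i t) <= 2)%N by have [_ _ _ [_ h] _] := H i; exact: h.
  have -> : n.+1 = (\sum_(i < n) 1).+1 by rewrite sum1_card card_ord.
  elim: (index_enum 'I_n) => [|i l IH]; first by rewrite !big_nil size_poly1.
  rewrite !big_cons (leq_trans (size_polyMleq _ _)) //.
  by have := leq_add (sY i) IH; case: (_ + _)%N.
rewrite le_eqVlt; apply/orP; left; apply/eqP; congr (Lf _ _).
rewrite big_enum /= big_split /=; congr (_ * _).
by rewrite (partition_big g predT).
Qed.

Definition pt {R : realFieldType} (th : R) := th / (1 - `|th|).

Lemma plin_pt {R : realFieldType} (th : R) : `|th| < 1 ->
  plin th = - (1 - `|th|) *: ('X - (pt th)%:P).
Proof.
move=> th1; have d0 : 1 - `|th| != 0 by rewrite subr_eq0 eq_sym lt_eqF.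
have E : (1 - `|th|)%:P * (pt th)%:P = th%:P by rewrite -polyCM /pt mulrC divfK.
by rewrite /plin -E -mul_polyC polyCN; ring.
Qed.

Lemma size_prod_XsubC_ord {R : idomainType} n (x : 'I_n -> R) : size (\prod_i ('X - (x i)%:P)) = n.+1.
Proof. by rewrite -big_enum /= size_prod_XsubC size_enum_ord. Qed.

Lemma plin_norm1 {R : realFieldType} (th : R) : `|th| = 1 -> plin th = th *: lin None.
Proof. by move=> h; rewrite /plin h subrr mul0r subr0 /lin -mul_polyC mulr1. Qed.

(** If q of degree r were apolar to the perturbed functional, then L(pp q) = eps > 0, because pp q
    is monic of degree 8, against [local_sign]. Away from the unique configuration apolarity already
    fails in the limit, and compactness joins the two cases. *)
Lemma boundary_outside {R : realType} {T : Type} (F : set_system T) {FF : Filter F} n r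
    (g : 'I_r -> 'I_n) (rho : 'I_n -> T -> R) (rho0 : 'I_n -> R)
    (L : T -> 'rV[R]_9) L0 (eps : T -> R) :
  (r + n = 8)%N -> (forall i, 0 < fiber_size g i)%N ->
  (forall i, rho i t @[t --> F] --> rho0 i) -> mxcvg F L L0 -> eps t @[t --> F] --> (0 : R) ->
  (forall i, (1 < fiber_size g i)%N ->
    0 < Lf L0 (('X - (rho0 i)%:P) ^+ (fiber_size g i).-1 *
               \prod_(j | j != i) ('X - (rho0 j)%:P) ^+ (fiber_size g j).+1)) ->
  (forall ts, size ts = r -> kills L0 n (lins ts) ->
    perm_eq ts [seq Some (rho0 (g k)) | k <- enum 'I_r]) ->
  \forall t \near F, 0 < eps t /\ kills (L t) n (\prod_i ('X - (rho i t)%:P) ^+ fiber_size g i) ->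
    forall ts, size ts = r -> ~ kills (L t - eps t *: delta_mx 0 ord_max) n (lins ts).
Proof.
move=> rn f0 cr cL ce pos uq.
have cL' : mxcvg F (fun t => L t - eps t *: delta_mx 0 ord_max) L0.
  move=> i j; rewrite -[L0 i j]subr0 -[X in _ - X](mul0r ((delta_mx 0 ord_max : 'rV[R]_9) i j)).
  under eq_fun do rewrite !mxE; rewrite !mxE.
  by apply: cvgB; [exact: cL | apply: cvgM => //; exact: cvg_cst].
apply: kills_near_covering => w w1.
have [kw|nk] := pselect (kills L0 n (plins w)); last first.
  by apply: filterS (not_killed_near cL' nk) => -[w' t] /= h _.
pose p th := if `|th| == 1 then None else Some (pt th) : option R.
have [c c0 wE] : exists2 c, c != 0 & plins w = c *: lins [tuple p (w 0 i) | i < r].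
  exists (\prod_i (if `|w 0 i| == 1 then w 0 i else 1 - `|w 0 i|)).
    apply/prodf_neq0 => i _; case: (`|w 0 i| =P 1) => [h|/eqP h].
      by apply/eqP => w0; move/esym/eqP: h; rewrite w0 normr0 oner_eq0.
    by rewrite subr_eq0 eq_sym.
  rewrite /plins /lins /= big_map big_enum -scaler_prod; apply: eq_bigr => i _; rewrite /p.
  case: eqP => [/plin_norm1 //|/eqP h]; rewrite plin_pt ?lt_neqAle ?h ?w1 //.
  by rewrite /= scaleNr -scalerN opprB.
(* By uniqueness w is the base configuration up to a permutation s, so [local_sign] applies with
   [g \o s]. *)
have /tuple_permP[s sE] : perm_eq [tuple p (w 0 i) | i < r] [tuple Some (rho0 (g k)) | k < r].
  by apply: uq; [rewrite size_tuple | apply: killsZ c0 _; rewrite -wE].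
have pw k : p (w 0 k) = Some (rho0 (g (s k))).
  move: sE => /val_inj /(congr1 (fun t => tnth t k)).
  by rewrite !tnth_mktuple.
have w1' k : `|w 0 k| < 1.
  by have := pw k; rewrite /p; case: eqP => // /eqP h _; rewrite lt_neqAle h w1.
have ptw k : pt (w 0 k) = rho0 (g (s k)).
  by have := pw k; rewrite /p lt_eqF // => -[].
have fs i : fiber_size (g \o s) i = fiber_size g i.
  rewrite /fiber_size -!sum1_card; rewrite [RHS](reindex_inj (@perm_inj _ s)).
  by apply: eq_bigl.
pose G := filter_prod (nbhs w) F.
have FG : Filter G by exact: filter_prod_filter.
have c2 (U : topologicalType) (f : T -> U) (l : U) : f t @[t --> F] --> l -> f x.2 @[x --> G] --> l.
  by move=> h; apply: (@cvg_comp _ _ _ snd f _ F) => //; exact: cvg_snd.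
have cw k : (x.1 : 'rV[R]_r) 0 k @[x --> G] --> w 0 k.
  apply: (@cvg_comp _ _ _ fst (fun v : 'rV[R]_r => v 0 k) _ (nbhs w)); first exact: cvg_fst.
  exact: coord_continuous.
have cn k : 1 - `|(x.1 : 'rV[R]_r) 0 k| @[x --> G] --> 1 - `|w 0 k|.
  by apply: cvgB; [exact: cvg_cst | apply: cvg_norm; exact: cw].
have H := @local_sign R _ G FG n r (g \o s) (fun i x => rho i x.2) rho0
  (fun k x => pt ((x.1 : 'rV[R]_r) 0 k)) (fun x => L x.2) L0.
have H1 : \forall x \near G, forall k, k \in enum 'I_r -> 1 - `|(x.1 : 'rV[R]_r) 0 k| > 0.
  apply: near_all => k _; move: (cn k) => /cvgr_gt; apply.
  by rewrite subr_gt0.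
have : \forall x \near G, kills (L x.2) n (\prod_i ('X - (rho i x.2)%:P) ^+ fiber_size (g \o s) i) ->
    exists y : 'I_n -> R, Lf (L x.2) (\prod_i ('X - (y i)%:P) *
       \prod_k ('X - (pt ((x.1 : 'rV[R]_r) 0 k))%:P)) <= 0.
  apply: H => [i|i|k||i].
  - by rewrite fs.
  - exact: (c2 R (rho i) (rho0 i) (cr i)).
  - rewrite /= -ptw; apply: cvgM => //; apply: cvgV => //.
    by rewrite gt_eqF // subr_gt0.
  - by move=> i j; exact: (c2 R (fun t => L t i j) (L0 i j) (cL i j)).
  - rewrite !fs => /pos; congr (_ < Lf _ (_ * _)).
    by apply: eq_bigr => j _; rewrite fs.
apply: filterS2 H1 => -[w' t] /= w'1 sgn [e0 kt] kw'.
have [|y ly] := sgn.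
  by under eq_bigr do rewrite fs; exact: kt.
move: ly; apply/negP; rewrite -ltNge.
set pp := \prod_i _; set q := \prod_k _.
have kq : kills (L t - eps t *: delta_mx 0 ord_max) n q.
  pose c' := \prod_k (- (1 - `|w' 0 k|)).
  have E : plins w' = c' *: q.
    rewrite /plins /c' /q -scaler_prod; apply: eq_bigr => k _; apply: plin_pt.
    by rewrite -subr_gt0; apply: w'1; rewrite mem_enum.
  apply: (@killsZ _ _ _ _ c'); last by rewrite -E.
  apply/prodf_neq0 => k _; rewrite oppr_eq0 gt_eqF //.
  by apply: w'1; rewrite mem_enum.
have sp : size pp = n.+1 by exact: size_prod_XsubC_ord.
have := killsP kq (_ : (size pp <= n.+1)%N); rewrite sp => /(_ (ltnSn n)).
have mon : (pp * q)`_8 = 1.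
  have m1 : pp \is monic by apply: monic_prod_XsubC.
  have m2 : q \is monic by apply: monic_prod_XsubC.
  have : pp * q \is monic by rewrite monicMl.
  rewrite monicE lead_coefE size_monicM ?monic_neq0 // sp size_prod_XsubC_ord.
  have -> : (n.+1 + r.+1).-1.-1 = 8%N by rewrite addSn addnS /= addnC.
  by move=> /eqP.
have -> : Lf (L t - eps t *: delta_mx 0 ord_max) (pp * q) = Lf (L t) (pp * q) - eps t.
  rewrite /Lf; under eq_bigr do rewrite !mxE mulrBr; rewrite sumrB; congr (_ - _).
  rewrite (bigD1 ord_max) //= big1 ?addr0 => [|i im].
    by rewrite /= mon mul1r mulr1.
  by rewrite (negbTE im) ?andbF !mulr0.
by move=> /eqP; rewrite subr_eq0 => /eqP ->.
Qed.

(* The functional annihilated by h that agrees with b on polynomials of degree below deg h. *)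
Definition sol {K : fieldType} (h : {poly K}) (b : 'rV[K]_9) : 'rV[K]_9 :=
  \row_j Lf b ('X^j %% h).

Lemma Lf_sol {K : fieldType} (h p : {poly K}) b : (size p <= 9)%N ->
  Lf (sol h b) p = Lf b (p %% h).
Proof.
move=> sp; rewrite {2}(polyE sp).
have -> : (\sum_(i < 9) p`_i *: 'X^i) %% h = \sum_(i < 9) p`_i *: ('X^i %% h).
  elim: (index_enum _) => [|i s IH]; first by rewrite !big_nil mod0p.
  by rewrite !big_cons modpD IH modpZl.
by rewrite linear_sum; apply: eq_bigr => i _; rewrite linearZ /= mxE.
Qed.

Lemma kills_sol {K : fieldType} n (h : {poly K}) b : (size h + n <= 9)%N -> kills (sol h b) n h.
Proof.
move=> sh j jn; rewrite Lf_sol ?modp_mull ?linear0 //.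
rewrite (leq_trans (size_polyMleq _ _)) // size_polyXn addSn /= addnC.
by rewrite (leq_trans _ sh) // leq_add2l.
Qed.

Lemma sol_id {K : fieldType} n r (h : {poly K}) a : size h = r.+1 -> (r + n = 8)%N ->
  kills a n h -> sol h a = a.
Proof.
move=> sh rn kh; apply/rowP => j; rewrite mxE -[RHS](Lf_Xn a j) [in RHS](divp_eq 'X^j h).
rewrite linearD /= (killsP kh) ?add0r // size_divp -?size_poly_eq0 ?sh // size_polyXn /=.
by have := ltn_ord j; lia.
Qed.

(** * Polynomial dependence on the roots *)

Definition cpoly {K : comNzRingType} (P : K -> {poly K}) := forall k, is_poly (fun s => (P s)`_k).

Lemma cpolyM {K : comNzRingType} (P Q : K -> {poly K}) :
  cpoly P -> cpoly Q -> cpoly (fun s => P s * Q s).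
Proof.
move=> hP hQ k; apply: (@is_poly_ext _ (fun s => \sum_(i < k.+1) (P s)`_i * (Q s)`_(k - i))).
  by move=> s; rewrite coefM.
by apply: is_poly_sum => i; apply: is_polyM.
Qed.

Lemma cpoly_prod {K : comNzRingType} I (s : seq I) (P : I -> K -> {poly K}) :
  (forall i, cpoly (P i)) -> cpoly (fun x => \prod_(i <- s) P i x).
Proof.
move=> H; elim: s => [|i s IH] k.
  by apply: (@is_poly_ext _ (fun=> (1 : {poly K})`_k)) => [x|];
    [rewrite big_nil | exact: is_poly_cst].
apply: (@is_poly_ext _ (fun x => (P i x * \prod_(j <- s) P j x)`_k)) => [x|].
  by rewrite big_cons.
exact: cpolyM.
Qed.

Lemma cpoly_XsubC {K : comNzRingType} (f : K -> K) : is_poly f -> cpoly (fun s => 'X - (f s)%:P).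
Proof.
move=> hf k; apply: (@is_poly_ext _ (fun s => ('X : {poly K})`_k - (if k == 0%N then f s else 0))).
  by move=> s; rewrite coefB coefC.
apply: is_polyD; first exact: is_poly_cst.
by apply: is_polyN; case: eqP => _; [exact: hf | exact: is_poly_cst].
Qed.

Lemma is_poly_sol {K : fieldType} r (h : K -> {poly K}) (b : K -> 'rV[K]_9) j :
  (forall s, h s \is monic /\ size (h s) = r.+1) -> cpoly h ->
  (forall i, is_poly (fun s => b s 0 i)) -> is_poly (fun s => sol (h s) (b s) 0 j).
Proof.
move=> mh ch hb.
have step s (q : {poly K}) : (size q <= r)%N -> ('X * q) %% h s = 'X * q - q`_r.-1 *: h s.
  move=> sq; have [m sh] := mh s.
  rewrite -[in LHS](subrK (q`_r.-1 *: h s) ('X * q)) modpD modpZl modpp scaler0 addr0.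
  apply: modp_small; rewrite sh ltnS; apply/leq_sizeP => k rk.
  rewrite coefB coefZ coefXM; have [rk'|kr] := ltnP r k.
    rewrite [(h s)`_k]nth_default ?sh // mulr0 subr0 (gtn_eqF (leq_ltn_trans _ rk')) //.
    by rewrite nth_default // (leq_trans sq) // -ltnS (ltn_predK rk').
  have -> : k = r by apply/eqP; rewrite eqn_leq kr.
  have -> : (h s)`_r = 1 by move: m; rewrite monicE lead_coefE sh => /eqP.
  case: eqP => [r0|_]; last by rewrite mulr1 subrr.
  by move: sq; rewrite r0 leqn0 size_poly_eq0 => /eqP ->; rewrite coef0 mul0r subr0.
have cX m : cpoly (fun s => 'X^m %% h s).
  elim: m => [|m IH] k.
    have [r0|r0] := posnP r.
      apply: (@is_poly_ext _ (fun=> 0)) => [s|]; last exact: is_poly_cst.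
      have [mo sh] := mh s; rewrite r0 in sh; have /size_poly1P[c c0 E] : size (h s) == 1%N by rewrite sh.
      by rewrite E modpC // coef0.
    apply: (@is_poly_ext _ (fun=> ('X^0 : {poly K})`_k)) => [s|]; last exact: is_poly_cst.
    by have [_ sh] := mh s; rewrite expr0 modp_small // size_poly1 sh ltnS.
  apply: (@is_poly_ext _ (fun s => ('X * ('X^m %% h s))`_k - ('X^m %% h s)`_r.-1 * (h s)`_k)).
    move=> s; rewrite exprS -modp_mul step ?coefB ?coefZ //.
    by have [_ sh] := mh s; rewrite -ltnS -sh ltn_modp -size_poly_eq0 sh.
  apply: is_polyD; first by apply: cpolyM => // i; exact: is_poly_cst.
  by apply: is_polyN; apply: is_polyM; [exact: IH | exact: ch].
apply: (@is_poly_ext _ (fun s => \sum_(i < 9) ('X^j %% h s)`_i * b s 0 i)).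
  by move=> s; rewrite mxE.
by apply: is_poly_sum => i; apply: is_polyM; [exact: cX | exact: hb].
Qed.

Lemma is_poly_near0 {R : realType} n (a : R -> 'rV[R]_n) e :
  (forall j, is_poly (fun s => a s 0 j)) -> 0 < e ->
  exists2 d, 0 < d & forall s, `|s| < d -> close e (a 0) (a s).
Proof.
move=> ha e0.
have FF : Filter (nbhs (0 : R)) := nbhs_filter 0.
have : \forall s \near (0 : R), forall j, j \in enum 'I_n -> `|a s 0 j - a 0 0 j| < e.
  apply: (@near_all _ (nbhs (0 : R)) FF) => j _; have [p Hp] := ha j.
  have : a s 0 j @[s --> (0 : R)] --> a 0 0 j.
    have E s : a s 0 j = \sum_(i < size p) p`_i * s ^+ i by rewrite Hp horner_coef.
    rewrite E; under eq_fun do rewrite E.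
    apply: (@cvg_bigsum R _ _ _ FF) => i; apply: cvgM; first exact: cvg_cst.
    elim: (i : nat) => [|k IH]; first by rewrite expr0; under eq_fun do rewrite expr0; exact: cvg_cst.
    by rewrite exprS; under eq_fun do rewrite exprS; apply: cvgM.
  by move=> /cvgr_distC_lt /(_ _ e0).
move=> /nbhs_ballP[d /= d0 H]; exists d => // s sd j; apply: H; last by rewrite mem_enum.
by rewrite /ball /= sub0r normrN.
Qed.

Lemma nondegenerate_open {R : realType} r n (a : 'rV[R]_9) : (r + n = 8)%N -> nondegenerate a n ->
  exists2 e, 0 < e & forall a', close e a a' -> nondegenerate a' n.
Proof.
move=> rn nd; pose M : 'rV[R]_9 -> 'M[R]_(n.+1, r.+1) := hankel n.+1 r.+1.
have r8 : (8 - n = r)%N by rewrite -rn addnK.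
have /row_freeP[psi Mpsi] : row_free (M a).
  apply: inj_row_free => v vM.
  have vz : rVpoly v = 0.
    apply: nd => [|j jr]; first exact: size_poly.
    have jr' : (j < r.+1)%N by rewrite ltnS -r8.
    by rewrite -(hankelE a v (Ordinal jr')) ?addSn ?addnS 1?addnC ?rn // vM mxE.
  by move: vz => /(congr1 (poly_rV : {poly R} -> 'rV_n.+1)); rewrite rVpolyK linear0.
have FF : Filter (nbhs a) := nbhs_filter a.
have /nearP[e e0 He] : \forall a' \near a, \det (M a' *m psi) != 0.
  have : \det (M a' *m psi) @[a' --> a] --> \det (M a *m psi).
    apply: (@cvg_det _ _ (nbhs a) FF _ (fun a' => M a' *m psi)).
    by apply: mxcvgM; [exact: mxcvg_hankel | exact: mxcvg_cst].
  by move=> /cvgr_neq0; apply; rewrite Mpsi det1 oner_neq0.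
exists e => // a' /He d0 q sq kq.
have qM : poly_rV q *m M a' = 0.
  apply/rowP => j; rewrite hankelE ?addSn ?addnS 1?addnC ?rn // poly_rV_K // mxE kq //.
  by rewrite r8 -ltnS.
have : poly_rV q = 0 :> 'rV_n.+1.
  apply: contraNeq d0 => q0; apply/det0P; exists (poly_rV q) => //.
  by rewrite mulmxA qM mul0mx.
by move/(congr1 rVpoly); rewrite poly_rV_K // linear0.
Qed.

Lemma boundary_outside_close {R : realType} n r (g : 'I_r -> 'I_n) (rho0 : 'rV[R]_n) L0 :
  (r + n = 8)%N -> (forall i, 0 < fiber_size g i)%N ->
  (forall i, (1 < fiber_size g i)%N ->
    0 < Lf L0 (('X - (rho0 0 i)%:P) ^+ (fiber_size g i).-1 *
               \prod_(j | j != i) ('X - (rho0 0 j)%:P) ^+ (fiber_size g j).+1)) ->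
  (forall ts, size ts = r -> kills L0 n (lins ts) ->
    perm_eq ts [seq Some (rho0 0 (g k)) | k <- enum 'I_r]) ->
  exists2 e, 0 < e & forall rho a eps, close e rho0 rho -> close e L0 a -> 0 < eps < e ->
    kills a n (\prod_i ('X - (rho 0 i)%:P) ^+ fiber_size g i) ->
    forall ts, size ts = r -> ~ kills (a - eps *: delta_mx 0 ord_max) n (lins ts).
Proof.
move=> rn f0 pos uq.
pose G := filter_prod (filter_prod (nbhs rho0) (nbhs L0)) (nbhs (0 : R)).
have F1 : Filter (filter_prod (nbhs rho0) (nbhs L0)) by exact: filter_prod_filter.
have FG : Filter G by exact: filter_prod_filter.
have := @boundary_outside R _ G FG n r g (fun i x => (x.1.1 : 'rV[R]_n) 0 i) (fun i => rho0 0 i)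
  (fun x => x.1.2) L0 (fun x => x.2) rn f0.
case=> [i|i j||||[A B] [/= [[A1 A2] [/= hA1 hA2] sA] hB] sub] //.
- apply: (@cvg_comp _ _ _ fst (fun x : 'rV[R]_n * 'rV[R]_9 => x.1 0 i) _
    (filter_prod (nbhs rho0) (nbhs L0))); first exact: cvg_fst.
  apply: (@cvg_comp _ _ _ fst (fun v : 'rV[R]_n => v 0 i) _ (nbhs rho0)); first exact: cvg_fst.
  exact: coord_continuous.
- apply: (@cvg_comp _ _ _ fst (fun x : 'rV[R]_n * 'rV[R]_9 => x.2 i j) _
    (filter_prod (nbhs rho0) (nbhs L0))); first exact: cvg_fst.
  apply: (@cvg_comp _ _ _ snd (fun v : 'rV[R]_9 => v i j) _ (nbhs L0)); first exact: cvg_snd.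
  exact: coord_continuous.
- exact: cvg_snd.
have /nearP[e1 e10 H1] := hA1; have /nearP[e2 e20 H2] := hA2.
have /nbhs_ballP[e3 /= e30 H3] := hB.
exists (Num.min e1 (Num.min e2 e3)); first by rewrite !lt_min e10 e20.
move=> rho a eps c1 c2 /andP[p0 pe] ka.
have := sub ((rho, a), eps); apply=> //; split=> /=.
- apply: (sA (rho, a)); split; [apply: H1 | apply: H2] => i.
    by apply: lt_le_trans (c1 i) _; rewrite ge_min lexx.
  by apply: lt_le_trans (c2 i) _; rewrite !ge_min lexx orbT.
- apply: H3; rewrite /ball /= sub0r normrN gtr0_norm //.
  by apply: lt_le_trans pe _; rewrite !ge_min lexx !orbT.
Qed.

Lemma close_sub_delta {R : realType} (a b : 'rV[R]_9) e eps : 0 < eps < e -> a = b ->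
  close e a (b - eps *: delta_mx 0 ord_max).
Proof.
move=> /andP[p0 pe] -> i; rewrite !mxE addrAC subrr add0r normrN normrM gtr0_norm //.
case: (_ && _); rewrite ?normr1 ?normr0 ?mulr1 ?mulr0 //; exact: lt_trans pe.
Qed.

Lemma close_open {R : realType} n (a b : 'rV[R]_n) e : close e a b ->
  exists2 c, 0 < c & forall b', close c b b' -> close e a b'.
Proof.
move=> cb; apply/nearP.
suff : \forall b' \near b, forall i, i \in enum 'I_n -> `|(b' : 'rV[R]_n) 0 i - a 0 i| < e.
  by apply: filterS => b' h i; apply: h; rewrite mem_enum.
apply: (@near_all _ (nbhs b) (nbhs_filter b)) => i _.
have : `|(b' : 'rV[R]_n) 0 i - a 0 i| @[b' --> b] --> `|b 0 i - a 0 i|.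
  have c1 : (b' : 'rV[R]_n) 0 i @[b' --> b] --> b 0 i by exact: coord_continuous.
  exact: cvg_norm (cvgB c1 (cvg_cst (a 0 i))).
by move=> /cvgr_lt; apply; exact: cb.
Qed.

(** * Real points of the hypersurfaces lie on two boundaries *)

Definition configuration {K : fieldType} {n r} (g : 'I_r -> 'I_n) (rho : 'rV[K]_n) : {poly K} :=
  \prod_i ('X - (rho 0 i)%:P) ^+ fiber_size g i.

Lemma configurationE {K : fieldType} n r (g : 'I_r -> 'I_n) (rho : 'rV[K]_n) :
  configuration g rho = \prod_k ('X - (rho 0 (g k))%:P).
Proof.
rewrite (partition_big g predT) //=; apply: eq_bigr => i _.
by rewrite /fiber_size -prodr_const; apply: eq_bigr => k /eqP ->.
Qed.

(** An apolar polynomial of degree r - 1, times an arbitrary linear factor, would be apolar of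
    degree r with a root outside [l]. *)
Lemma not_apolar_pred {R : realFieldType} r n (a : 'rV[R]_9) (l : seq (option R)) :
  (0 < r)%N -> (r + n = 8)%N ->
  (forall ts, size ts = r -> kills a n (lins ts) -> perm_eq ts l) ->
  forall ts, size ts = r.-1 -> ~ kills a n.+1 (lins ts).
Proof.
move=> r0 rn uq ts st kt.
have [s sl] : exists s, Some s \notin l.
  have [ns [_ sn fr]] := fresh_points 1 (pmap id l).
  case: ns sn fr => [|s [|]] // _ /(_ s (mem_head _ _)) h; exists s.
  by move: h; rewrite mem_pmap map_id.
have : perm_eq (Some s :: ts) l.
  apply: uq; first by rewrite /= st prednK.
  by rewrite lins_cons; apply: kills_mul kt _; rewrite size_lin.
by move=> /perm_mem /(_ (Some s)); rewrite mem_head (negbTE sl).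
Qed.

(* Near a0, forms killed by a configuration of the given type are limits of forms of rank r
   (separate the roots) and, along -y^8, of forms of rank r + 1. *)
Lemma local_boundary n r (g : 'I_r -> 'I_n) (rho0 : 'rV[RR]_n) (a0 : 'rV[RR]_9) :
  (0 < r)%N -> (r + n = 8)%N -> (forall i, 0 < fiber_size g i)%N ->
  (forall i, (1 < fiber_size g i)%N ->
    0 < Lf a0 (('X - (rho0 0 i)%:P) ^+ (fiber_size g i).-1 *
               \prod_(j | j != i) ('X - (rho0 0 j)%:P) ^+ (fiber_size g j).+1)) ->
  (forall ts, size ts = r -> kills a0 n (lins ts) ->
    perm_eq ts [seq Some (rho0 0 (g k)) | k <- enum 'I_r]) ->
  nondegenerate a0 n ->
  (exists2 e, 0 < e & forall a, close e a0 a -> waring_decomp 8 r.+1 a) ->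
  exists2 e, 0 < e & forall rho a, close e rho0 rho -> close e a0 a ->
    kills a n (configuration g rho) -> top_boundary 8 r a /\ top_boundary 8 r.+1 a.
Proof.
move=> r0 rn f0 pos uq nd [e4 e40 H4].
have [e1 e10 H1] := boundary_outside_close rn f0 pos uq.
have [e2 e20 H2] := nondegenerate_open rn nd.
have [e3 e30 H3] := not_apolar_open (not_apolar_pred r0 rn uq).
have r8 : (r <= 8)%N by rewrite -rn leq_addr.
have n8 : (8 - r = n)%N by rewrite -rn addKn.
have n8' : (8 - r.-1 = n.+1)%N by move: rn r0; clear; lia.
pose m := Num.min (Num.min e1 e2) (Num.min e3 e4).
have m0 : 0 < m by rewrite !lt_min e10 e20 e30.
have [m1 m2 m3 m4] : [/\ m <= e1, m <= e2, m <= e3 & m <= e4].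
  by split; rewrite /m !ge_min !lexx ?orbT.
clearbody m.
have half x : m <= x -> m / 2 <= x by move: m0; lra.
exists (m / 2); first by rewrite divr_gt0.
move=> rho a crho ca ka.
have near_a d b : d <= m / 2 -> close d a b -> close m a0 b.
  by move=> dm cb; rewrite (splitr m); apply: close_trans ca _; exact: closeW cb.
have not_pred b : close m a0 b -> ~ waring_decomp 8 r.-1 b.
  move=> cb /waring_kills[|ts st]; first by rewrite (leq_trans (leq_pred _)).
  by rewrite n8'; apply: H3 => //; exact: closeW cb.
have Rdr_near b vs : close m a0 b -> uniq vs -> size vs = r -> kills b n (rp vs) -> Rdr 8 r b.
  move=> cb uv sv kv.
  have [|d d0 Hd] := simple_roots_open uv sv rn r0 kv; first by apply: H2; exact: closeW cb.
  have := close_open cb.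
  move=> [c c0 Hc]; apply/nbhs_closeP; exists (Num.min c d); first by rewrite lt_min c0.
  move=> b' cb'; apply/(OmegaP _ r0); split.
    have [|ws [uw sw kw]] := Hd b'; first by apply: closeW cb'; rewrite ge_min lexx orbT.
    by apply: (kills_waring uw sw r8); rewrite n8.
  by apply: not_pred; apply: Hc; apply: closeW cb'; rewrite ge_min lexx.
have limit d : 0 < d -> exists2 b, close d a b & Rdr 8 r b.
  move=> d0; pose d' := Num.min d (m / 2).
  have d'0 : 0 < d' by rewrite lt_min d0 divr_gt0.
  (* The r factors move apart at different speeds, and [sol] deforms a accordingly. *)
  pose root k s : RR := rho 0 (g k) + s * (k : nat)%:R.
  pose h s : {poly RR} := \prod_(k < r) ('X - (root k s)%:P).
  have sh s : size (h s) = r.+1 by exact: size_prod_XsubC_ord.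
  have h0 : h 0 = configuration g rho.
    by rewrite configurationE; apply: eq_bigr => k _; rewrite /root mul0r addr0.
  have b0 : sol (h 0) a = a by apply: (sol_id (sh 0) rn); rewrite h0.
  have [|c c0 Hc] := @is_poly_near0 _ _ (fun s => sol (h s) a) d' _ d'0.
    move=> j; apply: (@is_poly_sol _ r) => [s||i].
    - by split; [apply: monic_prod_XsubC | exact: sh].
    - apply: cpoly_prod => k; apply: cpoly_XsubC; apply: is_polyD; first exact: is_poly_cst.
      by apply: is_polyM; [exact: is_poly_id | exact: is_poly_cst].
    - exact: is_poly_cst.
  (* The product of all differences of the moved roots as a polynomial in s: it is nonzero, so the
     roots are distinct for some arbitrarily small s. *)
  pose q : {poly RR} := \prod_(k < r) \prod_(l < r | l != k)
    ((rho 0 (g k) - rho 0 (g l))%:P + ((k : nat)%:R - (l : nat)%:R) *: 'X).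
  have q0 : q != 0.
    apply/prodf_neq0 => k _; apply/prodf_neq0 => l lk.
    apply: contraNneq lk => /(congr1 (fun p : {poly RR} => p`_1)).
    rewrite coefD coefC coefZ coefX mulr1 add0r coef0 => /eqP.
    by rewrite subr_eq0 eqr_nat => /eqP kl; apply/eqP/val_inj.
  have [s [s0 sc qs]] := poly_nonroot_small q0 c0.
  exists (sol (h s) a).
    rewrite -{1}b0; apply: (@closeW _ _ d'); first by rewrite ge_min lexx.
    by apply: Hc; rewrite gtr0_norm.
  pose vs := [seq root k s | k <- enum 'I_r].
  have vsE : rp vs = (-1) ^+ r *: h s.
    rewrite /rp /lins -map_comp big_map big_enum /=.
    have -> : (-1) ^+ r = \prod_(k < r) (-1 : RR) by rewrite prodr_const card_ord.
    rewrite -scaler_prod.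
    by apply: eq_bigr => k _; rewrite /= scaleN1r opprB.
  apply: (Rdr_near _ vs).
  - apply: (near_a d'); first by rewrite ge_min lexx orbT.
    by rewrite -{1}b0; apply: Hc; rewrite gtr0_norm.
  - rewrite map_inj_uniq ?enum_uniq // => k l kl; apply/eqP; apply: contraT => nkl.
    move/eqP: qs; case; rewrite /q horner_prod (bigD1 k) //= horner_prod (bigD1 l) ?(eq_sym l) //=.
    rewrite hornerD hornerC hornerZ hornerX (_ : _ + _ = root k s - root l s).
      by rewrite kl subrr !mul0r.
    rewrite /root; ring.
  - by rewrite size_map size_enum_ord.
  - apply: (@killsZ _ _ _ _ ((-1) ^+ r)); first by rewrite signr_eq0.
    rewrite vsE scalerA -exprD addnn -mul2n exprM sqrrN expr1n expr1n scale1r.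
    by apply: kills_sol; rewrite sh addSn rn.
have Rcl s b : Rdr 8 s b -> waring_decomp 8 s b by move=> /interior_subset [].
have outside eps : 0 < eps < m / 2 -> ~ closure (waring_decomp 8 r) (a - eps *: delta_mx 0 ord_max).
  move=> /andP[p0 pm] /closure_apolar[//|ts st]; rewrite n8; apply: H1 (st).
  - by apply: closeW crho; exact: half.
  - by apply: closeW ca; exact: half.
  - by rewrite p0 (lt_le_trans pm) // half.
  - exact: ka.
have eps_ex d : 0 < d -> exists2 eps, 0 < eps < d & 0 < eps < m / 2.
  move=> d0; have c0 : 0 < Num.min d (m / 2) by rewrite lt_min d0 divr_gt0.
  have h : 0 < Num.min d (m / 2) / 2 < Num.min d (m / 2).
    by rewrite divr_gt0 //= ltr_pdivrMr // ltr_pMr // ltr1n.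
  move: h => /andP[h1]; rewrite lt_min => /andP[h2 h3].
  by exists (Num.min d (m / 2) / 2); rewrite h1.
(* The form a is a limit of R_r. It is not interior to the closure, as a - eps y^8 lies outside.
   These same forms belong to R_(r+1) and tend to a. Finally R_r comes arbitrarily close to a and,
   being open and disjoint from R_(r+1), avoids its closure. *)
split; split.
- by apply/closure_closeP => d /limit.
- move=> /nbhs_closeP[d d0 Hd].
  have [eps p1 p2] := eps_ex d d0; apply: (outside eps p2).
  have := Hd _ (close_sub_delta p1 erefl); apply: closureS; exact: Rcl.
- apply/closure_closeP => d d0; have [eps p1 p2] := eps_ex d d0.
  exists (a - eps *: delta_mx 0 ord_max); first exact: close_sub_delta.
  have nb : nbhs (a - eps *: delta_mx 0 ord_max) (~` closure (waring_decomp 8 r)).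
    apply: open_nbhs_nbhs; split; last exact: outside.
    by apply: closed_openC; exact: closed_closure.
  have cm : close m a0 (a - eps *: delta_mx 0 ord_max).
    by apply: (near_a (m / 2)) => //; exact: close_sub_delta.
  have : nbhs (a - eps *: delta_mx 0 ord_max) [set b | close m a0 b].
    by apply/nbhs_closeP; exact: close_open.
  apply: filterS2 nb => b nb cb; apply/OmegaP => //; split.
    by apply: H4; exact: closeW cb.
  by move=> wb; apply: nb; exact: subset_closure.
- move=> /nbhs_closeP[d d0 Hd]; have [b cb Rb] := limit d d0.
  have [c [Oc Rc]] := Hd b cb _ (Rb : nbhs b (Omega 8 r)).
  have [_ /(_ r (ltnSn r))] := interior_subset Oc; apply; by case: Rc.
Qed.

(** * Zariski density of the real points *)

Lemma is_poly_polyfun F (z : CC -> 'rV[CC]_9) : polyfun F -> (forall j, is_poly (fun s => z s 0 j)) ->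
  is_poly (fun s => F (z s)).
Proof.
move=> [P HP] hz; apply: (@is_poly_ext _ (fun s => \sum_(m <- mpoly.msupp P)
   mpoly.mcoeff m P * \prod_i z s 0 i ^+ m i)) => [s|].
  by rewrite HP mpoly.mevalE.
apply: is_poly_sum => m; apply: is_polyM; first exact: is_poly_cst.
by apply: is_poly_prod => i; apply: is_polyX; exact: hz.
Qed.

Lemma size_configuration {K : fieldType} n r (g : 'I_r -> 'I_n) (rho : 'rV[K]_n) :
  size (configuration g rho) = r.+1.
Proof. by rewrite configurationE size_prod_XsubC_ord. Qed.

Lemma configuration_complexify n r (g : 'I_r -> 'I_n) (rho : 'rV[RR]_n) :
  configuration g (complexify rho) = map_poly (real_complex RR) (configuration g rho).
Proof.
rewrite !configurationE rmorph_prod; apply: eq_bigr => k _.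
by rewrite rmorphB /= map_polyC map_polyX complexifyE.
Qed.

Lemma sol_complexify (h : {poly RR}) b :
  sol (map_poly (real_complex RR) h) (complexify b) = complexify (sol h b).
Proof.
by apply/rowP => j; rewrite complexifyE !mxE -Lf_complexify map_modp map_polyXn.
Qed.

(** Along a line of parameters F is a polynomial in s, and infinitely many real zeros make it vanish
    identically. *)
Lemma sol_line n r (g : 'I_r -> 'I_n) F (x y : 'rV[RR]_n) (u v : 'rV[RR]_9) (c : nat -> RR) :
  polyfun F -> injective c ->
  (forall k, F (complexify (sol (configuration g (x + c k *: y)) (u + c k *: v))) = 0) ->
  forall s : CC, F (sol (configuration g (complexify x + s *: complexify y))
                        (complexify u + s *: complexify v)) = 0.
Proof.
move=> pF ic H s; pose h (s : CC) := configuration g (complexify x + s *: complexify y).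
have lineP m (a b : 'rV[CC]_m) i : is_poly (fun s => (a + s *: b) 0 i).
  apply: (@is_poly_ext _ (fun s => a 0 i + s * b 0 i)) => [t|]; first by rewrite !mxE.
  by apply: is_polyD; [|apply: is_polyM; [exact: is_poly_id|]]; exact: is_poly_cst.
have [p Hp] : is_poly (fun s => F (sol (h s) (complexify u + s *: complexify v))).
  apply: is_poly_polyfun => // j; apply: (@is_poly_sol _ r) => [t||i] //.
  - split; last exact: size_configuration.
    by rewrite /h configurationE; apply: monic_prod_XsubC.
  - move=> k; apply: (@is_poly_ext _ (fun s => (\prod_i ('X - ((complexify x + s *: complexify y) 0 (g i))%:P))`_k)).
      by move=> t; rewrite /h configurationE.
    by apply: cpoly_prod => i; apply: cpoly_XsubC; exact: lineP.
rewrite (Hp s); have [->|p0] := eqVneq p 0; first by rewrite horner0.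
have [|k] := @poly_nonroot _ p (fun k => (c k)%:C%C) _ p0.
  by move=> i j /(congr1 (fun z : CC => complex.Re z)) /= /ic.
have cE m (a b : 'rV[RR]_m) (t : RR) : complexify a + t%:C%C *: complexify b = complexify (a + t *: b).
  by apply/rowP => i; rewrite complexifyE !mxE rmorphD rmorphM.
by rewrite -(Hp (c k)%:C%C) /h !cE configuration_complexify sol_complexify H eqxx.
Qed.

(** The vanishing of P spreads from a neighbourhood of (rho0, a0) to all real parameters along lines
    through that point, then to complex ones along imaginary directions. Roots at infinity are made
    finite by t / (1 - s t); the result is polynomial in s, hence also vanishes at s = 0. *)
Lemma zariski_configuration n r (g : 'I_r -> 'I_n) rho0 a0 e (S : set 'rV[RR]_9) :
  (r + n = 8)%N -> kills a0 n (configuration g rho0) -> 0 < e ->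
  (forall rho a, close e rho0 rho -> close e a0 a -> kills a n (configuration g rho) -> S a) ->
  forall (z : 'rV[CC]_9) ts, kills z n (\prod_i lin (ts i) ^+ fiber_size g i) -> zariski_closure S z.
Proof.
move=> rn k0 e0 HS z ts kz P hP.
pose F (w : 'rV[CC]_9) := mpoly.meval (fun i => w 0 i) P.
have pF : polyfun F by exists P.
have realF rho b : F (complexify (sol (configuration g rho) b)) = 0.
  have lineP m (a b' : 'rV[RR]_m) i : is_poly (fun s => (a + s *: b') 0 i).
    apply: (@is_poly_ext _ (fun s => a 0 i + s * b' 0 i)) => [t|]; first by rewrite !mxE.
    by apply: is_polyD; [|apply: is_polyM; [exact: is_poly_id|]]; exact: is_poly_cst.
  pose h s := configuration g (rho0 + s *: (rho - rho0)).
  pose a s := sol (h s) (a0 + s *: (b - a0)).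
  have a00 : a 0 = a0.
    by rewrite /a /h !scale0r !addr0; apply: sol_id rn k0; exact: size_configuration.
  have [|d1 d10 H1] := @is_poly_near0 _ _ a e _ e0.
    move=> j; apply: (@is_poly_sol _ r) => [t||i] //.
    - split; last exact: size_configuration.
      by rewrite /h configurationE; apply: monic_prod_XsubC.
    - move=> k; apply: (@is_poly_ext _ (fun s => (\prod_i ('X - ((rho0 + s *: (rho - rho0)) 0 (g i))%:P))`_k)).
        by move=> t; rewrite /h configurationE.
      by apply: cpoly_prod => i; apply: cpoly_XsubC; exact: lineP.
  have [|d2 d20 H2] := @is_poly_near0 _ _ (fun s => rho0 + s *: (rho - rho0)) e _ e0.
    by move=> j; exact: lineP.
  rewrite scale0r addr0 in H2; rewrite a00 in H1.
  pose d := Num.min d1 d2.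
  have d0 : 0 < d by rewrite lt_min d10.
  pose c (k : nat) : RR := d / k.+2%:R.
  have c0 k : 0 < c k by rewrite divr_gt0 // ltr0n.
  have cd k : c k < d by rewrite ltr_pdivrMr ?ltr0n // ltr_pMr // ltr1n.
  have ic : injective c.
    move=> i j /(mulfI (lt0r_neq0 d0)) /invr_inj /eqP.
    by rewrite eqr_nat => /eqP [].
  have ck k : F (complexify (a (c k))) = 0.
    apply: hP; apply: (HS (rho0 + c k *: (rho - rho0))).
    - by apply: H2; rewrite gtr0_norm //; apply: lt_le_trans (cd k) _; rewrite ge_min lexx orbT.
    - by apply: H1; rewrite gtr0_norm //; apply: lt_le_trans (cd k) _; rewrite ge_min lexx.
    - by apply: kills_sol; rewrite size_configuration addSn rn.
  have cE m (u v : 'rV[RR]_m) : complexify u + complexify (v - u) = complexify v.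
    by apply/rowP => i; rewrite mxE !complexifyE !mxE -rmorphD [u _ _ + _]addrC subrK.
  have := sol_line pF ic ck 1.
  by rewrite !scale1r !cE configuration_complexify sol_complexify.
have complexF rho b : F (sol (configuration g rho) b) = 0.
  have split m (w : 'rV[CC]_m) : w = complexify (map_mx (fun x : CC => complex.Re x) w) +
      'i%C *: complexify (map_mx (fun x : CC => complex.Im x) w).
    by apply/rowP => i; rewrite !mxE -complexE.
  rewrite (split _ rho) (split _ b); apply: (sol_line (c := fun k => k%:R)) => //.
    by move=> i j /eqP; rewrite eqr_nat => /eqP.
have actF s : s != 0 -> (forall i x, ts i = Some x -> 1 - s * x != 0) -> F (act 1 0 (- s) 1 z) = 0.
  move=> s0 hs; pose tr := [seq ts (g k) | k <- enum 'I_r].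
  have E (f : 'I_n -> option CC) : \prod_i lin (f i) ^+ fiber_size g i = lins [seq f (g k) | k <- enum 'I_r].
    rewrite /lins big_map big_enum /= (partition_big g predT) //=; apply: eq_bigr => i _.
    by rewrite /fiber_size -prodr_const; apply: eq_bigr => k /eqP ->.
  have str : (size tr + n = 8)%N by rewrite size_map size_enum_ord.
  have det1 : 1 * 1 - 0 * - s != 0 :> CC by rewrite mul0r subr0 mulr1 oner_neq0.
  have := kz; rewrite E => /(kills_act_map det1 str).
  rewrite /tr -map_comp -(E (fun i => mob 1 0 (- s) 1 (ts i))).
  have /choice[rho Hrho] : forall i, exists x, mob 1 0 (- s) 1 (ts i) = Some x.
    move=> i; have := hs i; case: (ts i) => [x /(_ x erefl) sx|_] /=.
      by rewrite mulNr addrC (negbTE sx); eexists.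
    by rewrite oppr_eq0 (negbTE s0); eexists.
  have -> : \prod_i lin (mob 1 0 (- s) 1 (ts i)) ^+ fiber_size g i =
      (-1) ^+ r *: configuration g (\row_i rho i).
    rewrite configurationE E /lins big_map big_enum /=.
    have -> : (-1) ^+ r = \prod_(k < r) (-1 : CC) by rewrite prodr_const card_ord.
    rewrite -scaler_prod; apply: eq_bigr => k _.
    by rewrite Hrho mxE /= scaleN1r opprB.
  move=> ka; have /(sol_id (size_configuration _ _) rn) <- : kills (act 1 0 (- s) 1 z) n (configuration g (\row_i rho i)).
    by apply: killsZ ka; rewrite signr_eq0.
  exact: complexF.
have [p Hp] : is_poly (fun s => F (act 1 0 (- s) 1 z)).
  apply: is_poly_polyfun => // j.
  apply: (@is_poly_ext _ (fun s => \sum_(i < 9) ((1 *: 'X + 0%:P) ^+ j * ((- s) *: 'X + 1%:P) ^+ (8 - j))`_i * z 0 i)).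
    by move=> s; rewrite mxE.
  apply: is_poly_sum => i; apply: is_polyM; last exact: is_poly_cst.
  move: (i : nat); apply: cpolyM; first by move=> k; exact: is_poly_cst.
  elim: (8 - j)%N => [|m IH] k.
    by apply: (@is_poly_ext _ (fun=> (1 : {poly CC})`_k)) => [s|];
      [rewrite expr0 | exact: is_poly_cst].
  apply: (@is_poly_ext _ (fun s => ((- s *: 'X + 1%:P) * (- s *: 'X + 1%:P) ^+ m)`_k)) => [s|].
    by rewrite exprS.
  apply: cpolyM => // l; apply: (@is_poly_ext _ (fun s => - s * ('X : {poly CC})`_l + (1%:P : {poly CC})`_l)).
    by move=> s; rewrite coefD coefZ.
  apply: is_polyD; last exact: is_poly_cst.
  by apply: is_polyM; [apply: is_polyN; exact: is_poly_id | exact: is_poly_cst].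
have p0 : p = 0.
  (* [D] vanishes at the excluded s: at 0, where infinity stays fixed, and wherever a finite root is
     sent to infinity. *)
  pose D : {poly CC} := 'X * \prod_i (1 - (odflt 0 (ts i)) *: 'X).
  have D0 : D != 0.
    rewrite mulf_neq0 ?polyX_eq0 //; apply/prodf_neq0 => i _.
    apply/eqP => /(congr1 (fun q : {poly CC} => q.[0])) /eqP.
    by rewrite hornerD hornerN hornerZ hornerX hornerC horner0 mulr0 subr0 oner_eq0.
  apply: contraTeq isT => pn0.
  have [|k] := @poly_nonroot _ (p * D) (fun k => k%:R) _ (mulf_neq0 pn0 D0).
    by move=> i j /eqP; rewrite eqr_nat => /eqP.
  rewrite hornerM mulf_eq0 negb_or => /andP[pk]; rewrite hornerM hornerX mulf_eq0 negb_or => /andP[k0' Dk].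
  move: pk; rewrite -Hp actF ?eqxx // => i x tx; apply: contraNneq Dk => E.
  rewrite horner_prod (bigD1 i) //= tx /= hornerD hornerN hornerZ hornerX hornerC.
  by rewrite [x * _]mulrC E mul0r.
have := Hp 0; rewrite p0 horner0 /F => h; rewrite -[RHS]h; congr (mpoly.meval _ P).
apply/funext => j; rewrite mxE scale1r addr0 oppr0 scale0r add0r expr1n mulr1.
by rewrite Lf_Xn.
Qed.

(** * Explicit moment vectors and uniqueness of the apolar polynomial *)

Definition vec {K : fieldType} (s : seq K) : 'rV[K]_9 := \row_i s`_i.

Lemma Lf_vec {K : fieldType} (s : seq K) p : Lf (vec s) p = \sum_(i < 9) p`_i * s`_i.
Proof. by apply: eq_bigr => i _; rewrite mxE. Qed.

Lemma kills_vec {K : fieldType} (s : seq K) n m (h : {poly K}) :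
  (m + n <= 8)%N -> (size h <= m.+1)%N ->
  kills (vec s) n h <-> forall j, (j <= n)%N -> \sum_(i < m.+1) h`_i * s`_(i + j) = 0.
Proof.
move=> mn sh; suff E j : (j <= n)%N -> Lf (vec s) ('X^j * h) = \sum_(i < m.+1) h`_i * s`_(i + j).
  by split=> H j jn; [rewrite -E // H | rewrite E // H].
move=> jn; rewrite {1}(polyE sh) mulr_sumr linear_sum; apply: eq_bigr => i _ /=.
rewrite -scalerAr linearZ /= -exprD addnC.
have ij : (i + j < 9)%N by have := ltn_ord i; lia.
by rewrite -[X in 'X^X]/(val (Ordinal ij)) Lf_Xn mxE.
Qed.

(* Applying the functional of moments s to ('X - c) * p amounts to applying dstep c s to p. *)
Definition dstep {K : fieldType} (c : K) (s : seq K) :=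
  mkseq (fun i => s`_i.+1 - c * s`_i) (size s).-1.

Lemma Lf_vec_prod {K : fieldType} (cs : seq K) (s : seq K) :
  (size cs < size s)%N -> (size s <= 9)%N ->
  Lf (vec s) (\prod_(c <- cs) ('X - c%:P)) = (foldl (fun s c => dstep c s) s cs)`_0.
Proof.
elim: cs s => [|c cs IH] s /=.
  move=> s0 s9; rewrite big_nil Lf_vec big_ord_recl coef1 mul1r big1 ?addr0 // => i _.
  by rewrite coef1 mul0r.
move=> cs_s s9; have ss : size (dstep c s) = (size s).-1 by rewrite size_mkseq.
rewrite big_cons -IH ?ss; [|by move: cs_s; clear; lia|by move: s9; clear; lia].
set p := \prod_(c <- cs) _; have sp : size p = (size cs).+1 by exact: size_prod_XsubC.
have p0 i : ((size s).-1 <= i)%N -> p`_i = 0.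
  by move=> si; rewrite nth_default // sp (leq_trans _ si) //; move: cs_s; clear; lia.
have p8 : p`_8 = 0 by apply: p0; move: s9; clear; lia.
rewrite mulrBl linearB /= mul_polyC linearZ /= !Lf_vec.
rewrite big_ord_recl coefXM /= mul0r add0r.
rewrite [\sum_(i < 9) p`_i * s`_i]big_ord_recr [RHS]big_ord_recr /= p8 !mul0r !addr0.
rewrite mulr_sumr -sumrB; apply: eq_bigr => i _; rewrite coefXM /=.
by have [/p0 ->|si] := leqP (size s).-1 i; [rewrite !mul0r mulr0 subrr | rewrite nth_mkseq //; ring].
Qed.

(** The prefix [nseq j 0] multiplies by X^j, so apolarity becomes a computation with iterated
    differences. *)
Lemma kills_vec_prod {K : fieldType} (cs : seq K) (s : seq K) n :
  (size cs + n < size s)%N -> (size s <= 9)%N ->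
  (forall j, (j <= n)%N -> (foldl (fun s c => dstep c s) s (nseq j 0 ++ cs))`_0 = 0) ->
  kills (vec s) n (\prod_(c <- cs) ('X - c%:P)).
Proof.
move=> sn s9 H j jn; rewrite -(H j jn) -Lf_vec_prod //; last first.
  by rewrite size_cat size_nseq addnC (leq_ltn_trans _ sn) // leq_add2l.
by rewrite big_cat big_nseq /= subr0 iter_mulr_1.
Qed.

(** Entry j of the image is L((X + 1)^(8 - j)), the first term after 8 - j steps [dstep (-1)]; hence
    the reversal. *)
Lemma act_vec {K : fieldType} (s t : seq K) : size s = 9 ->
  [seq (foldl (fun s c => dstep c s) s (nseq k (-1)))`_0 | k <- iota 0 9] = rev t ->
  act 0 1 1 1 (vec s) = vec t.
Proof.
move=> ss H; have st : size t = 9 by rewrite -size_rev -H size_map size_iota.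
apply/rowP => j; have j8 : (8 - j < 9)%N by rewrite ltnS leq_subr.
have -> : (vec t) 0 j = (rev t)`_(8 - j).
  by rewrite mxE nth_rev st // subSS subKn // -ltnS.
rewrite -H (nth_map 0%N) ?size_iota // nth_iota // add0n -Lf_vec_prod ?size_nseq ?ss //.
rewrite mxE scale0r add0r expr1n mul1r scale1r big_nseq iter_mulr_1.
by rewrite polyCN opprK.
Qed.

(* Up to sign, h(X) h(-X) is the product of the x^2 - X^2 over the finite roots x of h. *)
Lemma lins_newton {R : realFieldType} (ts : seq (option R)) k :
  0 <= \sum_(i < k.*2.+1) (-1) ^+ (k + i) * (lins ts)`_i * (lins ts)`_(k.*2 - i).
Proof.
suff H : forall k, 0 <= (-1) ^+ k * (lins ts * (lins ts \Po - 'X))`_k.*2.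
  apply: le_trans (H k) _; rewrite mulrC [lins ts * _]mulrC coefM mulr_suml le_eqVlt.
  apply/orP; left; apply/eqP; apply: eq_bigr => i _.
  have -> : (lins ts \Po - 'X)`_i = (-1) ^+ i * (lins ts)`_i.
    have -> : lins ts \Po - 'X = \poly_(j < size (lins ts)) ((-1) ^+ j * (lins ts)`_j).
      rewrite comp_polyE poly_def; apply: eq_bigr => j _.
      have -> : (- 'X) ^+ j = (-1) ^+ j *: 'X^j :> {poly R}.
        by rewrite -mul_polyC [LHS]exprNn polyC_exp polyCN.
      by rewrite scalerA mulrC.
    by rewrite coef_poly; case: ltnP => // si; rewrite nth_default ?mulr0.
  by rewrite exprD; ring.
elim: ts => [|t ts IH] m.
  rewrite /lins big_nil comp_polyC mulr1 coef1.
  by case: m => [|m]; rewrite /= ?mulr0n ?mulr0 ?expr0 ?mul1r ?ler01.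
rewrite lins_cons comp_polyM mulrACA; set q := lins ts * _ in IH *.
case: t => [x|] /=; last by rewrite comp_polyC mul1r mul1r; exact: IH.
have -> : (x%:P - 'X) * ((x%:P - 'X) \Po - 'X) = (x ^+ 2)%:P - 'X^2.
  by rewrite comp_polyB comp_polyC comp_polyX polyC_exp; ring.
rewrite mulrBl coefB coefCM ['X^2 * q]mulrC coefMXn.
case: m => [|m] /=.
  by have := mulr_ge0 (sqr_ge0 x) (IH 0%N); rewrite !expr0 !mul1r subr0.
have h1 := IH m; have := mulr_ge0 (sqr_ge0 x) (IH m.+1); rewrite !exprS doubleS !subSS subn0.
by move: h1; lra.
Qed.

(** [lins_newton] for k = 1, ..., 6, with the coefficients above degree 7 set to zero. In the
    uniqueness lemmas this is all that is used of real-rootedness. *)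
Lemma newton_ineqs {R : realFieldType} (ts : seq (option R)) : (size ts <= 7)%N ->
  let e i := (lins ts)`_i in
  [/\ 0 <= e 1%N ^+ 2 - 2 * e 0%N * e 2%N,
      0 <= e 2%N ^+ 2 - 2 * e 1%N * e 3%N + 2 * e 0%N * e 4%N,
      0 <= e 3%N ^+ 2 - 2 * e 2%N * e 4%N + 2 * e 1%N * e 5%N - 2 * e 0%N * e 6%N,
      0 <= e 4%N ^+ 2 - 2 * e 3%N * e 5%N + 2 * e 2%N * e 6%N - 2 * e 1%N * e 7%N &
      0 <= e 5%N ^+ 2 - 2 * e 4%N * e 6%N + 2 * e 3%N * e 7%N /\
      0 <= e 6%N ^+ 2 - 2 * e 5%N * e 7%N].
Proof.
move=> st e; have e0 i : (7 < i)%N -> e i = 0.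
  by move=> i7; apply: nth_default; rewrite (leq_trans (size_lins_le _)) // (leq_ltn_trans st).
have N k := lins_newton ts k; rewrite -/e in N.
have e8 : e 8%N = 0 by exact: e0.
have e9 : e 9%N = 0 by exact: e0.
have e10 : e 10%N = 0 by exact: e0.
have e11 : e 11%N = 0 by exact: e0.
have e12 : e 12%N = 0 by exact: e0.
split; last split.
- by have := N 1%N; rewrite !big_ord_recr big_ord0 /= -!/(e _); lra.
- by have := N 2%N; rewrite !big_ord_recr big_ord0 /= -!/(e _); lra.
- by have := N 3%N; rewrite !big_ord_recr big_ord0 /= -!/(e _); lra.
- by have := N 4%N; rewrite !big_ord_recr big_ord0 /= -!/(e _) e8; lra.
- by have := N 5%N; rewrite !big_ord_recr big_ord0 /= -!/(e _) e8 e9 e10; lra.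
- by have := N 6%N; rewrite !big_ord_recr big_ord0 /= -!/(e _) e8 e9 e10 e11 e12; lra.
Qed.

(** Unique factorization recovers the finite roots, and equality of lengths the number of points at
    infinity. *)
Lemma lins_scale_perm {K : fieldType} (ts us : seq (option K)) c :
  size ts = size us -> lins ts = c *: lins us -> perm_eq ts us.
Proof.
move=> stu E.
have c0 : c != 0 by apply: contraNneq (lins_neq0 ts) => c0; rewrite E c0 scale0r.
have lE (l : seq (option K)) : lins l = (-1) ^+ size (pmap id l) *: \prod_(x <- pmap id l) ('X - x%:P).
  elim: l => [|[x|] l IH]; first by rewrite /lins !big_nil scale1r.
    rewrite lins_cons IH /= big_cons -scalerAr exprS mulN1r !scaleNr -scalerN -mulNr opprB.
    by [].
  by rewrite lins_cons IH /= mul1r.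
have pm : perm_eq (pmap id ts) (pmap id us).
  apply: prod_XsubC_eq; have mon (l : seq K) : \prod_(x <- l) ('X - x%:P) \is monic.
    exact: monic_prod_XsubC.
  have : exists2 d, d != 0 & \prod_(x <- pmap id ts) ('X - x%:P) = d *: \prod_(x <- pmap id us) ('X - x%:P).
    exists ((-1) ^+ size (pmap id ts) * c * (-1) ^+ size (pmap id us)).
      by rewrite !mulf_neq0 ?signr_eq0.
    move: E; rewrite !lE => /(congr1 (fun p => (-1) ^+ size (pmap id ts) *: p)).
    by rewrite !scalerA -expr2 sqrr_sign scale1r.
  move=> [d d0 Ed]; have := mon (pmap id ts); rewrite Ed monicE lead_coefZ.
  by have := mon (pmap id us); rewrite monicE => /eqP ->; rewrite mulr1 => /eqP ->; rewrite scale1r.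
have cE (l : seq (option K)) : perm_eq l (map Some (pmap id l) ++ nseq (size l - size (pmap id l)) None).
  elim: l => //= -[x|] l IH /=; first by rewrite subSS perm_cons.
  have le : (size (pmap id l) <= size l)%N by rewrite size_pmap count_size.
  by rewrite subSn //= perm_sym perm_catC /= perm_cons perm_catC perm_sym.
rewrite (permPl (cE ts)) (permPr (cE us)) stu (perm_size pm) perm_cat2r.
exact: perm_map.
Qed.

(** For determinant -1 the inverse matrix is (- de, be; ga, - al), which needs no division; it
    carries apolar polynomials back. *)
Lemma uniq_act {K : fieldType} (al be ga de : K) n r (a : 'rV[K]_9) (us : seq (option K)) :
  al * de - be * ga = -1 -> (r + n = 8)%N ->
  (forall ts, size ts = r -> kills a n (lins ts) -> perm_eq ts us) ->
  forall ts, size ts = r -> kills (act al be ga de a) n (lins ts) ->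
    perm_eq ts (map (mob al be ga de) us).
Proof.
move=> det rn H ts st kt.
have aK : act (- de) be ga (- al) (act al be ga de a) = a.
  have E : - (al * de - be * ga) = 1 by rewrite det opprK.
  by apply: actK; rewrite -?E; ring.
have d1 : - de * - al - be * ga != 0.
  by rewrite mulrNN mulrC det oppr_eq0 oner_eq0.
have str : (size ts + n = 8)%N by rewrite st.
have := kills_act_map d1 str kt; rewrite aK => /H; rewrite size_map => /(_ st) p.
have mE : map (mob al be ga de) (map (mob (- de) be ga (- al)) ts) = ts.
  rewrite -map_comp; apply: map_id_in => t _ /=.
  have d2 : al * de - be * ga != 0 by rewrite det oppr_eq0 oner_eq0.
  have := mobK d2 t; rewrite (_ : mob de (- be) (- ga) al t = mob (- de) be ga (- al) t) //.
  rewrite /mob; case: t => [x|]; last by rewrite oppr_eq0 invrN mulrN mulNr.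
  have -> : ga * x + - al = - (- ga * x + al) by ring.
  have -> : - de * x + be = - (de * x + - be) by ring.
  by rewrite oppr_eq0 invrN mulrNN.
by rewrite -mE perm_map.
Qed.

Lemma sign_changes_roots {R : rcfType} (p : {poly R}) x xs :
  path (fun y z => (y < z) && (p.[y] * p.[z] < 0)) x xs ->
  exists vs, [/\ size vs = size xs, uniq vs, all (root p) vs & all (> x) vs].
Proof.
elim: xs x => [|y xs IH] x /=; first by exists [::].
move=> /andP[/andP[xy sgn] /IH[vs [sv uv rv gv]]].
have [z zI rz] := poly_ivtoo (ltW xy) sgn.
move: zI; rewrite in_itv /= => /andP[xz zy]; exists (z :: vs); split=> /=.
- by rewrite sv.
- rewrite uv andbT; apply/negP => /(allP gv) /=; by rewrite ltNge (ltW zy).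
- by rewrite rz.
- by rewrite xz; apply: sub_all gv => v /=; exact: lt_trans.
Qed.

Lemma fiber_size_count n l (i : 'I_n.+1) : all (ltn^~ n.+1) l ->
  fiber_size (fun k : 'I_(size l) => inord (nth 0%N l k) : 'I_n.+1) i = count_mem (i : nat) l.
Proof.
move=> /all_nthP ln; rewrite /fiber_size -sum1_card -sum1_count (big_nth 0%N) big_mkord.
apply: eq_bigl => k; rewrite inE; have := ln 0%N k (ltn_ord k) => lk.
by apply/eqP/eqP => [<-|e]; [rewrite inordK | apply/val_inj; rewrite /= inordK].
Qed.

Lemma nondegenerate_vec {K : fieldType} (s : seq K) n : (n <= 8)%N ->
  (forall q : nat -> K, (forall j, (j <= 8 - n)%N -> \sum_(i < n.+1) q i * s`_(i + j) = 0) ->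
    forall i, (i <= n)%N -> q i = 0) ->
  nondegenerate (vec s) n.
Proof.
move=> n8 H q sq; have nn : (n + (8 - n) <= 8)%N by rewrite subnKC.
move=> /(kills_vec _ nn sq) /H q0; apply/polyP => i; rewrite coef0.
by have [/q0//|ni] := leqP i n; rewrite nth_default // (leq_trans sq).
Qed.

Lemma nondegenerate_pred {K : fieldType} (a : 'rV[K]_9) n :
  nondegenerate a n.+1 -> nondegenerate a n.
Proof.
move=> nd q sq kq; apply: nd => [|j jn]; first exact: leqW.
by apply: kq; apply: leq_trans jn _; rewrite leq_sub2l.
Qed.

(** A checkable certificate: [c] lists the coefficients of an apolar polynomial of degree r + 1
    whose sign changes along [x :: xs] give r + 1 simple real roots, and these persist nearby. *)
Lemma waring_near r n (s c : seq RR) x xs :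
  (r.+1 + n = 8)%N -> nondegenerate (vec s) n.+1 -> (size c <= r.+2)%N -> size xs = r.+1 ->
  (forall j, (j <= n)%N -> \sum_(i < r.+2) c`_i * s`_(i + j) = 0) ->
  path (fun y z => (y < z) && ((Poly c).[y] * (Poly c).[z] < 0)) x xs ->
  exists2 e, 0 < e & forall a, close e (vec s) a -> waring_decomp 8 r.+1 a.
Proof.
move=> rn nd sc sx eqs /[dup] pth /sign_changes_roots[vs [sv uv rv _]].
have sp : (size (Poly c) <= r.+2)%N by rewrite (leq_trans (size_Poly c)).
have kp : kills (vec s) n (Poly c).
  apply/(kills_vec _ _ sp) => [|j jn]; first by rewrite rn.
  by under eq_bigr do rewrite coef_Poly; exact: eqs.
have p0 : Poly c != 0.
  case: xs sx pth {sv} => // y xs _ /= /andP[/andP[_ h] _].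
  by apply: contraTneq h => ->; rewrite !horner0 mulr0 ltxx.
have [|d d0 E] := rp_roots p0 _ uv rv; first by rewrite sv sx.
have kv : kills (vec s) n (rp vs) by apply: (killsZ d0); rewrite -E.
have [|e e0 He] := simple_roots_open uv _ rn isT kv (nondegenerate_pred nd); first by rewrite sv.
exists e => // a /He[ws [uw sw kw]]; apply: (kills_waring uw sw); first by rewrite -rn leq_addr.
by rewrite -rn addKn.
Qed.

(** The conditions on a base form as computations on lists: [l] gives for each of the r roots its
    index in [pts], so multiplicities are counts, which must match the parts minus one. *)
Lemma dual_crl_boundary (pts : seq RR) (l : seq nat) (s : seq RR) r n :
  (0 < r)%N -> (0 < n)%N -> (r + n = 8)%N -> size pts = n -> size l = r ->
  all (ltn^~ n) l -> all (fun i => 0 < count_mem i l)%N (iota 0 n) ->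
  kills (vec s) n (\prod_(c <- [seq pts`_i | i <- l]) ('X - c%:P)) ->
  (forall i, (i < n)%N -> (1 < count_mem i l)%N ->
    0 < Lf (vec s) (\prod_(c <- nseq (count_mem i l).-1 pts`_i ++
      flatten [seq nseq (count_mem j l).+1 pts`_j | j <- iota 0 n & j != i]) ('X - c%:P))) ->
  (forall ts, size ts = r -> kills (vec s) n (lins ts) ->
    perm_eq ts [seq Some pts`_i | i <- l]) ->
  nondegenerate (vec s) n ->
  (exists2 e, 0 < e & forall a, close e (vec s) a -> waring_decomp 8 r.+1 a) ->
  forall lam z, [seq k.-1 | k <- lam] = [seq count_mem i l | i <- iota 0 n] ->
  dual_crl 8 lam z ->
  zariski_closure (top_boundary 8 r) z /\ zariski_closure (top_boundary 8 r.+1) z.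
Proof.
case: n => // n r0 _ rn sp sl ln cnt ks pos uq nd up lam z lamE dz; subst r.
pose g := fun k : 'I_(size l) => inord (nth 0%N l k) : 'I_n.+1.
pose rho0 : 'rV[RR]_n.+1 := \row_i pts`_i.
have fE i : fiber_size g i = count_mem (i : nat) l by exact: fiber_size_count.
have gE (k : 'I_(size l)) : g k = nth 0%N l k :> nat.
  by rewrite inordK //; exact: (allP ln) (mem_nth _ _).
have lE T (f : nat -> T) : [seq f (g k) | k <- enum 'I_(size l)] = [seq f i | i <- l].
  transitivity [seq f (nth 0%N l i) | i <- [seq val k | k <- enum 'I_(size l)]].
    by rewrite -map_comp; apply: eq_map => k /=; rewrite gE.
  by rewrite val_enum_ord -[in RHS](mkseq_nth 0%N l) /mkseq -map_comp.
have cE : configuration g rho0 = \prod_(c <- [seq pts`_i | i <- l]) ('X - c%:P).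
  rewrite configurationE -big_enum /=; under eq_bigr do rewrite mxE.
  by rewrite -(big_map (fun k => pts`_(g k)) predT (fun c => 'X - c%:P)) lE.
have [|||||e e0 He] := @local_boundary n.+1 (size l) g rho0 (vec s) r0 rn.
- by move=> i; rewrite fE; apply: (allP cnt); rewrite mem_iota /= add0n.
- move=> i; rewrite fE => /(pos _ (ltn_ord i)); rewrite mxE big_cat big_nseq iter_mulr_1; congr (_ < Lf _ (_ * _)).
  rewrite big_flatten big_map big_filter -[iota 0 n.+1]val_enum_ord big_map big_enum_cond /=; apply: eq_big => [j|j _].
    by rewrite -val_eqE.
  by rewrite big_cons big_nseq iter_mulr_1 -exprS fE mxE.
- move=> ts st kt; under eq_map do rewrite mxE.
  by rewrite (lE _ (fun i => Some pts`_i)); exact: uq.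
- exact: nd.
- exact: up.
have slam : size lam = n.+1 by have := congr1 size lamE; rewrite !size_map size_iota.
have dl : (n.+1 + \sum_(k <- lam) k.-1 = 8)%N.
  rewrite -(big_map predn predT id) lamE -[RHS]rn addnC; congr (_ + _)%N.
  rewrite big_map -[iota 0 n.+1]val_enum_ord big_map big_enum /=.
  rewrite (eq_bigr (fun i : 'I_n.+1 => \sum_(k | predT k && (g k == i)) 1)%N); last first.
    by move=> i _; rewrite -fE /fiber_size -sum1_card; apply: eq_bigl.
  by rewrite -(partition_big g predT) //= sum1_card card_ord.
have [ts sts kts] := (dual_crlP z dl).1 dz.
pose tt i := nth None ts (i : 'I_n.+1).
have kz : kills z n.+1 (\prod_i lin (tt i) ^+ fiber_size g i).
  move: kts; rewrite (big_nth (0%N, None)) size_zip sts minnn slam big_mkord.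
  congr (kills _ _ _); apply: eq_bigr => i _; rewrite nth_zip //= fE; congr (_ ^+ _).
  have := congr1 (fun l => nth 0%N l i) lamE; rewrite (nth_map 0%N) ?slam // => ->.
  by rewrite (nth_map 0%N) ?size_iota // nth_iota.
have k0 : kills (vec s) n.+1 (configuration g rho0) by rewrite cE.
split; apply: (zariski_configuration rn k0 e0 _ kz) => rho a cr ca ka.
  by have [] := He rho a cr ca ka.
by have [] := He rho a cr ca ka.
Qed.

(** The projectivity t -> 1 / (t + 1) sends 0, infinity and 1 to 1, 0 and 1/2. *)
Lemma mob_shift0 {K : fieldType} : mob 0 1 1 1 (Some 0) = Some (1 : K).
Proof. by rewrite /= mulr0 add0r oner_eq0 mul0r add0r divr1. Qed.

Lemma mob_shiftN {K : fieldType} : mob 0 1 1 1 None = Some (0 : K).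
Proof. by rewrite /= oner_eq0 mul0r. Qed.

Lemma mob_shift1 {R : realFieldType} : mob 0 1 1 1 (Some 1) = Some (1 / 2 : R).
Proof. by rewrite /= mul1r mul0r add0r -(natrD _ 1 1) pnatr_eq0. Qed.

Lemma sqr_le0 {R : realFieldType} (x : R) : x ^+ 2 <= 0 -> x = 0.
Proof. by move=> x2; apply/eqP; rewrite -sqrf_eq0 eq_le x2 sqr_ge0. Qed.

(* Newton's inequalities of [unique_53] in terms of b = e0/e2, u = (e1/e2)^2 and d = e4/e2. *)
Lemma no_roots_53 {R : realFieldType} (b u d : R) : 0 <= u ->
  0 <= 1 - 2 * b ^+ 2 - u / 10 ->
  0 <= u / 100 - 2 * d - 2 * u - 2 * b * (b / 10 - 1) ->
  0 <= u - 2 * d * (b / 10 - 1) -> 0 <= d ^+ 2 + u / 5 + 2 * (b / 10 - 1) -> False.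
Proof.
move=> u0 H0 H3 H5 H4.
have b1 : b <= 3 / 4 by nra.
have b2 : - (3 / 4) <= b by nra.
have d1 : - u <= 185 / 100 * d.
  have [d0|d0] := lerP 0 d; first by lra.
  have : 0 <= - d * (b + 3 / 4) by rewrite mulr_ge0 //; lra.
  have : 0 <= - d * (3 / 4 - b) by rewrite mulr_ge0 //; lra.
  lra.
have b3 := sqr_ge0 b.
have u1 : u <= 23 / 10 * b by lra.
have d2 : d <= 19 / 20 by lra.
have d3 : - (19 / 20) <= d by lra.
have : 0 <= (19 / 20 - d) * (d + 19 / 20) by rewrite mulr_ge0 //; lra.
lra.
Qed.

(* The moment vectors below are those of the six base points. Except in types (8) and (4,2,2)
   the multiple roots sit at 0 and infinity, where Newton's inequalities give uniqueness;
   afterwards t -> 1/(t+1) makes all roots finite. *)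
Lemma unique_8 {R : realFieldType} (ts : seq (option R)) :
  size ts = 7%N -> kills (vec [:: -7; 0; 7; 0; -8; 0; 7; 0; 0]) 1 (lins ts) ->
  perm_eq ts [:: Some 0; Some 0; Some 0; Some 0; Some 0; Some 0; Some 0].
Proof.
move=> st kt; have sl : (size (lins ts) <= 8)%N by rewrite (leq_trans (size_lins_le ts)) ?st.
have [|N1 N2 N3 N4 [N5 N6]] := @newton_ineqs _ ts; first by rewrite st.
have k j := (@kills_vec _ _ 1 7 _ isT sl).1 kt j.
have := k 1%N isT; have := k 0%N isT.
rewrite !big_ord_recr !big_ord0 /= {k}; set e := fun i => (lins ts)`_i.
rewrite -![(lins ts)`_ _]/(e _) in N1 N2 N3 N4 N5 N6 *.
move=> k0 k1.
have h5 : e 5%N = 8 / 7 * e 3%N - e 1%N by lra.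
have h6 : e 6%N = e 0%N - e 2%N + 8 / 7 * e 4%N by lra.
rewrite h5 h6 in N2 N3 N4 N5 N6 *.
(* Weighted by 5/2, 4, 11/2, 7, 8, 7, the inequalities [N1] to [N6] sum to minus a combination of
   these five squares with positive weights; the terms in [e 7] cancel. *)
have s0 := sqr_ge0 (e 0%N); have s1 := sqr_ge0 (e 1%N).
have s2 := sqr_ge0 (e 2%N - 4 * e 0%N); have s3 := sqr_ge0 (e 3%N - 14 / 5 * e 1%N).
have s4 := sqr_ge0 (e 4%N - 7 / 6 * e 2%N + 16 / 15 * e 0%N).
have h0 : e 0%N = 0 by apply: sqr_le0; lra.
have h1 : e 1%N = 0 by apply: sqr_le0; lra.
have h2 : e 2%N - 4 * e 0%N = 0 by apply: sqr_le0; lra.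
have h3 : e 3%N - 14 / 5 * e 1%N = 0 by apply: sqr_le0; lra.
have h4 : e 4%N - 7 / 6 * e 2%N + 16 / 15 * e 0%N = 0 by apply: sqr_le0; lra.
have {}h2 : e 2%N = 0 by lra.
have {}h3 : e 3%N = 0 by lra.
have {}h4 : e 4%N = 0 by lra.
have {}h5 : e 5%N = 0 by lra.
have {}h6 : e 6%N = 0 by lra.
apply: (@lins_scale_perm _ _ _ (- e 7%N)); first by rewrite st.
rewrite [LHS](polyE sl) !big_ord_recr big_ord0 /= -![(lins ts)`_ _]/(e _) h0 h1 h2 h3 h4 h5 h6.
rewrite /lins !big_cons big_nil /= -?mul_polyC ?polyCN ?polyC0 ?polyC1; ring.
Qed.

Lemma unique_44 {R : realFieldType} (ts : seq (option R)) :
  size ts = 6%N -> kills (vec [:: 1; 0; 2; 0; 0; 0; 2; 0; 1]) 2 (lins ts) ->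
  perm_eq ts [:: Some 0; Some 0; Some 0; None; None; None].
Proof.
move=> st kt; have sl : (size (lins ts) <= 7)%N by rewrite (leq_trans (size_lins_le ts)) ?st.
have [|N1 N2 N3 N4 _] := @newton_ineqs _ ts; first by rewrite st.
have k j := (@kills_vec _ _ 2 6 _ isT sl).1 kt j.
have := k 2%N isT; have := k 1%N isT; have := k 0%N isT.
rewrite !big_ord_recr !big_ord0 /= {k}; set e := fun i => (lins ts)`_i.
rewrite -![(lins ts)`_ _]/(e _) in N1 N2 N3 N4 *.
move=> k0 k1 k2.
have h7 : e 7%N = 0 by exact: nth_default.
rewrite h7 in N4.
have h2 : e 2%N = - (e 0%N / 2 + e 6%N) by lra.
have h4 : e 4%N = - (e 0%N + e 6%N / 2) by lra.
have h5 : e 5%N = - e 1%N by lra.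
have s0 := sqr_ge0 (e 0%N); have s6 := sqr_ge0 (e 6%N).
(* The sum of [N2] and [N4] is - 3/4 (e_0^2 + e_6^2), as the products e_1 e_3 cancel. *)
have h0 : e 0%N = 0 by apply: sqr_le0; move: N2 N4; rewrite h2 h4 h5; lra.
have h6 : e 6%N = 0 by apply: sqr_le0; move: N2 N4; rewrite h2 h4 h5; lra.
have {}h2 : e 2%N = 0 by rewrite h2 h0 h6; lra.
have {}h4 : e 4%N = 0 by rewrite h4 h0 h6; lra.
rewrite h0 h2 h4 h5 h6 in N2 N3 N4.
have h13 : e 1%N * e 3%N = 0 by lra.
have h1 : e 1%N = 0.
  move/eqP: h13; rewrite mulf_eq0 => /orP[/eqP //|/eqP h3].
  by apply: sqr_le0; move: N3; rewrite h3; lra.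
have {}h5 : e 5%N = 0 by rewrite h5 h1 oppr0.
apply: (@lins_scale_perm _ _ _ (- e 3%N)); first by rewrite st.
rewrite [LHS](polyE sl) !big_ord_recr big_ord0 /= -![(lins ts)`_ _]/(e _) h0 h1 h2 h4 h5 h6.
rewrite /lins !big_cons big_nil /= -?mul_polyC ?polyCN ?polyC0 ?polyC1; ring.
Qed.

Lemma unique_53 {R : realFieldType} (ts : seq (option R)) :
  size ts = 6%N -> kills (vec [:: 0; 1; 0; -10; 0; 0; 0; -10; 0]) 2 (lins ts) ->
  perm_eq ts [:: Some 0; Some 0; Some 0; Some 0; None; None].
Proof.
move=> st kt; have sl : (size (lins ts) <= 7)%N by rewrite (leq_trans (size_lins_le ts)) ?st.
have [|N1 N2 N3 N4 [N5 N6]] := @newton_ineqs _ ts; first by rewrite st.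
have k j := (@kills_vec _ _ 2 6 _ isT sl).1 kt j.
have := k 2%N isT; have := k 1%N isT; have := k 0%N isT.
rewrite !big_ord_recr !big_ord0 /= {k}; set e := fun i => (lins ts)`_i.
rewrite -![(lins ts)`_ _]/(e _) in N1 N2 N3 N4 N5 N6 *.
move=> k0 k1 k2.
have h7 : e 7%N = 0 by exact: nth_default.
rewrite h7 in N4 N5.
have h3 : e 3%N = e 1%N / 10 by lra.
have h6 : e 6%N = e 0%N / 10 - e 2%N by lra.
have h5 : e 5%N = - e 1%N by lra.
rewrite h3 h5 h6 in N2 N3 N4 N5.
have h2 : e 2%N = 0.
  apply/eqP/negPn/negP => h2.
  have p2 : 0 <= (e 2%N) ^- 2 by rewrite invr_ge0 sqr_ge0.
  apply: (@no_roots_53 _ (e 0%N / e 2%N) ((e 1%N / e 2%N) ^+ 2) (e 4%N / e 2%N)).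
  - exact: sqr_ge0.
  (* The numerator is N2 + 10 (N1 + N3 + N5), in which all cross terms cancel. *)
  - rewrite (_ : _ - _ = ((e 2%N) ^+ 2 - 2 * e 0%N ^+ 2 - e 1%N ^+ 2 / 10) * (e 2%N) ^- 2); last by field.
    by rewrite mulr_ge0 //; lra.
  - move: (mulr_ge0 N3 p2); congr (_ <= _); field; exact: h2.
  - move: (mulr_ge0 N5 p2); congr (_ <= _); field; exact: h2.
  - move: (mulr_ge0 N4 p2); congr (_ <= _); field; exact: h2.
have s0 := sqr_ge0 (e 0%N); have s1 := sqr_ge0 (e 1%N).
have h0 : e 0%N = 0 by apply: sqr_le0; move: N1 N2 N3 N5; rewrite h2; lra.
have h1 : e 1%N = 0 by apply: sqr_le0; move: N1 N2 N3 N5; rewrite h2; lra.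
have {}h3 : e 3%N = 0 by rewrite h3 h1 mul0r.
have {}h5 : e 5%N = 0 by rewrite h5 h1 oppr0.
have {}h6 : e 6%N = 0 by rewrite h6 h0 h2 mul0r subr0.
apply: (@lins_scale_perm _ _ _ (e 4%N)); first by rewrite st.
rewrite [LHS](polyE sl) !big_ord_recr big_ord0 /= -![(lins ts)`_ _]/(e _) h0 h1 h2 h3 h5 h6.
rewrite /lins !big_cons big_nil /= -?mul_polyC ?polyCN ?polyC0 ?polyC1; ring.
Qed.

Lemma unique_62 {R : realFieldType} (ts : seq (option R)) :
  size ts = 6%N -> kills (vec [:: 10; 0; -1; 0; 10; 0; 0; 0; 10]) 2 (lins ts) ->
  perm_eq ts [:: Some 0; Some 0; Some 0; Some 0; Some 0; None].
Proof.
move=> st kt; have sl : (size (lins ts) <= 7)%N by rewrite (leq_trans (size_lins_le ts)) ?st.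
have [|N1 N2 N3 N4 _] := @newton_ineqs _ ts; first by rewrite st.
have k j := (@kills_vec _ _ 2 6 _ isT sl).1 kt j.
have := k 2%N isT; have := k 1%N isT; have := k 0%N isT.
rewrite !big_ord_recr !big_ord0 /= {k}; set e := fun i => (lins ts)`_i.
rewrite -![(lins ts)`_ _]/(e _) in N1 N2 N3 N4 *.
move=> k0 k1 k2.
have h7 : e 7%N = 0 by exact: nth_default.
rewrite h7 in N4.
have h4 : e 4%N = e 2%N / 10 - e 0%N by lra.
have h3 : e 3%N = e 1%N / 10 by lra.
have h6 : e 6%N = e 0%N / 10 - e 2%N by lra.
rewrite h3 h4 h6 in N2 N3 N4.
(* N3 + 10 (N2 + N4) is free of [e 5] and equals minus 7.2 e_0^2 + 1.99 e_1^2 + 7.1 e_2^2 + 3 (e_0 -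
   e_2)^2. *)
have s0 := sqr_ge0 (e 0%N); have s1 := sqr_ge0 (e 1%N); have s2 := sqr_ge0 (e 2%N).
have s3 := sqr_ge0 (e 0%N - e 2%N).
have h0 : e 0%N = 0 by apply: sqr_le0; lra.
have h1 : e 1%N = 0 by apply: sqr_le0; lra.
have h2 : e 2%N = 0 by apply: sqr_le0; lra.
have {}h3 : e 3%N = 0 by rewrite h3 h1 mul0r.
have {}h4 : e 4%N = 0 by rewrite h4 h0 h2 mul0r subr0.
have {}h6 : e 6%N = 0 by rewrite h6 h0 h2 mul0r subr0.
apply: (@lins_scale_perm _ _ _ (- e 5%N)); first by rewrite st.
rewrite [LHS](polyE sl) !big_ord_recr big_ord0 /= -![(lins ts)`_ _]/(e _) h0 h1 h2 h3 h4 h6.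
rewrite /lins !big_cons big_nil /= -?mul_polyC ?polyCN ?polyC0 ?polyC1; ring.
Qed.

Lemma unique_422 {R : realFieldType} (ts : seq (option R)) :
  size ts = 5%N -> kills (vec [:: 1; 0; 2; 0; 1; 0; 1; 0; 1]) 3 (lins ts) ->
  perm_eq ts [:: Some 0; Some 0; Some 0; Some 1; Some (-1)].
Proof.
move=> st kt; have sl : (size (lins ts) <= 6)%N by rewrite (leq_trans (size_lins_le ts)) ?st.
have [|N1 _ _ _ _] := @newton_ineqs _ ts; first by rewrite st.
have k j := (@kills_vec _ _ 3 5 _ isT sl).1 kt j.
have := k 3%N isT; have := k 2%N isT; have := k 1%N isT; have := k 0%N isT.
rewrite !big_ord_recr !big_ord0 /= {k}; set e := fun i => (lins ts)`_i.
rewrite -![(lins ts)`_ _]/(e _) in N1 *.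
move=> k0 k1 k2 k3.
have h2 : e 2%N = e 0%N by lra.
have h0 : e 0%N = 0 by apply: sqr_le0; move: N1; rewrite h2 (_ : e 1%N = 0); lra.
have h1 : e 1%N = 0 by lra.
rewrite h0 in h2.
have h4 : e 4%N = 0 by lra.
have h5 : e 5%N = - e 3%N by lra.
apply: (@lins_scale_perm _ _ _ (e 3%N)); first by rewrite st.
rewrite [LHS](polyE sl) !big_ord_recr big_ord0 /= -![(lins ts)`_ _]/(e _) h0 h1 h2 h4 h5.
rewrite /lins !big_cons big_nil /= -?mul_polyC ?polyCN ?polyC0 ?polyC1; ring.
Qed.

Lemma unique_332 {R : realFieldType} (ts : seq (option R)) :
  size ts = 5%N -> kills (vec [:: -2; -2; 1; 1; 1; 1; 1; -2; -2]) 3 (lins ts) ->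
  perm_eq ts [:: Some 0; Some 0; None; None; Some 1].
Proof.
move=> st kt; have sl : (size (lins ts) <= 6)%N by rewrite (leq_trans (size_lins_le ts)) ?st.
have [|N1 _ _ N4 _] := @newton_ineqs _ ts; first by rewrite st.
have k j := (@kills_vec _ _ 3 5 _ isT sl).1 kt j.
have := k 3%N isT; have := k 2%N isT; have := k 1%N isT; have := k 0%N isT.
rewrite !big_ord_recr !big_ord0 /= {k}; set e := fun i => (lins ts)`_i.
rewrite -![(lins ts)`_ _]/(e _) in N1 N4 *.
move=> k0 k1 k2 k3.
have h1 : e 1%N = 0 by lra.
have h4 : e 4%N = 0 by lra.
have h5 : e 5%N = e 0%N by lra.
have h3 : e 3%N = e 0%N - e 2%N by lra.
(* The sum of [N1] and [N4] is - 2 e_0^2. *)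
have h0 : e 0%N = 0.
  have e60 : e 6%N = 0 by apply: nth_default.
  apply: sqr_le0; move: N1 N4; rewrite h1 h4 h5 h3 e60; lra.
rewrite h0 sub0r in h3 h5.
apply: (@lins_scale_perm _ _ _ (e 2%N)); first by rewrite st.
rewrite [LHS](polyE sl) !big_ord_recr big_ord0 /= -![(lins ts)`_ _]/(e _) h0 h1 h3 h4 h5.
rewrite /lins !big_cons big_nil /= -?mul_polyC ?polyCN ?polyC0 ?polyC1; ring.
Qed.

(** * Lower bound: each dual variety lies in two boundaries *)

Lemma boundary_8 z : dual_crl 8 [:: 8]%N z ->
  zariski_closure (top_boundary 8 7) z /\ zariski_closure (top_boundary 8 8) z.
Proof.
pose s : seq RR := [:: -7; 0; 7; 0; -8; 0; 7; 0; 0].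
have nd : nondegenerate (vec s) 1.
  apply: nondegenerate_vec => // q k.
  have := k 7%N isT; have := k 6%N isT; have := k 5%N isT; have := k 4%N isT; have := k 3%N isT; have := k 2%N isT; have := k 1%N isT; have := k 0%N isT.
  rewrite !big_ord_recr !big_ord0 /= {k} => k0 k1 k2 k3 k4 k5 k6 k7.
  case=> [|[|//]] _; lra.
apply: (@dual_crl_boundary [:: 0] [:: 0; 0; 0; 0; 0; 0; 0]%N s 7 1) => //.
- apply: kills_vec_prod => // -[|[|//]] _ /=; lra.
- case=> [|//] //= _ _; (rewrite Lf_vec_prod; [rewrite /=; lra | by [] | by []]).
- exact: unique_8.
(* Rank 8 is maximal, so any neighbourhood serves. *)
- by exists 1 => // a _; exact: waring8.
Qed.

Lemma boundary_44 z : dual_crl 8 [:: 4; 4]%N z ->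
  zariski_closure (top_boundary 8 6) z /\ zariski_closure (top_boundary 8 7) z.
Proof.
(* The moments [s0] of [unique_44] after t -> 1 / (t + 1): the triple roots at 0 and infinity become
   triple roots at 1 and 0. *)
pose s : seq RR := [:: 114; 57; 33; 21; 13; 7; 3; 1; 1].
pose s0 : seq RR := [:: 1; 0; 2; 0; 0; 0; 2; 0; 1].
have sE : act 0 1 1 1 (vec s0) = vec s by apply: act_vec => //=; do ?congr (_ :: _); lra.
have nd : nondegenerate (vec s) 2.
  apply: nondegenerate_vec => // q k.
  have := k 6%N isT; have := k 5%N isT; have := k 4%N isT; have := k 3%N isT; have := k 2%N isT; have := k 1%N isT; have := k 0%N isT.
  rewrite !big_ord_recr !big_ord0 /= {k} => k0 k1 k2 k3 k4 k5 k6.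
  case=> [|[|[|//]]] _; lra.
apply: (@dual_crl_boundary [:: 1; 0] [:: 0; 0; 0; 1; 1; 1]%N s 6 2) => //.
- apply: kills_vec_prod => // -[|[|[|//]]] _ /=; lra.
- case=> [|[|//]] //= _ _; (rewrite Lf_vec_prod; [rewrite /=; lra | by [] | by []]).
- rewrite -sE => ts st kt.
  have d1 : 0 * 1 - 1 * 1 = -1 :> RR by rewrite mul0r mul1r sub0r.
  have := uniq_act d1 (erefl : 6 + 2 = 8)%N (@unique_44 _) st kt.
  by rewrite !map_cons !mob_shift0 ?mob_shiftN.
(* A polynomial of degree 7 apolar to [s], with eight sample points that interlace its seven real
   roots. *)
- apply: (@waring_near 6 1 s [:: 0; -12; 76; -105; -15; 107; -61; 10] (-2) [:: -(1/2); 1/5; 1/2; 7/8; 3/2; 5/2; 4]) => //.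
    move=> j jn; rewrite !big_ord_recr big_ord0 /=.
    case: j jn => [|[|//]] _ /=; lra.
  have pth (R : realFieldType) : let p : {poly R} := Poly [:: 0; -12; 76; -105; -15; 107; -61; 10] in
      path (fun y z => (y < z) && (p.[y] * p.[z] < 0)) (-2) [:: -(1/2); 1/5; 1/2; 7/8; 3/2; 5/2; 4].
    by move=> p; rewrite /= /p !horner_Poly /= andbT; do ?[apply/andP; split]; lra.
  exact: pth.
Qed.

Lemma boundary_53 z : dual_crl 8 [:: 5; 3]%N z ->
  zariski_closure (top_boundary 8 6) z /\ zariski_closure (top_boundary 8 7) z.
Proof.
pose s : seq RR := [:: -632; -353; -194; -95; -36; -7; 2; 1; 0].
pose s0 : seq RR := [:: 0; 1; 0; -10; 0; 0; 0; -10; 0].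
have sE : act 0 1 1 1 (vec s0) = vec s by apply: act_vec => //=; do ?congr (_ :: _); lra.
have nd : nondegenerate (vec s) 2.
  apply: nondegenerate_vec => // q k.
  have := k 6%N isT; have := k 5%N isT; have := k 4%N isT; have := k 3%N isT; have := k 2%N isT; have := k 1%N isT; have := k 0%N isT.
  rewrite !big_ord_recr !big_ord0 /= {k} => k0 k1 k2 k3 k4 k5 k6.
  case=> [|[|[|//]]] _; lra.
apply: (@dual_crl_boundary [:: 1; 0] [:: 0; 0; 0; 0; 1; 1]%N s 6 2) => //.
- apply: kills_vec_prod => // -[|[|[|//]]] _ /=; lra.
- case=> [|[|//]] //= _ _; (rewrite Lf_vec_prod; [rewrite /=; lra | by [] | by []]).
- rewrite -sE => ts st kt.
  have d1 : 0 * 1 - 1 * 1 = -1 :> RR by rewrite mul0r mul1r sub0r.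
  have := uniq_act d1 (erefl : 6 + 2 = 8)%N (@unique_53 _) st kt.
  by rewrite !map_cons !mob_shift0 ?mob_shiftN.
- apply: (@waring_near 6 1 s [:: 0; 45; -101; 0; 109; -37; -28; 12] (-2) [:: -(3/2); -1; 1/2; 3/4; 4/3; 2; 3]) => //.
    move=> j jn; rewrite !big_ord_recr big_ord0 /=.
    case: j jn => [|[|//]] _ /=; lra.
  have pth (R : realFieldType) : let p : {poly R} := Poly [:: 0; 45; -101; 0; 109; -37; -28; 12] in
      path (fun y z => (y < z) && (p.[y] * p.[z] < 0)) (-2) [:: -(3/2); -1; 1/2; 3/4; 4/3; 2; 3].
    by move=> p; rewrite /= /p !horner_Poly /= andbT; do ?[apply/andP; split]; lra.
  exact: pth.
Qed.

Lemma boundary_62 z : dual_crl 8 [:: 6; 2]%N z ->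
  zariski_closure (top_boundary 8 6) z /\ zariski_closure (top_boundary 8 7) z.
Proof.
pose s : seq RR := [:: 692; 339; 145; 50; 14; 7; 9; 10; 10].
pose s0 : seq RR := [:: 10; 0; -1; 0; 10; 0; 0; 0; 10].
have sE : act 0 1 1 1 (vec s0) = vec s by apply: act_vec => //=; do ?congr (_ :: _); lra.
have nd : nondegenerate (vec s) 2.
  apply: nondegenerate_vec => // q k.
  have := k 6%N isT; have := k 5%N isT; have := k 4%N isT; have := k 3%N isT; have := k 2%N isT; have := k 1%N isT; have := k 0%N isT.
  rewrite !big_ord_recr !big_ord0 /= {k} => k0 k1 k2 k3 k4 k5 k6.
  case=> [|[|[|//]]] _; lra.
apply: (@dual_crl_boundary [:: 1; 0] [:: 0; 0; 0; 0; 0; 1]%N s 6 2) => //.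
- apply: kills_vec_prod => // -[|[|[|//]]] _ /=; lra.
- case=> [|[|//]] //= _ _; (rewrite Lf_vec_prod; [rewrite /=; lra | by [] | by []]).
- rewrite -sE => ts st kt.
  have d1 : 0 * 1 - 1 * 1 = -1 :> RR by rewrite mul0r mul1r sub0r.
  have := uniq_act d1 (erefl : 6 + 2 = 8)%N (@unique_62 _) st kt.
  by rewrite !map_cons !mob_shift0 ?mob_shiftN.
- apply: (@waring_near 6 1 s [:: 0; 6; 15; -48; -136; -64; 37; 21] (-3) [:: -1; -(4/5); -(1/2); -(1/4); 1/3; 1; 3]) => //.
    move=> j jn; rewrite !big_ord_recr big_ord0 /=.
    case: j jn => [|[|//]] _ /=; lra.
  have pth (R : realFieldType) : let p : {poly R} := Poly [:: 0; 6; 15; -48; -136; -64; 37; 21] in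
      path (fun y z => (y < z) && (p.[y] * p.[z] < 0)) (-3) [:: -1; -(4/5); -(1/2); -(1/4); 1/3; 1; 3].
    by move=> p; rewrite /= /p !horner_Poly /= andbT; do ?[apply/andP; split]; lra.
  exact: pth.
Qed.

Lemma boundary_422 z : dual_crl 8 [:: 4; 2; 2]%N z ->
  zariski_closure (top_boundary 8 5) z /\ zariski_closure (top_boundary 8 6) z.
Proof.
pose s : seq RR := [:: 1; 0; 2; 0; 1; 0; 1; 0; 1].
have nd : nondegenerate (vec s) 3.
  apply: nondegenerate_vec => // q k.
  have := k 5%N isT; have := k 4%N isT; have := k 3%N isT; have := k 2%N isT; have := k 1%N isT; have := k 0%N isT.
  rewrite !big_ord_recr !big_ord0 /= {k} => k0 k1 k2 k3 k4 k5.
  case=> [|[|[|[|//]]]] _; lra.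
apply: (@dual_crl_boundary [:: 0; 1; -1] [:: 0; 0; 0; 1; 2]%N s 5 3) => //.
- apply: kills_vec_prod => // -[|[|[|[|//]]]] _ /=; lra.
- case=> [|[|[|//]]] //= _ _; (rewrite Lf_vec_prod; [rewrite /=; lra | by [] | by []]).
- exact: unique_422.
- apply: (@waring_near 5 2 s [:: 0; 45; 0; -194; -32; 104; 32] (-4) [:: -2; -1; -(1/2); 1/3; 1; 2]) => //.
    move=> j jn; rewrite !big_ord_recr big_ord0 /=.
    case: j jn => [|[|[|//]]] _ /=; lra.
  have pth (R : realFieldType) : let p : {poly R} := Poly [:: 0; 45; 0; -194; -32; 104; 32] in
      path (fun y z => (y < z) && (p.[y] * p.[z] < 0)) (-4) [:: -2; -1; -(1/2); 1/3; 1; 2].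
    by move=> p; rewrite /= /p !horner_Poly /= andbT; do ?[apply/andP; split]; lra.
  exact: pth.
Qed.

Lemma boundary_332 z : dual_crl 8 [:: 3; 3; 2]%N z ->
  zariski_closure (top_boundary 8 5) z /\ zariski_closure (top_boundary 8 6) z.
Proof.
(* The moments [s0] of [unique_332] after the projectivity: double roots at 1 and 0, a simple root
   at 1/2. *)
pose s : seq RR := [:: 202; 101; 43; 14; 1; -4; -5; -4; -2].
pose s0 : seq RR := [:: -2; -2; 1; 1; 1; 1; 1; -2; -2].
have sE : act 0 1 1 1 (vec s0) = vec s by apply: act_vec => //=; do ?congr (_ :: _); lra.
have nd : nondegenerate (vec s) 3.
  apply: nondegenerate_vec => // q k.
  have := k 5%N isT; have := k 4%N isT; have := k 3%N isT; have := k 2%N isT; have := k 1%N isT; have := k 0%N isT.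
  rewrite !big_ord_recr !big_ord0 /= {k} => k0 k1 k2 k3 k4 k5.
  case=> [|[|[|[|//]]]] _; lra.
apply: (@dual_crl_boundary [:: 1; 0; 1 / 2] [:: 0; 0; 1; 1; 2]%N s 5 3) => //.
- apply: kills_vec_prod => // -[|[|[|[|//]]]] _ /=; lra.
- case=> [|[|[|//]]] //= _ _; (rewrite Lf_vec_prod; [rewrite /=; lra | by [] | by []]).
- rewrite -sE => ts st kt.
  have d1 : 0 * 1 - 1 * 1 = -1 :> RR by rewrite mul0r mul1r sub0r.
  have := uniq_act d1 (erefl : 5 + 3 = 8)%N (@unique_332 _) st kt.
  by rewrite !map_cons !mob_shift0 ?mob_shiftN ?mob_shift1.
- apply: (@waring_near 5 2 s [:: 4; -24; 37; 11; -47; 13; 6] (-5) [:: -3; 0; 2/5; 1/2; 7/6; 2]) => //.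
    move=> j jn; rewrite !big_ord_recr big_ord0 /=.
    case: j jn => [|[|[|//]]] _ /=; lra.
  have pth (R : realFieldType) : let p : {poly R} := Poly [:: 4; -24; 37; 11; -47; 13; 6] in
      path (fun y z => (y < z) && (p.[y] * p.[z] < 0)) (-5) [:: -3; 0; 2/5; 1/2; 7/6; 2].
    by move=> p; rewrite /= /p !horner_Poly /= andbT; do ?[apply/andP; split]; lra.
  exact: pth.
Qed.

(** * Conclusion *)

(** A finite union of closed sets is closed: the separating functions are multiplied. *)
Lemma polyfun_separates_seq (lams : seq (seq nat)) z :
  all (fun lam => all (ltn 1) lam && (\sum_(k <- lam) k.-1 <= 8)%N) lams ->
  (forall lam, lam \in lams -> ~ dual_crl 8 lam z) ->
  exists2 F, polyfun F & (forall lam w, lam \in lams -> dual_crl 8 lam w -> F w = 0) /\ F z != 0.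
Proof.
elim: lams => [|lam lams IH] /=; first by exists (fun=> 1); [exact: polyfun_cst | rewrite oner_eq0].
move=> /andP[/andP[l1 l8] ls] H.
have [G pG [G0 Gz]] := IH ls (fun mu h => H mu (mem_behead (s := lam :: lams) h)).
have [F pF [F0 Fz]] := polyfun_separates l1 (subnK l8) (H lam (mem_head _ _)).
exists (fun w => F w * G w); first exact: polyfunM.
split; last by rewrite mulf_neq0.
move=> mu w; rewrite inE => /predU1P[->|h] dw; first by rewrite F0 ?mul0r.
by rewrite (G0 mu) ?mulr0.
Qed.

Lemma zariski_closure_sub (S : set 'rV[RR]_9) (lams : seq (seq nat)) z :
  all (fun lam => all (ltn 1) lam && (\sum_(k <- lam) k.-1 <= 8)%N) lams ->
  (forall a, S a -> exists2 lam, lam \in lams & dual_crl 8 lam (complexify a)) ->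
  zariski_closure S z -> exists2 lam, lam \in lams & dual_crl 8 lam z.
Proof.
move=> ok HS cz; apply: contrapT => no.
have [lam h dz|F [P PE] [F0]] := @polyfun_separates_seq lams z ok.
  by apply: no; exists lam.
rewrite PE cz ?eqxx // => a /HS[lam h dw].
by rewrite -PE (F0 lam).
Qed.

Theorem theorem5p1 :
  rank_boundary 8 5 = dual_crl 8 [:: 3; 3; 2]%N `|` dual_crl 8 [:: 4; 2; 2]%N /\
  rank_boundary 8 6 = dual_crl 8 [:: 3; 3; 2]%N `|` dual_crl 8 [:: 4; 2; 2]%N
                      `|` dual_crl 8 [:: 4; 4]%N `|` dual_crl 8 [:: 5; 3]%N
                      `|` dual_crl 8 [:: 6; 2]%N /\
  rank_boundary 8 7 = dual_crl 8 [:: 4; 4]%N `|` dual_crl 8 [:: 5; 3]%N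
                      `|` dual_crl 8 [:: 6; 2]%N `|` dual_crl 8 [:: 8]%N /\
  rank_boundary 8 8 = dual_crl 8 [:: 8]%N.
Proof.
have sums (lams : seq (seq nat)) : {subset lams <= [:: [:: 3; 3; 2]; [:: 4; 2; 2]; [:: 4; 4]; [:: 5; 3]; [:: 6; 2]; [:: 8]]%N} ->
    all (fun lam => all (ltn 1) lam && (\sum_(k <- lam) k.-1 <= 8)%N) lams.
  by move=> h; apply/allP => lam /h; rewrite !inE => /or3P[|| /or4P[]] /eqP ->; rewrite /= ?big_cons big_nil.
split; [|split; [|split]]; apply/seteqP; split=> z.
- move=> /(zariski_closure_sub (lams := [:: [:: 3; 3; 2]; [:: 4; 2; 2]]%N)); case.
  + by apply: sums => l; rewrite !inE => /orP[] /eqP ->.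
  + move=> a /top_boundary_5 /dual_53[] h; [exists [:: 3; 3; 2]%N | exists [:: 4; 2; 2]%N] => //.
  + by move=> lam; rewrite !inE => /orP[] /eqP ->; [left | right].
- by case=> [/boundary_332[]|/boundary_422[]].
- move=> /(zariski_closure_sub (lams := [:: [:: 3; 3; 2]; [:: 4; 2; 2]; [:: 4; 4]; [:: 5; 3]; [:: 6; 2]]%N)); case.
  + by apply: sums => l; rewrite !inE => /or4P[||| /orP[]] /eqP ->.
  + move=> a /top_boundary_6[/dual_62[||]|/dual_53[]] h.
    * by exists [:: 4; 4]%N.
    * by exists [:: 5; 3]%N.
    * by exists [:: 6; 2]%N.
    * by exists [:: 3; 3; 2]%N.
    * by exists [:: 4; 2; 2]%N.
  + move=> lam; rewrite !inE => /or4P[||| /orP[]] /eqP -> h.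
    * by do 4 left.
    * by do 3 left; right.
    * by do 2 left; right.
    * by left; right.
    * by right.
- by case=> [[[[]|]|]|] => [/boundary_332[]|/boundary_422[]|/boundary_44[]|/boundary_53[]|/boundary_62[]].
- move=> /(zariski_closure_sub (lams := [:: [:: 4; 4]; [:: 5; 3]; [:: 6; 2]; [:: 8]]%N)); case.
  + by apply: sums => l; rewrite !inE => /or4P[] /eqP ->.
  + move=> a /top_boundary_7[/dual_71|/dual_62[||]] h.
    * by exists [:: 8]%N.
    * by exists [:: 4; 4]%N.
    * by exists [:: 5; 3]%N.
    * by exists [:: 6; 2]%N.
  + move=> lam; rewrite !inE => /or4P[] /eqP -> h.
    * by do 3 left.
    * by do 2 left; right.
    * by left; right.
    * by right.
- by case=> [[[]|]|] => [/boundary_44[]|/boundary_53[]|/boundary_62[]|/boundary_8[]].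
- move=> /(zariski_closure_sub (lams := [:: [:: 8]]%N)); case.
  + by apply: sums => l; rewrite !inE => /eqP ->.
  + by move=> a /top_boundary_8 /dual_71 h; exists [:: 8]%N.
  + by move=> lam; rewrite inE => /eqP ->.
- by move=> /boundary_8[].
Qed.
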